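(* Let $p\ge 0$ and $\lambda>0$ be real, and let $\gamma,\vartheta,\upsilon,\sigma,z\in\mathbb{C}$, $a\in\mathbb{C}\setminus\{0,-1,-2,\dots\}$ with $\Re(\upsilon)>\Re(\vartheta)>0$, and either $|z|<1$, or $|z|=1$ and $\Re(\sigma+\upsilon-\gamma-\vartheta)>1$. Assume that the integrals defining $B(\vartheta+n,\upsilon-\vartheta;p,\lambda)$, $n\in\mathbb{N}_0$, converge absolutely. Then, provided that the integrals on the right-hand sides converge: (i) $$\Phi_{\gamma,\vartheta;\upsilon}(z,\sigma,a;p,\lambda)=\frac{1}{B(\vartheta,\upsilon-\vartheta)}\int_0^\infty\frac{x^{\vartheta-1}}{(1+x)^\upsilon}\,E_\lambda\Big(-p\big(2+x+\tfrac1x\big)\Big)\,\Phi_\gamma^*\Big(\frac{zx}{1+x},\sigma,a\Big)\,dx ;$$ (ii) if moreover $\min\{\Re(\sigma),\Re(a)\}>0$, $$\Phi_{\gamma,\vartheta;\upsilon}(z,\sigma,a;p,\lambda)=\frac{1}{\Gamma(\sigma)\,B(\vartheta,\upsilon-\vartheta)}\int_0^\infty\!\!\int_0^\infty\frac{t^{\sigma-1}e^{-at}x^{\vartheta-1}}{(1+x)^\upsilon}\,E_\lambda\Big(-p\big(2+x+\tfrac1x\big)\Big)\Big(1-\frac{zxe^{-t}}{1+x}\Big)^{-\gamma}\,dt\,dx .$$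
   Context: $\mathbb{N}_0=\{0,1,2,\dots\}$; $(\gamma)_n=\gamma(\gamma+1)\cdots(\gamma+n-1)$, $(\gamma)_0=1$, is the Pochhammer symbol; $B(x,y)$ is the classical beta function; complex powers are principal. The Mittag-Leffler function is $E_\lambda(w)=\sum_{n=0}^\infty \frac{w^n}{\Gamma(\lambda n+1)}$. For $\Re(x)>0$, $\Re(y)>0$ the extended beta function is $$B(x,y;p,\lambda)=\int_0^1 t^{x-1}(1-t)^{y-1}E_\lambda\Big(-\frac{p}{t(1-t)}\Big)dt$$ (when this integral converges). The extended Hurwitz-Lerch Zeta function is $$\Phi_{\gamma,\vartheta;\upsilon}(z,\sigma,a;p,\lambda)=\sum_{n=0}^\infty\frac{(\gamma)_n\,B(\vartheta+n,\upsilon-\vartheta;p,\lambda)}{B(\vartheta,\upsilon-\vartheta)\,n!}\frac{z^n}{(n+a)^\sigma},$$ for $p\ge0$, $\lambda>0$, $a\in\mathbb{C}\setminus\{0,-1,-2,\dots\}$, with $\sigma\in\mathbb{C}$ arbitrary when $|z|<1$ and $\Re(\sigma+\upsilon-\gamma-\vartheta)>1$ when $|z|=1$. The Goyal-Laddha function is $$\Phi_\gamma^*(w,\sigma,a)=\sum_{n=0}^\infty\frac{(\gamma)_n}{n!}\frac{w^n}{(n+a)^\sigma}\qquad(|w|<1).$$ *)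

(* Defs.v *)
(* Stdlib reals with Coquelicot: complex numbers [C], improper Riemann integrals
   [RInt_gen], series. *)
From Stdlib Require Import Factorial Reals.
From Coquelicot Require Import Coquelicot.

Open Scope R_scope.
Open Scope C_scope.

Definition Cexp (z : C) : C := (exp (Re z) * cos (Im z), exp (Re z) * sin (Im z))%R.

(* Principal argument, in (-PI, PI], for z <> 0. *)
Definition Carg (z : C) : R :=
  if Rlt_dec (Im z) 0 then (- acos (Re z / Cmod z))%R else acos (Re z / Cmod z).

Definition Clog (z : C) : C := (ln (Cmod z), Carg z).

(* Principal power.  The value at z = 0 is meaningless; it is never used below. *)
Definition Cpower (z s : C) : C := Cexp (s * Clog z).

(* Equal to the sum whenever the complex series converges. *)
Definition CSeries (u : nat -> C) : C :=
  (Series (fun n => Re (u n)), Series (fun n => Im (u n))).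

(* Improper integrals over (0, 1) and (0, oo): both endpoints are approached as limits,
   so integrability is only required on compact subintervals of the open interval. *)
Definition CInt01 (f : R -> C) : C :=
  RInt_gen (V := C_R_CompleteNormedModule) f (at_right 0) (at_left 1).
Definition abs_CInt01 (f : R -> C) : Prop :=
  ex_RInt_gen (V := R_NormedModule) (fun t => Cmod (f t)) (at_right 0) (at_left 1).

Definition ex_CInt0oo (f : R -> C) : Prop :=
  ex_RInt_gen (V := C_R_NormedModule) f (at_right 0) (Rbar_locally p_infty).
Definition CInt0oo (f : R -> C) : C :=
  RInt_gen (V := C_R_CompleteNormedModule) f (at_right 0) (Rbar_locally p_infty).

Fixpoint pochhammer (g : C) (n : nat) : C :=
  match n with
  | O => 1
  | S m => pochhammer g m * (g + RtoC (INR m))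
  end.

(* Euler's integrals: Gamma for Re s > 0, Beta for Re x, Re y > 0.
   Only these ranges are needed. *)
Definition CGamma (s : C) : C :=
  CInt0oo (fun t => Cpower (RtoC t) (s - 1) * RtoC (exp (- t))).

Definition CBeta (x y : C) : C :=
  CInt01 (fun t => Cpower (RtoC t) (x - 1) * Cpower (RtoC (1 - t)) (y - 1)).

Definition mittag_leffler (lambda : R) (w : C) : C :=
  CSeries (fun n => w ^ n / CGamma (RtoC (lambda * INR n + 1))).

Definition ext_beta_integrand (x y : C) (p lambda : R) (t : R) : C :=
  Cpower (RtoC t) (x - 1) * Cpower (RtoC (1 - t)) (y - 1)
  * mittag_leffler lambda (RtoC (- (p / (t * (1 - t))))).

Definition ext_beta (x y : C) (p lambda : R) : C :=
  CInt01 (ext_beta_integrand x y p lambda).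

Definition ext_hurwitz_lerch
    (gamma theta upsilon z sigma a : C) (p lambda : R) : C :=
  CSeries (fun n =>
    (pochhammer gamma n * ext_beta (theta + RtoC (INR n)) (upsilon - theta) p lambda)
      / (CBeta theta (upsilon - theta) * RtoC (INR (fact n)))
    * (z ^ n / Cpower (RtoC (INR n) + a) sigma)).

Definition goyal_laddha (gamma w sigma a : C) : C :=
  CSeries (fun n =>
    pochhammer gamma n / RtoC (INR (fact n))
    * (w ^ n / Cpower (RtoC (INR n) + a) sigma)).

Definition single_integrand
    (gamma theta upsilon z sigma a : C) (p lambda : R) (x : R) : C :=
  Cpower (RtoC x) (theta - 1) / Cpower (RtoC (1 + x)) upsilon
  * mittag_leffler lambda (RtoC (- (p * (2 + x + 1 / x))))
  * goyal_laddha gamma (z * RtoC x / RtoC (1 + x)) sigma a.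

Definition double_integrand
    (gamma theta upsilon z sigma a : C) (p lambda : R) (x t : R) : C :=
  (Cpower (RtoC t) (sigma - 1) * Cexp (- (a * RtoC t)) * Cpower (RtoC x) (theta - 1))
    / Cpower (RtoC (1 + x)) upsilon
  * mittag_leffler lambda (RtoC (- (p * (2 + x + 1 / x))))
  * Cpower (1 - z * RtoC x * RtoC (exp (- t)) / RtoC (1 + x)) (- gamma).

(* Main.v *)
Require Import Defs.
From Stdlib Require Import Reals Factorial Lra Lia ssreflect Classical_Prop.
From Coquelicot Require Import Coquelicot.

Unset SsrRewrite.
Open Scope R_scope.

(** In both formulas the right-hand side is evaluated by termwise integration.

    The substitution [t = x / (1 + x)] turns [x^(theta-1) (1+x)^(-upsilon) E_lambda(...) dx] into
    the beta weight [w(t) dt = t^(theta-1) (1-t)^(upsilon-theta-1) E_lambda(-p/(t(1-t))) dt]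
    ([weight_subst]) and the Goyal-Laddha series into the power series [sum_n c_n t^n] with
    [c_n = (gamma)_n z^n / (n! (n+a)^sigma)]. As the integral of [t^n w(t)] is the extended beta
    function at [theta + n], (i) is the exchange of the sum with the integral
    ([weighted_series]). On compact subintervals the series converges geometrically; at the two
    ends Tannery's theorem applies as soon as [sum_n |c_n| b_n] is finite, [b_n] being a bound
    for the integral of [t^n |w(t)|]. The coefficients grow like a power of [n] times [|z|^n]
    ([coef_bound]), which settles [|z| < 1].

    For [|z| = 1] the [b_n] have to decay like [n^(1 - Re (upsilon - theta))]
    ([weight_decay]). This follows from the boundedness of [E_lambda] on the values taken by the
    kernel ([ml_kernel_bounded]). Nothing has to be shown for [p = 0].
    - For [lambda <= 2], [|E_lambda(-s)| <= 1] for [s >= 0] ([ml_bound]): [E_lambda(-s)] is the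
      real part of [E_alpha(i sqrt s)] with [alpha = lambda / 2 <= 1], which is the limit, by
      Gauss' formula for the Gamma function ([gauss_limit]), of a time discretisation of the
      fractional relaxation equation ([xs]). The discretisation expresses each value as an
      average of earlier ones and 1, divided by [1 - omega] of modulus at least 1, so that it
      never leaves the unit disc ([xs_bound]).
    - For [lambda > 2] and [p > 0] the beta integrals do not converge absolutely. If they did,
      [E_lambda(-t^lambda)] would have an absolutely convergent Laplace transform on the whole
      half-plane [Re s > 0] ([laplace_of_beta]), but that transform is
      [s^(lambda-1) / (s^lambda + 1)], with a pole at [e^(i pi / lambda)] ([ml_not_laplace]).

    For (ii), expanding [(1 - zeta e^(-t))^(-gamma)] by the binomial theorem and using
    [int_0^oo t^(sigma-1) e^(-(n+a)t) dt = Gamma(sigma) (n+a)^(-sigma)] for complex [a]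
    ([gamma_scaled]) shows that the inner integral is [Gamma(sigma)] times the integrand of (i)
    ([goyal_laddha_integral]); and [Gamma(sigma)] does not vanish ([CGamma_neq_0]). *)

(** * Elementary inequalities *)

Lemma exp_le x y : x <= y -> exp x <= exp y.
Proof. intros [h| ->]; [now apply Rlt_le, exp_increasing|lra]. Qed.

Lemma exp_le_1 x : x <= 0 -> exp x <= 1.
Proof. intros H. rewrite <- exp_0. now apply exp_le. Qed.

Lemma Rdiv_lt_1 x y : 0 < y -> x < y -> x / y < 1.
Proof.
  intros Hy H. apply Rmult_lt_reg_r with y; auto. unfold Rdiv. rewrite Rmult_assoc, Rinv_l; lra.
Qed.

Lemma ln_le_pred u : 0 < u -> ln u <= u - 1.
Proof.
  intros Hu. pose proof (exp_ineq1_le (ln u)) as H. rewrite exp_ln in H by auto. lra.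
Qed.

Lemma ln_step k : 0 < k -> / (k + 1) <= ln (k + 1) - ln k.
Proof.
  intros Hk. pose proof (ln_le_pred (k / (k + 1)) ltac:(apply Rdiv_lt_0_compat; lra)) as H.
  replace (k / (k + 1) - 1) with (- / (k + 1)) in H by (field; lra).
  rewrite ln_div in H by lra. lra.
Qed.

Lemma exp_pow y n : exp y ^ n = exp (INR n * y).
Proof. rewrite <- Rpower_pow by apply exp_pos. unfold Rpower. now rewrite ln_exp. Qed.

Lemma Rpower_pos x y : 0 < Rpower x y.
Proof. apply exp_pos. Qed.

(** Sign conditions on products, quotients and powers, looking through local definitions. *)
Ltac pos :=
  try assumption; try lra;
  try (match goal with |- context [INR ?n] => pose proof (pos_INR n); lra end);
  lazymatch goal with
  | |- _ > _ => unfold Rgt; pos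
  | |- 0 < _ * _ => apply Rmult_lt_0_compat; pos
  | |- 0 <= _ * _ => apply Rmult_le_pos; pos
  | |- 0 < _ / _ => apply Rdiv_lt_0_compat; pos
  | |- 0 <= _ / _ => apply Rdiv_le_0_compat; pos
  | |- 0 < / _ => apply Rinv_0_lt_compat; pos
  | |- 0 < _ ^ _ => apply pow_lt; pos
  | |- 0 <= _ ^ _ => apply pow_le; pos
  | |- 0 < Rpower _ _ => apply exp_pos
  | |- 0 < exp _ => apply exp_pos
  | |- 0 <= Rabs _ => apply Rabs_pos
  | |- 0 <= Cmod _ => apply Cmod_ge_0
  | |- 0 <= INR _ => apply pos_INR
  | |- 0 < INR (fact _) => apply INR_fact_lt_0
  | |- 0 < ?c => match goal with d := _ |- _ => constr_eq c d; unfold d end; pos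
  | |- 0 <= ?c => first [match goal with d := _ |- _ => constr_eq c d; unfold d end | apply Rlt_le]; pos
  | |- ?D _ => unfold D; pos
  end.

Ltac rring := match goal with |- ?a = ?b => change (@eq R a b) end; ring.

(** * Improper integrals over an interval *)

Lemma RInt_correctR (f : R -> R) a b : ex_RInt f a b -> is_RInt f a b (RInt f a b).
Proof. exact (@RInt_correct R_CompleteNormedModule f a b). Qed.

Definition interval (D : R -> Prop) : Prop :=
  (exists d, D d) /\ forall x y t, D x -> D y -> x <= t <= y -> D t.

Definition locint (D : R -> Prop) (f : R -> R) : Prop :=
  forall a b, D a -> D b -> ex_RInt f a b.

(** Limit along the compact subintervals of [D] directed by inclusion: the same notion serves
    (0, 1) and (0, oo), and the two ends are approached independently. *)
Definition improper (D : R -> Prop) (f : R -> R) (l : R) : Prop :=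
  forall eps, 0 < eps -> exists c d, D c /\ D d /\ c <= d /\
    forall a b, D a -> D b -> a <= c -> d <= b -> Rabs (RInt f a b - l) < eps.

(** For nonnegative [f] this is convergence of the integral, expressed on compact subintervals,
    where comparison and substitution are elementary. *)
Definition ibound (D : R -> Prop) (f : R -> R) (B : R) : Prop :=
  forall a b, D a -> D b -> a <= b -> RInt f a b <= B.

Lemma interval_between D x y t : interval D -> D x -> D y ->
  Rmin x y <= t <= Rmax x y -> D t.
Proof.
  intros [_ H] Hx Hy Ht.
  destruct (Rle_dec x y) as [h|h].
  - rewrite Rmin_left, Rmax_right in Ht by lra. now apply (H x y).
  - rewrite Rmin_right, Rmax_left in Ht by lra. now apply (H y x).
Qed.

Lemma interval_min D x y : D x -> D y -> D (Rmin x y).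
Proof. unfold Rmin; destruct Rle_dec; auto. Qed.

Lemma interval_max D x y : D x -> D y -> D (Rmax x y).
Proof. unfold Rmax; destruct Rle_dec; auto. Qed.

Lemma locint_continuous D (f : R -> R) : interval D ->
  (forall t, D t -> continuous f t) -> locint D f.
Proof.
  intros HD Hf a b Ha Hb. apply: ex_RInt_continuous.
  intros z Hz. apply Hf. now apply (interval_between D a b).
Qed.

Lemma improper_unique D (f : R -> R) l1 l2 : interval D ->
  improper D f l1 -> improper D f l2 -> l1 = l2.
Proof.
  intros HD H1 H2.
  destruct (Req_dec l1 l2) as [h|h]; [easy|exfalso].
  assert (He : 0 < Rabs (l1 - l2) / 2).
  { apply Rdiv_lt_0_compat; [apply Rabs_pos_lt|]; lra. }
  destruct (H1 _ He) as (c1 & d1 & Hc1 & Hd1 & H12 & K1).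
  destruct (H2 _ He) as (c2 & d2 & Hc2 & Hd2 & H12' & K2).
  pose proof (K1 _ _ (interval_min D _ _ Hc1 Hc2) (interval_max D _ _ Hd1 Hd2)
    (Rmin_l _ _) (Rmax_l _ _)) as L1.
  pose proof (K2 _ _ (interval_min D _ _ Hc1 Hc2) (interval_max D _ _ Hd1 Hd2)
    (Rmin_r _ _) (Rmax_r _ _)) as L2.
  apply Rabs_def2 in L1. apply Rabs_def2 in L2.
  unfold Rabs in *. destruct Rcase_abs; lra.
Qed.

Lemma RInt_ext_on D (f g : R -> R) a b : interval D -> (forall t, D t -> f t = g t) ->
  D a -> D b -> RInt f a b = RInt g a b.
Proof.
  intros HD H Ha Hb. apply RInt_ext. intros x Hx. apply H.
  apply (interval_between D a b); auto; lra.
Qed.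

Lemma locint_ext D (f g : R -> R) : interval D -> (forall t, D t -> f t = g t) ->
  locint D f -> locint D g.
Proof.
  intros HD H Hf a b Ha Hb. apply (ex_RInt_ext f); [|now apply Hf].
  intros x Hx. apply H. apply (interval_between D a b); auto; lra.
Qed.

Lemma improper_ext D (f g : R -> R) l : interval D -> (forall t, D t -> f t = g t) ->
  improper D f l -> improper D g l.
Proof.
  intros HD H Hf eps He. destruct (Hf eps He) as (c & d & Hc & Hd & Hcd & K).
  exists c, d. repeat split; auto. intros a b Ha Hb h1 h2.
  rewrite <- (RInt_ext_on D f g); auto.
Qed.

Lemma improper_lin D (f g : R -> R) x y lf lg : interval D -> locint D f -> locint D g ->
  improper D f lf -> improper D g lg ->
  improper D (fun t => x * f t + y * g t) (x * lf + y * lg).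
Proof.
  intros HD If Ig Hf Hg eps He.
  set (k := Rabs x + Rabs y + 1).
  assert (Hk : 0 < k) by (unfold k; pose proof (Rabs_pos x); pose proof (Rabs_pos y); lra).
  assert (He' : 0 < eps / k) by pos.
  destruct (Hf _ He') as (c1 & d1 & Hc1 & Hd1 & H12 & K1).
  destruct (Hg _ He') as (c2 & d2 & Hc2 & Hd2 & H12' & K2).
  exists (Rmin c1 c2), (Rmax d1 d2). split; [now apply interval_min|].
  split; [now apply interval_max|]. split.
  { apply Rle_trans with c1; [apply Rmin_l|]. apply Rle_trans with d1; [easy|apply Rmax_l]. }
  intros a b Ha Hb h1 h2.
  assert (L1 := K1 a b Ha Hb (Rle_trans _ _ _ h1 (Rmin_l _ _)) (Rle_trans _ _ _ (Rmax_l _ _) h2)).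
  assert (L2 := K2 a b Ha Hb (Rle_trans _ _ _ h1 (Rmin_r _ _)) (Rle_trans _ _ _ (Rmax_r _ _) h2)).
  rewrite (is_RInt_unique _ a b (x * RInt f a b + y * RInt g a b)).
  2:{ apply: is_RInt_plus; apply: is_RInt_scal; apply RInt_correctR; auto. }
  replace (x * RInt f a b + y * RInt g a b - (x * lf + y * lg))
    with (x * (RInt f a b - lf) + y * (RInt g a b - lg)) by ring.
  eapply Rle_lt_trans; [apply Rabs_triang|]. rewrite 2!Rabs_mult.
  apply Rle_lt_trans with (Rabs x * (eps / k) + Rabs y * (eps / k)).
  { apply Rplus_le_compat; apply Rmult_le_compat_l; try pos. }
  replace eps with (k * (eps / k)) at 3 by (field; lra). unfold k at 3.
  lra.
Qed.

Lemma improper_scal D (f : R -> R) x l : interval D -> locint D f ->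
  improper D f l -> improper D (fun t => x * f t) (x * l).
Proof.
  intros HD If Hf. replace (x * l) with (x * l + 0 * l) by ring.
  apply (improper_ext D (fun t => x * f t + 0 * f t)); auto.
  - intros; ring.
  - now apply improper_lin.
Qed.

Lemma RInt_le_wider D (h : R -> R) a b a' b' : interval D -> locint D h ->
  (forall t, D t -> 0 <= h t) -> D a' -> D b' -> a' <= a -> a <= b -> b <= b' ->
  RInt h a b <= RInt h a' b'.
Proof.
  intros HD Ih Hh Ha' Hb' h1 h2 h3.
  assert (Ha : D a) by (apply (proj2 HD a' b'); auto; lra).
  assert (Hb : D b) by (apply (proj2 HD a' b'); auto; lra).
  rewrite <- (RInt_Chasles h a' a b') by auto.
  rewrite <- (RInt_Chasles h a b b') by auto.
  unfold plus; simpl.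
  assert (0 <= RInt h a' a).
  { apply RInt_ge_0; auto. intros x Hx. apply Hh. apply (proj2 HD a' a); auto; lra. }
  assert (0 <= RInt h b b').
  { apply RInt_ge_0; auto. intros x Hx. apply Hh. apply (proj2 HD b b'); auto; lra. }
  lra.
Qed.

Lemma improper_nonneg D (h : R -> R) B : interval D -> locint D h ->
  (forall t, D t -> 0 <= h t) -> ibound D h B -> exists l, improper D h l /\ l <= B.
Proof.
  intros HD Ih Hh HB.
  set (E := fun y => exists a b, D a /\ D b /\ a <= b /\ y = RInt h a b).
  destruct (completeness E) as [l [Hub Hlub]].
  - exists B. intros y (a & b & Ha & Hb & Hab & ->). now apply HB.
  - destruct HD as [[d Hd] _]. exists (RInt h d d). exists d, d. repeat split; auto; lra.
  - exists l. split.
    2:{ apply Hlub. intros y (a & b & Ha & Hb & Hab & ->). now apply HB. }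
    intros eps He.
    assert (exists a b, D a /\ D b /\ a <= b /\ l - eps < RInt h a b) as (c & d & Hc & Hd & Hcd & K).
    { destruct (Classical_Prop.classic
        (exists a b, D a /\ D b /\ a <= b /\ l - eps < RInt h a b)) as [e|n]; [easy|].
      exfalso. assert (l <= l - eps); [|lra]. apply Hlub.
      intros y (a & b & Ha & Hb & Hab & ->).
      apply Rnot_lt_le. intros hh. apply n. now exists a, b. }
    exists c, d. repeat split; auto. intros a b Ha Hb h1 h2.
    assert (RInt h c d <= RInt h a b) by (apply (RInt_le_wider D); auto).
    assert (RInt h a b <= l).
    { apply Hub. exists a, b. repeat split; auto; lra. }
    apply Rabs_def1; lra.
Qed.

Lemma improper_ge D (h : R -> R) l : interval D -> locint D h ->
  (forall t, D t -> 0 <= h t) -> improper D h l -> ibound D h l.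
Proof.
  intros HD Ih Hh Hl a b Ha Hb Hab.
  apply Rnot_lt_le. intros hlt.
  destruct (Hl (RInt h a b - l)) as (c & d & Hc & Hd & Hcd & K); [lra|].
  specialize (K (Rmin a c) (Rmax b d) (interval_min D _ _ Ha Hc) (interval_max D _ _ Hb Hd)
    (Rmin_r _ _) (Rmax_r _ _)).
  assert (RInt h a b <= RInt h (Rmin a c) (Rmax b d)).
  { apply (RInt_le_wider D); auto. now apply interval_min. now apply interval_max.
    apply Rmin_l. apply Rmax_l. }
  apply Rabs_def2 in K. lra.
Qed.

Lemma improper_le D (f g : R -> R) lf lg : interval D -> locint D f -> locint D g ->
  (forall t, D t -> f t <= g t) -> improper D f lf -> improper D g lg -> lf <= lg.
Proof.
  intros HD If Ig H Hf Hg. apply Rnot_lt_le. intros hlt.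
  assert (He : 0 < (lf - lg) / 2) by lra.
  destruct (Hf _ He) as (c1 & d1 & Hc1 & Hd1 & H12 & K1).
  destruct (Hg _ He) as (c2 & d2 & Hc2 & Hd2 & H12' & K2).
  pose proof (K1 _ _ (interval_min D _ _ Hc1 Hc2) (interval_max D _ _ Hd1 Hd2)
    (Rmin_l _ _) (Rmax_l _ _)) as L1.
  pose proof (K2 _ _ (interval_min D _ _ Hc1 Hc2) (interval_max D _ _ Hd1 Hd2)
    (Rmin_r _ _) (Rmax_r _ _)) as L2.
  assert (RInt f (Rmin c1 c2) (Rmax d1 d2) <= RInt g (Rmin c1 c2) (Rmax d1 d2)).
  { assert (Rmin c1 c2 <= Rmax d1 d2).
    { apply Rle_trans with c1; [apply Rmin_l|]. apply Rle_trans with d1; [easy|apply Rmax_l]. }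
    assert (Hm := interval_min D _ _ Hc1 Hc2). assert (HM := interval_max D _ _ Hd1 Hd2).
    apply RInt_le; [easy|now apply If|now apply Ig|].
    intros x Hx. apply H. apply (proj2 HD (Rmin c1 c2) (Rmax d1 d2)); auto; lra. }
  apply Rabs_def2 in L1. apply Rabs_def2 in L2. lra.
Qed.

Lemma ibound_le D (f g : R -> R) B : interval D -> locint D f -> locint D g ->
  (forall t, D t -> f t <= g t) -> ibound D g B -> ibound D f B.
Proof.
  intros HD If Ig H HB a b Ha Hb Hab.
  apply Rle_trans with (RInt g a b); [|now apply HB].
  apply RInt_le; auto. intros x Hx. apply H. apply (proj2 HD a b); auto; lra.
Qed.

Lemma ibound_scal D (f : R -> R) k B : interval D -> locint D f -> 0 <= k -> ibound D f B ->
  ibound D (fun t => k * f t) (k * B).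
Proof.
  intros HD If Hk HB a b Ha Hb Hab.
  rewrite (is_RInt_unique _ a b (k * RInt f a b)).
  2:{ apply: is_RInt_scal. apply RInt_correctR; auto. }
  apply Rmult_le_compat_l; auto.
Qed.

Lemma locint_scal D (f : R -> R) k : locint D f -> locint D (fun t => k * f t).
Proof. intros H a b Ha Hb. apply: ex_RInt_scal. auto. Qed.

Lemma locint_plus D (f g : R -> R) : locint D f -> locint D g -> locint D (fun t => f t + g t).
Proof. intros H K a b Ha Hb. apply: ex_RInt_plus; auto. Qed.

(** [f] is the difference of [f + g] and [g], which are nonnegative with bounded integrals. *)
Lemma improper_abs D (f g : R -> R) B : interval D -> locint D f -> locint D g ->
  (forall t, D t -> Rabs (f t) <= g t) -> ibound D g B ->
  exists l, improper D f l /\ Rabs l <= B.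
Proof.
  intros HD If Ig H HB.
  assert (Hg : forall t, D t -> 0 <= g t).
  { intros t Ht. eapply Rle_trans; [apply Rabs_pos|now apply H]. }
  destruct (improper_nonneg D g B) as [lg [Hlg Bg]]; auto.
  destruct (improper_nonneg D (fun t => f t + g t) (2 * B)) as [ls [Hls _]]; auto.
  - now apply locint_plus.
  - intros t Ht. specialize (H t Ht). unfold Rabs in H. destruct Rcase_abs; lra.
  - apply (ibound_le D _ (fun t => 2 * g t)); auto.
    + now apply locint_plus.
    + now apply locint_scal.
    + intros t Ht. specialize (H t Ht). unfold Rabs in H. destruct Rcase_abs; lra.
    + apply ibound_scal; auto; lra.
  - assert (Hf : improper D f (ls - lg)).
    { apply (improper_ext D (fun t => 1 * (f t + g t) + (-1) * g t)); auto.
      { intros; ring. }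
      replace (ls - lg) with (1 * ls + -1 * lg) by ring.
      apply improper_lin; auto. now apply locint_plus. }
    exists (ls - lg). split; auto.
    assert (ls - lg <= lg).
    { apply (improper_le D f g); auto. intros t Ht. specialize (H t Ht).
      unfold Rabs in H. destruct Rcase_abs; lra. }
    assert (-1 * lg <= ls - lg).
    { apply (improper_le D (fun t => -1 * g t) f); auto.
      - now apply locint_scal.
      - intros t Ht. specialize (H t Ht). unfold Rabs in H. destruct Rcase_abs; lra.
      - now apply improper_scal. }
    apply Rabs_le; lra.
Qed.

Lemma improper_subst D E (f phi dphi : R -> R) l : interval D -> interval E ->
  (forall t, D t -> continuous f t) ->
  (forall x, E x -> D (phi x) /\ is_derive phi x (dphi x) /\ continuous dphi x) ->
  (forall d, D d -> exists e, E e /\ forall x, E x -> x <= e -> phi x <= d) ->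
  (forall d, D d -> exists e, E e /\ forall x, E x -> e <= x -> d <= phi x) ->
  improper D f l -> improper E (fun x => dphi x * f (phi x)) l.
Proof.
  intros HD HE Cf Hphi Hlo Hhi Hf eps He.
  destruct (Hf eps He) as (c & d & Hc & Hd & Hcd & K).
  destruct (Hlo c Hc) as (e1 & He1 & L1). destruct (Hhi d Hd) as (e2 & He2 & L2).
  exists (Rmin e1 e2), (Rmax e1 e2). split; [now apply interval_min|].
  split; [now apply interval_max|]. split.
  { eapply Rle_trans; [apply Rmin_l|apply Rmax_l]. }
  intros a b Ha Hb h1 h2.
  replace (RInt (fun x => dphi x * f (phi x)) a b) with (RInt f (phi a) (phi b)).
  2:{ symmetry. apply (RInt_comp f phi dphi).
      - intros x Hx. apply Cf. apply Hphi. now apply (interval_between E a b).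
      - intros x Hx. apply Hphi. now apply (interval_between E a b). }
  apply K; try apply Hphi; auto.
  - apply L1; auto. eapply Rle_trans; [apply h1|apply Rmin_l].
  - apply L2; auto. eapply Rle_trans; [apply Rmax_r|apply h2].
Qed.

Lemma ibound_subst D E (f phi dphi : R -> R) B : interval D -> interval E ->
  (forall t, D t -> continuous f t) ->
  (forall x, E x -> D (phi x) /\ is_derive phi x (dphi x) /\ continuous dphi x) ->
  (forall x y, E x -> E y -> x <= y -> phi x <= phi y) ->
  ibound D f B -> ibound E (fun x => dphi x * f (phi x)) B.
Proof.
  intros HD HE Cf Hphi Hmon HB a b Ha Hb Hab.
  replace (RInt (fun x => dphi x * f (phi x)) a b) with (RInt f (phi a) (phi b)).
  2:{ symmetry. apply (RInt_comp f phi dphi).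
      - intros x Hx. apply Cf. apply Hphi. now apply (interval_between E a b).
      - intros x Hx. apply Hphi. now apply (interval_between E a b). }
  apply HB; try apply Hphi; auto.
Qed.

Lemma improper_derive D (F f : R -> R) la lb : interval D ->
  (forall t, D t -> is_derive F t (f t) /\ continuous f t) ->
  (forall eps, 0 < eps -> exists c, D c /\ forall a, D a -> a <= c -> Rabs (F a - la) < eps) ->
  (forall eps, 0 < eps -> exists c, D c /\ forall a, D a -> c <= a -> Rabs (F a - lb) < eps) ->
  improper D f (lb - la).
Proof.
  intros HD HF Hlo Hhi eps He.
  destruct (Hlo (eps / 2)) as (c & Hc & K1); [lra|].
  destruct (Hhi (eps / 2)) as (d & Hd & K2); [lra|].
  exists (Rmin c d), (Rmax c d). split; [now apply interval_min|].
  split; [now apply interval_max|]. split.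
  { eapply Rle_trans; [apply Rmin_l|apply Rmax_l]. }
  intros a b Ha Hb h1 h2.
  assert (L1 : Rabs (F a - la) < eps / 2).
  { apply K1; auto. eapply Rle_trans; [apply h1|apply Rmin_l]. }
  assert (L2 : Rabs (F b - lb) < eps / 2).
  { apply K2; auto. eapply Rle_trans; [apply Rmax_r|apply h2]. }
  rewrite (is_RInt_unique f a b (minus (F b) (F a))).
  2:{ apply: is_RInt_derive; intros x Hx; apply HF; now apply (interval_between D a b). }
  unfold minus, plus, opp; simpl.
  apply Rabs_def2 in L1. apply Rabs_def2 in L2. apply Rabs_def1; lra.
Qed.

Lemma ibound_derive D (F f g : R -> R) m M : interval D -> locint D f ->
  (forall t, D t -> is_derive F t (g t) /\ continuous g t) ->
  (forall t, D t -> f t <= g t) ->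
  (forall t, D t -> m <= F t <= M) -> ibound D f (M - m).
Proof.
  intros HD If HF Hfg Hm.
  assert (Ig : locint D g) by (apply locint_continuous; [easy|intros t Ht; now apply HF]).
  apply (ibound_le D f g); auto.
  intros a b Ha Hb Hab.
  rewrite (is_RInt_unique g a b (minus (F b) (F a))).
  2:{ apply: is_RInt_derive; intros x Hx; apply HF; now apply (interval_between D a b). }
  unfold minus, plus, opp; simpl. specialize (Hm a Ha) as h1. specialize (Hm b Hb) as h2. lra.
Qed.

(** * Dominated convergence for series *)

Lemma ex_series_Rle (a b : nat -> R) :
  (forall n, Rabs (a n) <= b n) -> ex_series b -> ex_series a.
Proof. intros H Hb. apply: (ex_series_le a b); auto. Qed.

Lemma ex_series_lim_tail (M : nat -> R) : ex_series M -> forall eps, 0 < eps ->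
  exists N, (0 < N)%nat /\ Rabs (Series (fun k => M (N + k)%nat)) < eps.
Proof.
  intros HM eps He.
  destruct (Series_correct M HM (ball (Series M) (mkposreal _ He))) as [N HN].
  { apply locally_ball. }
  exists (S N). split; [lia|].
  specialize (HN N (le_n _)). rewrite sum_n_Reals in HN.
  rewrite (Series_incr_n M (S N)) in HN; [|lia|easy].
  simpl pred in HN. unfold ball in HN; simpl in HN; unfold AbsRing_ball, abs, minus, plus, opp in HN;
    simpl in HN.
  replace (Series (fun k => M (S N + k)%nat)) with
   (- (sum_f_R0 M N + - (sum_f_R0 M N + Series (fun k : nat => M (S N + k)%nat)))) by ring.
  now rewrite Rabs_Ropp.
Qed.

Lemma Series_abs_le (a b : nat -> R) : (forall n, Rabs (a n) <= b n) -> ex_series b ->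
  Rabs (Series a) <= Series b.
Proof.
  intros H Hb. assert (ex_series (fun n => Rabs (a n))).
  { apply (ex_series_Rle _ b); auto. intros n. now rewrite Rabs_Rabsolu. }
  eapply Rle_trans; [now apply Series_Rabs|].
  apply Series_le; auto. intros n. split; [pos|auto].
Qed.

Lemma Series_head_tail (a M : nat -> R) N : (0 < N)%nat ->
  (forall n, Rabs (a n) <= M n) -> ex_series M ->
  Rabs (Series a) <= sum_f_R0 (fun n => Rabs (a n)) (pred N)
     + Rabs (Series (fun k => M (N + k)%nat)).
Proof.
  intros HN H HM.
  rewrite (Series_incr_n a N); [|easy|now apply (ex_series_Rle a M)].
  eapply Rle_trans; [apply Rabs_triang|]. apply Rplus_le_compat.
  - clear. induction (pred N) as [|n IH]; simpl; [lra|].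
    eapply Rle_trans; [apply Rabs_triang|]. lra.
  - eapply Rle_trans; [apply Series_abs_le|apply Rle_abs].
    + intros n. apply H.
    + now apply (ex_series_incr_n M).
Qed.

Lemma term_le_Series (a : nat -> R) n : (forall k, 0 <= a k) -> ex_series a -> a n <= Series a.
Proof.
  intros Ha Hs. rewrite (Series_incr_n a (S n)); [|lia|easy]. simpl pred.
  assert (Ht : forall m, 0 <= sum_f_R0 a m).
  { induction m as [|m IH]; simpl; [auto|]. specialize (Ha (S m)). lra. }
  assert (0 <= Series (fun k => a (S n + k)%nat)).
  { eapply Rle_trans; [apply Rabs_pos|].
    apply (Series_abs_le (fun k => a (S n + k)%nat) (fun k => a (S n + k)%nat)).
    - intros k. rewrite Rabs_pos_eq; auto. apply Rle_refl.
    - now apply (ex_series_incr_n a). }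
  destruct n as [|n]; simpl in *; [lra|]. specialize (Ht n). lra.
Qed.

(** The filter is arbitrary because the theorem is used both along sequences and along the
    compact subintervals of an interval. *)
Lemma tannery {T : Type} (F : (T -> Prop) -> Prop) {FF : Filter F}
    (u : T -> nat -> R) (v M : nat -> R) :
  ex_series M -> F (fun x => forall k, Rabs (u x k) <= M k) ->
  (forall k, Rabs (v k) <= M k) ->
  (forall k eps, 0 < eps -> F (fun x => Rabs (u x k - v k) < eps)) ->
  forall eps, 0 < eps -> F (fun x => Rabs (Series (u x) - Series v) < eps).
Proof.
  intros HM Hu Hv Hlim eps He.
  destruct (ex_series_lim_tail (fun k => 2 * M k)) with (eps := eps / 2) as (N & HN & Ht).
  { apply: ex_series_scal; auto. } { lra. }
  assert (Hhead : forall n e, 0 < e ->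
     F (fun x => sum_f_R0 (fun k => Rabs (u x k - v k)) n < e)).
  { induction n as [|n IH]; intros e Hpos.
    - simpl. now apply Hlim.
    - generalize (filter_and (F := F) _ _ (IH (e / 2) ltac:(lra)) (Hlim (S n) (e / 2) ltac:(lra))).
      apply filter_imp. intros x [h1 h2]. simpl. lra. }
  generalize (filter_and (F := F) _ _ Hu (Hhead (pred N) (eps / 2) ltac:(lra))).
  apply filter_imp. intros x [h1 h2].
  rewrite <- Series_minus.
  2:{ now apply (ex_series_Rle _ M). } 2:{ now apply (ex_series_Rle _ M). }
  eapply Rle_lt_trans; [apply (Series_head_tail _ (fun k => 2 * M k) N)|].
  - easy.
  - intros n. eapply Rle_trans; [apply Rabs_triang|]. rewrite Rabs_Ropp.
    specialize (h1 n). specialize (Hv n). lra.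
  - apply: ex_series_scal; auto.
  - lra.
Qed.

Lemma is_RInt_series (f : nat -> R -> R) (M : nat -> R) a b : a <= b ->
  (forall n, ex_RInt (f n) a b) -> ex_series M ->
  (forall n t, a <= t <= b -> Rabs (f n t) <= M n) ->
  is_RInt (fun t => Series (fun n => f n t)) a b (Series (fun n => RInt (f n) a b)).
Proof.
  intros Hab If HM Hf.
  (* [filterlim_RInt] asks for uniform convergence on the whole line, hence the clipping of the
     variable to the segment. *)
  set (clip := fun t => Rmax a (Rmin b t)).
  assert (Hc : forall t, a <= clip t <= b).
  { intros t. unfold clip. split; [apply Rmax_l|]. apply Rmax_lub; [easy|apply Rmin_l]. }
  assert (Hc' : forall t, a <= t <= b -> clip t = t).
  { intros t Ht. unfold clip. rewrite Rmin_right, Rmax_right; lra. }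
  assert (If' : forall n, is_RInt (fun t => f n (clip t)) a b (RInt (f n) a b)).
  { intros n. apply (is_RInt_ext (f n)); [|apply RInt_correctR; auto].
    intros t Ht. rewrite Rmin_left, Rmax_right in Ht by lra. rewrite Hc'; auto; lra. }
  destruct (filterlim_RInt (fun N t => sum_n (fun n => f n (clip t)) N) a b eventually _
    (fun t => Series (fun n => f n (clip t))) (fun N => sum_n (fun n => RInt (f n) a b) N))
    as (I & HI & HI').
  - intros N. induction N as [|N IH].
    + rewrite sum_O. apply (is_RInt_ext (fun t => f O (clip t))); [|apply If'].
      intros t _. now rewrite sum_O.
    + rewrite sum_Sn.
      apply (is_RInt_ext (fun t => plus (sum_n (fun n => f n (clip t)) N) (f (S N) (clip t)))).
      { intros t _. now rewrite sum_Sn. }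
      now apply: is_RInt_plus.
  - apply filterlim_locally. intros eps.
    assert (Htail : is_lim_seq (fun N => Series M - sum_n M N) 0).
    { replace 0 with (Series M - Series M) by ring.
      apply is_lim_seq_minus'; [apply is_lim_seq_const|]. apply Series_correct, HM. }
    apply is_lim_seq_spec in Htail. specialize (Htail eps).
    revert Htail. apply filter_imp. intros N HN t.
    change (Rabs (sum_n (fun n => f n (clip t)) N - Series (fun n => f n (clip t))) < eps).
    assert (Hex : ex_series (fun n => f n (clip t))).
    { apply (ex_series_Rle _ M); auto. }
    rewrite (Series_incr_n _ (S N)); [|lia|easy]. simpl pred. rewrite sum_n_Reals.
    match goal with |- Rabs (?x - (?x + ?y)) < _ => replace (x - (x + y)) with (- y) by ring end.
    rewrite Rabs_Ropp. eapply Rle_lt_trans; [apply (Series_abs_le _ (fun k => M (S N + k)%nat))|].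
    + intros k. apply Hf. apply Hc.
    + now apply (ex_series_incr_n M).
    + rewrite (Series_incr_n M (S N)) in HN; [|lia|easy]. simpl pred in HN.
      rewrite sum_n_Reals in HN. eapply Rle_lt_trans; [apply Rle_abs|].
      match goal with HN : Rabs (?x + ?y - ?x - 0) < _ |- _ =>
        replace (x + y - x - 0) with y in HN by ring end. exact HN.
  - assert (HS : Series (fun n => RInt (f n) a b) = I).
    { apply is_series_unique. exact HI. }
    rewrite HS. apply (is_RInt_ext (fun t => Series (fun n => f n (clip t)))); [|exact HI'].
    intros t Ht. rewrite Rmin_left, Rmax_right in Ht by lra. rewrite Hc'; auto; lra.
Qed.

Definition normal_on (D : R -> Prop) (f : nat -> R -> R) : Prop :=
  forall a b, D a -> D b -> a <= b -> exists M : nat -> R, ex_series M /\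
    forall n t, a <= t <= b -> Rabs (f n t) <= M n.

(** Only compact subintervals see uniform convergence; the passage to the ends is Tannery's
    theorem, the integrals of the terms being dominated by [B]. *)
Lemma improper_series D (f : nat -> R -> R) (g : nat -> R -> R) (B l : nat -> R) :
  interval D -> (forall n, locint D (f n)) -> (forall n, locint D (g n)) ->
  (forall n t, D t -> Rabs (f n t) <= g n t) -> normal_on D f ->
  (forall n, ibound D (g n) (B n)) -> ex_series B ->
  (forall n, improper D (f n) (l n)) ->
  ex_series l /\ improper D (fun t => Series (fun n => f n t)) (Series l) /\
  locint D (fun t => Series (fun n => f n t)).
Proof.
  intros HD If Ig Hfg HN HB HBs Hl.
  assert (Hloc : forall a b, D a -> D b -> a <= b ->
    is_RInt (fun t => Series (fun n => f n t)) a b (Series (fun n => RInt (f n) a b))).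
  { intros a b Ha Hb Hab. destruct (HN a b Ha Hb Hab) as (M & HM & HfM).
    apply (is_RInt_series f M); auto. intros n. now apply If. }
  assert (Hfb : forall a b n, D a -> D b -> a <= b -> Rabs (RInt (f n) a b) <= B n).
  { intros a b n Ha Hb Hab. eapply Rle_trans; [apply abs_RInt_le; [easy|now apply If]|].
    refine (ibound_le D (fun t => Rabs (f n t)) (g n) (B n) HD _ (Ig n) (Hfg n) (HB n) a b Ha Hb Hab).
    intros x y Hx Hy. apply: ex_RInt_norm. now apply If. }
  assert (Hlb : forall n, Rabs (l n) <= B n).
  { intros n. destruct (improper_abs D (f n) (g n) (B n)) as (l' & Hl' & Hb); auto.
    now rewrite (improper_unique D (f n) (l n) l'). }
  split; [now apply (ex_series_Rle l B)|]. split.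
  2:{ intros a b Ha Hb. destruct (Rle_dec a b) as [h|h].
      - eexists; now apply Hloc.
      - apply ex_RInt_swap. eexists; apply Hloc; auto; lra. }
  set (F := fun Q : R * R -> Prop => exists c d, D c /\ D d /\ c <= d /\
      forall a b, D a -> D b -> a <= c -> d <= b -> Q (a, b)).
  assert (FF : Filter F).
  { split.
    - destruct HD as [[d Hd] _]. exists d, d. repeat split; auto. lra.
    - intros P Q (c1 & d1 & Hc1 & Hd1 & H1 & K1) (c2 & d2 & Hc2 & Hd2 & H2 & K2).
      exists (Rmin c1 c2), (Rmax d1 d2). split; [now apply interval_min|].
      split; [now apply interval_max|]. split.
      { apply Rle_trans with c1; [apply Rmin_l|]. apply Rle_trans with d1; [easy|apply Rmax_l]. }
      intros a b Ha Hb h1 h2. split.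
      + apply K1; auto. eapply Rle_trans; [apply h1|apply Rmin_l].
        eapply Rle_trans; [apply Rmax_l|apply h2].
      + apply K2; auto. eapply Rle_trans; [apply h1|apply Rmin_r].
        eapply Rle_trans; [apply Rmax_r|apply h2].
    - intros P Q HPQ (c & d & Hc & Hd & H & K). exists c, d. repeat split; auto. }
  assert (HT : forall eps, 0 < eps -> F (fun ab =>
     Rabs (Series (fun n => RInt (f n) (fst ab) (snd ab)) - Series l) < eps)).
  { apply (tannery F (fun ab n => RInt (f n) (fst ab) (snd ab)) l B); auto.
    - destruct HD as [[d Hd] _]. exists d, d. split; [easy|]. split; [easy|]. split; [lra|].
      intros a b Ha Hb h1 h2 k. simpl. apply Hfb; auto; lra.
    }
  intros eps He. destruct (HT eps He) as (c & d & Hc & Hd & H & K).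
  exists c, d. repeat split; auto. intros a b Ha Hb h1 h2.
  rewrite (is_RInt_unique _ _ _ _ (Hloc a b Ha Hb ltac:(lra))).
  now apply (K a b).
Qed.

(** * The intervals (0, 1) and (0, oo) *)

Definition D01 (t : R) : Prop := 0 < t < 1.
Definition D0oo (t : R) : Prop := 0 < t.

Lemma interval_D01 : interval D01.
Proof. split; [exists (1/2); unfold D01; lra|unfold D01; intros; lra]. Qed.

Lemma interval_D0oo : interval D0oo.
Proof. split; [exists 1; unfold D0oo; lra|unfold D0oo; intros; lra]. Qed.

Lemma improper_gen01 (f : R -> R) l : locint D01 f ->
  (improper D01 f l <-> is_RInt_gen f (at_right 0) (at_left 1) l).
Proof.
  intros If. split.
  - intros H P [eps HP].
    destruct (H eps (cond_pos eps)) as (c & d & Hc & Hd & Hcd & K).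
    unfold D01 in Hc, Hd.
    apply (Filter_prod _ _ _ (fun a => 0 < a <= c) (fun b => d <= b < 1)).
    + exists (mkposreal c (proj1 Hc)). intros y Hy Hy0. split; auto.
      apply Rabs_def2 in Hy. unfold minus, plus, opp in Hy; simpl in Hy. lra.
    + assert (h : 0 < 1 - d) by lra. exists (mkposreal _ h). intros y Hy Hy0. split; auto.
      apply Rabs_def2 in Hy. unfold minus, plus, opp in Hy; simpl in Hy. lra.
    + intros a b Ha Hb. exists (RInt f a b). split.
      * apply RInt_correctR. apply If; unfold D01; lra.
      * apply HP. apply K; unfold D01; lra.
  - intros H eps He.
    destruct (H (ball l (mkposreal eps He)) (locally_ball l (mkposreal eps He)))
      as [Q S [e1 HQ] [e2 HS] K].
    set (c := Rmin (e1 / 2) (1 / 2)). set (d := Rmax (1 - e2 / 2) (1 / 2)).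
    pose proof (cond_pos e1) as p1. pose proof (cond_pos e2) as p2.
    assert (Hc : 0 < c <= 1/2 /\ c <= e1 / 2).
    { unfold c. split; [split|]; [apply Rmin_glb_lt; lra|apply Rmin_r|apply Rmin_l]. }
    assert (Hd : 1/2 <= d < 1 /\ 1 - e2 / 2 <= d).
    { unfold d. split; [split|]; [apply Rmax_r|apply Rmax_lub_lt; lra|apply Rmax_l]. }
    exists c, d. unfold D01. repeat split; try lra.
    intros a b Ha Hb h1 h2.
    destruct (K a b) as (y & Hy & Hy').
    + apply HQ; [|lra]. apply Rabs_def1; unfold minus, plus, opp; simpl; lra.
    + apply HS; [|lra]. apply Rabs_def1; unfold minus, plus, opp; simpl; lra.
    + simpl in Hy. rewrite (is_RInt_unique _ _ _ _ Hy). apply Hy'.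
Qed.

Lemma improper_gen0oo (f : R -> R) l : locint D0oo f ->
  improper D0oo f l -> is_RInt_gen f (at_right 0) (Rbar_locally p_infty) l.
Proof.
  intros If H P [eps HP].
  destruct (H eps (cond_pos eps)) as (c & d & Hc & Hd & Hcd & K).
  unfold D0oo in Hc, Hd.
  apply (Filter_prod _ _ _ (fun a => 0 < a <= c) (fun b => d < b)).
  + exists (mkposreal c Hc). intros y Hy Hy0. split; auto.
    apply Rabs_def2 in Hy. unfold minus, plus, opp in Hy; simpl in Hy. lra.
  + exists d. auto.
  + intros a b Ha Hb. exists (RInt f a b). split.
    * apply RInt_correctR. apply If; unfold D0oo; lra.
    * apply HP. apply K; unfold D0oo; lra.
Qed.

(** * Complex-valued functions of a real variable *)

Ltac cring := unfold Re, Im; simpl;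
  rring.

Lemma im_le_Cmod (z : C) : Rabs (Im z) <= Cmod z.
Proof. eapply Rle_trans; [apply Rmax_r|apply Rmax_Cmod]. Qed.

Lemma Cmod_le_abs (z : C) : Cmod z <= Rabs (Re z) + Rabs (Im z).
Proof.
  replace z with (RtoC (Re z) + Ci * RtoC (Im z))%C at 1.
  - eapply Rle_trans; [apply Cmod_triangle|]. rewrite Cmod_mult, Cmod_Ci, 2!Cmod_R. lra.
  - destruct z; apply injective_projections; simpl; ring.
Qed.

Lemma C_ext (z w : C) : Re z = Re w -> Im z = Im w -> z = w.
Proof. destruct z, w; simpl; now intros -> ->. Qed.

Lemma Cexp_plus z w : Cexp (z + w)%C = (Cexp z * Cexp w)%C.
Proof.
  apply C_ext; unfold Cexp, Re, Im; simpl; rewrite exp_plus; [rewrite cos_plus|rewrite sin_plus]; ring.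
Qed.

Lemma Cexp_0 : Cexp 0 = 1.
Proof. apply C_ext; unfold Cexp, Re, Im, RtoC; simpl; rewrite exp_0; [rewrite cos_0|rewrite sin_0]; ring. Qed.

Lemma Cexp_RtoC (x : R) : Cexp (RtoC x) = RtoC (exp x).
Proof. apply C_ext; unfold Cexp, Re, Im, RtoC; simpl; [rewrite cos_0|rewrite sin_0]; ring. Qed.

Lemma Cmod_Cexp z : Cmod (Cexp z) = exp (Re z).
Proof.
  unfold Cmod, Cexp, Re, Im; simpl.
  fold (Re z) (Im z).
  replace (exp (Re z) * cos (Im z) * (exp (Re z) * cos (Im z) * 1) +
    exp (Re z) * sin (Im z) * (exp (Re z) * sin (Im z) * 1))
    with (Rsqr (exp (Re z)) * (Rsqr (sin (Im z)) + Rsqr (cos (Im z)))) by (unfold Rsqr; ring).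
  rewrite sin2_cos2, Rmult_1_r. apply sqrt_Rsqr. pos.
Qed.

Lemma Cexp_neq_0 z : Cexp z <> 0.
Proof.
  intros H. apply (f_equal Cmod) in H. rewrite Cmod_Cexp, Cmod_0 in H.
  pose proof (exp_pos (Re z)). lra.
Qed.

Lemma Cexp_opp z : (Cexp (- z) * Cexp z)%C = 1.
Proof. rewrite <- Cexp_plus, <- Cexp_0. f_equal. ring. Qed.

Definition Ccont (f : R -> C) (t : R) : Prop :=
  continuous (fun x => Re (f x)) t /\ continuous (fun x => Im (f x)) t.

Definition Cderiv (f : R -> C) (t : R) (l : C) : Prop :=
  is_derive (fun x => Re (f x)) t (Re l) /\ is_derive (fun x => Im (f x)) t (Im l).

Lemma Cderiv_cont f t l : Cderiv f t l -> Ccont f t.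
Proof.
  intros [H1 H2].
  split; apply: ex_derive_continuous; eexists; eassumption.
Qed.

Lemma Ccont_const c t : Ccont (fun _ => c) t.
Proof. split; apply continuous_const. Qed.

Lemma Ccont_RtoC (f : R -> R) t : continuous f t -> Ccont (fun x => RtoC (f x)) t.
Proof. intros H; split; simpl; [exact H|apply continuous_const]. Qed.

Lemma Rcont_plus (f g : R -> R) t : continuous f t -> continuous g t ->
  continuous (fun x => f x + g x) t.
Proof. intros H K. now apply: continuous_plus. Qed.

Lemma Rcont_minus (f g : R -> R) t : continuous f t -> continuous g t ->
  continuous (fun x => f x - g x) t.
Proof. intros H K. now apply: continuous_minus. Qed.

Lemma Rcont_mult (f g : R -> R) t : continuous f t -> continuous g t ->
  continuous (fun x => f x * g x) t.
Proof. intros H K. now apply: continuous_mult. Qed.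

Lemma Ccont_plus f g t : Ccont f t -> Ccont g t -> Ccont (fun x => (f x + g x)%C) t.
Proof. intros [H1 H2] [K1 K2]. split; simpl; now apply Rcont_plus. Qed.

Lemma Ccont_mult f g t : Ccont f t -> Ccont g t -> Ccont (fun x => (f x * g x)%C) t.
Proof.
  intros [H1 H2] [K1 K2]. split; simpl.
  - apply Rcont_minus; now apply Rcont_mult.
  - apply Rcont_plus; now apply Rcont_mult.
Qed.

Lemma Rcont_comp (g : R -> R) (f : R -> R) t :
  continuous f t -> (forall x, continuous g x) -> continuous (fun x => g (f x)) t.
Proof. intros H K. now apply: continuous_comp. Qed.

Lemma continuous_exp x : continuous exp x.
Proof. apply: ex_derive_continuous. auto_derive; auto. Qed.

Lemma Ccont_Cexp f t : Ccont f t -> Ccont (fun x => Cexp (f x)) t.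
Proof.
  intros [H1 H2]. split; simpl; apply Rcont_mult;
    apply Rcont_comp; auto; try apply continuous_exp;
    intros x; [apply continuous_cos|apply continuous_sin].
Qed.

Lemma Ccont_Cmod f t : Ccont f t -> continuous (fun x => Cmod (f x)) t.
Proof.
  intros [H1 H2]. unfold Cmod. apply: continuous_comp; [|apply continuous_sqrt].
  apply Rcont_plus; simpl; apply Rcont_mult; auto; apply Rcont_mult; auto; apply continuous_const.
Qed.

Lemma Ccont_ext_loc (f g : R -> C) t : locally t (fun x => f x = g x) -> Ccont f t -> Ccont g t.
Proof.
  intros H [K1 K2]. split.
  - apply (continuous_ext_loc _ (fun x => Re (f x))); auto.
    revert H; apply filter_imp; now intros x ->.
  - apply (continuous_ext_loc _ (fun x => Im (f x))); auto.
    revert H; apply filter_imp; now intros x ->.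
Qed.

Lemma Cderiv_const c t : Cderiv (fun _ => c) t 0.
Proof. split; apply: is_derive_const. Qed.

Lemma Cderiv_RtoC (f : R -> R) t l : is_derive f t l -> Cderiv (fun x => RtoC (f x)) t (RtoC l).
Proof. intros H; split; simpl; [exact H|apply: is_derive_const]. Qed.

Lemma Rderive_mult (f g : R -> R) t lf lg : is_derive f t lf -> is_derive g t lg ->
  is_derive (fun x => f x * g x) t (lf * g t + f t * lg).
Proof. intros H K. apply: is_derive_mult; auto. intros; apply Rmult_comm. Qed.

Lemma is_derive_val (f : R -> R) t l l' : is_derive f t l -> l = l' -> is_derive f t l'.
Proof. now intros H <-. Qed.

Lemma Rderive_plus (f g : R -> R) t lf lg : is_derive f t lf -> is_derive g t lg ->
  is_derive (fun x => f x + g x) t (lf + lg).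
Proof. intros H K. now apply: is_derive_plus. Qed.

Lemma Rderive_minus (f g : R -> R) t lf lg : is_derive f t lf -> is_derive g t lg ->
  is_derive (fun x => f x - g x) t (lf - lg).
Proof. intros H K. now apply: is_derive_minus. Qed.

Lemma Cderiv_mult f g t lf lg : Cderiv f t lf -> Cderiv g t lg ->
  Cderiv (fun x => (f x * g x)%C) t (lf * g t + f t * lg)%C.
Proof.
  intros [H1 H2] [K1 K2]. split.
  - apply (is_derive_val (fun x => Re (f x) * Re (g x) - Im (f x) * Im (g x)) t
      ((Re lf * Re (g t) + Re (f t) * Re lg) - (Im lf * Im (g t) + Im (f t) * Im lg))).
    + apply Rderive_minus; now apply Rderive_mult.
    + unfold Re, Im; simpl; ring.
  - apply (is_derive_val (fun x => Re (f x) * Im (g x) + Im (f x) * Re (g x)) t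
      ((Re lf * Im (g t) + Re (f t) * Im lg) + (Im lf * Re (g t) + Im (f t) * Re lg))).
    + apply Rderive_plus; now apply Rderive_mult.
    + unfold Re, Im; simpl; ring.
Qed.

Lemma Cderiv_Cexp f t l : Cderiv f t l -> Cderiv (fun x => Cexp (f x)) t (l * Cexp (f t))%C.
Proof.
  intros [H1 H2].
  assert (E : is_derive (fun x => exp (Re (f x))) t (Re l * exp (Re (f t)))).
  { apply: (is_derive_comp exp (fun x => Re (f x))); auto. apply is_derive_exp. }
  assert (Kc : is_derive (fun x => cos (Im (f x))) t (Im l * - sin (Im (f t)))).
  { apply: (is_derive_comp cos (fun x => Im (f x))); auto. apply is_derive_cos. }
  assert (Ks : is_derive (fun x => sin (Im (f x))) t (Im l * cos (Im (f t)))).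
  { apply: (is_derive_comp sin (fun x => Im (f x))); auto. apply is_derive_sin. }
  split.
  - apply (is_derive_val (fun x => exp (Re (f x)) * cos (Im (f x))) t
      ((Re l * exp (Re (f t))) * cos (Im (f t)) + exp (Re (f t)) * (Im l * - sin (Im (f t))))).
    + now apply (Rderive_mult (fun x => exp (Re (f x))) (fun x => cos (Im (f x)))).
    + unfold Re, Im; simpl; unfold Re, Im; ring.
  - apply (is_derive_val (fun x => exp (Re (f x)) * sin (Im (f x))) t
      ((Re l * exp (Re (f t))) * sin (Im (f t)) + exp (Re (f t)) * (Im l * cos (Im (f t))))).
    + now apply (Rderive_mult (fun x => exp (Re (f x))) (fun x => sin (Im (f x)))).
    + unfold Re, Im; simpl; unfold Re, Im; ring.
Qed.

Lemma Cderiv_zero_const f a b : a <= b -> (forall t, a <= t <= b -> Cderiv f t 0) -> f b = f a.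
Proof.
  intros Hab H. apply C_ext.
  - destruct (MVT_gen (fun x => Re (f x)) a b (fun _ => 0)) as (c & _ & Hc).
    + intros x Hx. apply H. rewrite Rmin_left, Rmax_right in Hx; lra.
    + intros x Hx. apply continuity_pt_filterlim.
      apply (Cderiv_cont f x 0). apply H. rewrite Rmin_left, Rmax_right in Hx; lra.
    + lra.
  - destruct (MVT_gen (fun x => Im (f x)) a b (fun _ => 0)) as (c & _ & Hc).
    + intros x Hx. apply H. rewrite Rmin_left, Rmax_right in Hx; lra.
    + intros x Hx. apply continuity_pt_filterlim.
      apply (Cderiv_cont f x 0). apply H. rewrite Rmin_left, Rmax_right in Hx; lra.
    + lra.
Qed.

(** * Complex series *)

Definition is_Cseries (u : nat -> C) (l : C) : Prop :=
  is_series (fun n => Re (u n)) (Re l) /\ is_series (fun n => Im (u n)) (Im l).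

Lemma is_Cseries_unique u l : is_Cseries u l -> CSeries u = l.
Proof. intros [H1 H2]. apply C_ext; simpl; now apply is_series_unique. Qed.

Lemma Cseries_abs u (M : nat -> R) : (forall n, Cmod (u n) <= M n) -> ex_series M ->
  is_Cseries u (CSeries u) /\ Cmod (CSeries u) <= 2 * Series M.
Proof.
  intros H HM.
  assert (H1 : forall n, Rabs (Re (u n)) <= M n).
  { intros n. eapply Rle_trans; [apply re_le_Cmod|auto]. }
  assert (H2 : forall n, Rabs (Im (u n)) <= M n).
  { intros n. eapply Rle_trans; [apply im_le_Cmod|auto]. }
  split.
  - split; apply Series_correct; now apply (ex_series_Rle _ M).
  - eapply Rle_trans; [apply Cmod_le_abs|]. simpl.
    pose proof (Series_abs_le _ _ H1 HM). pose proof (Series_abs_le _ _ H2 HM). lra.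
Qed.

Lemma is_Cseries_ext u v l : (forall n, u n = v n) -> is_Cseries u l -> is_Cseries v l.
Proof.
  intros H [H1 H2]. split.
  - eapply is_series_ext; [|apply H1]. intros n; simpl; now rewrite H.
  - eapply is_series_ext; [|apply H2]. intros n; simpl; now rewrite H.
Qed.

Lemma CSeries_ext u v : (forall n, u n = v n) -> CSeries u = CSeries v.
Proof. intros H. apply C_ext; simpl; apply Series_ext; intros n; now rewrite H. Qed.

Lemma CSeries_R (u : nat -> R) : CSeries (fun n => RtoC (u n)) = RtoC (Series u).
Proof.
  apply C_ext.
  - reflexivity.
  - transitivity (Series (fun n => 0 * 0)); [apply Series_ext; intros n; cring|].
    rewrite Series_scal_l. cring.
Qed.

Lemma is_Cseries_plus u v lu lv : is_Cseries u lu -> is_Cseries v lv ->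
  is_Cseries (fun n => (u n + v n)%C) (lu + lv)%C.
Proof. intros [H1 H2] [K1 K2]. split; simpl; now apply: is_series_plus. Qed.

Lemma is_series_lin (a b : nat -> R) x y la lb : is_series a la -> is_series b lb ->
  is_series (fun n => x * a n + y * b n) (x * la + y * lb).
Proof. intros H K. apply: is_series_plus; now apply: is_series_scal. Qed.

Lemma is_Cseries_scal c u l : is_Cseries u l -> is_Cseries (fun n => (c * u n)%C) (c * l)%C.
Proof.
  intros [H1 H2]. split.
  - apply (is_series_ext (fun n => Re c * Re (u n) + (- Im c) * Im (u n))).
    { intros n; cring. }
    replace (Re (c * l)%C) with (Re c * Re l + (- Im c) * Im l) by (cring).
    now apply is_series_lin.
  - apply (is_series_ext (fun n => Re c * Im (u n) + Im c * Re (u n))).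
    { intros n; cring. }
    replace (Im (c * l)%C) with (Re c * Im l + Im c * Re l) by (cring).
    now apply is_series_lin.
Qed.

Lemma is_Cseries_shift (u : nat -> C) l :
  is_Cseries (fun n => u (S n)) l -> is_Cseries u (u O + l)%C.
Proof.
  intros [H1 H2].
  assert (H : forall x y : R, y = plus (x + y) (opp x)) by (intros x y; unfold plus, opp; simpl; ring).
  split; apply: is_series_decr_1.
  - change (Re (u O + l)%C) with (Re (u O) + Re l). now rewrite <- H.
  - change (Im (u O + l)%C) with (Im (u O) + Im l). now rewrite <- H.
Qed.

(** * Complex improper integrals *)

Definition Cimproper (D : R -> Prop) (f : R -> C) (l : C) : Prop :=
  improper D (fun t => Re (f t)) (Re l) /\ improper D (fun t => Im (f t)) (Im l).

Definition Ccont_on (D : R -> Prop) (f : R -> C) : Prop := forall t, D t -> Ccont f t.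

Lemma Ccont_on_Re D f : interval D -> Ccont_on D f -> locint D (fun t => Re (f t)).
Proof. intros HD H. apply locint_continuous; auto. intros t Ht. destruct (H t Ht). assumption. Qed.

Lemma Ccont_on_Im D f : interval D -> Ccont_on D f -> locint D (fun t => Im (f t)).
Proof. intros HD H. apply locint_continuous; auto. intros t Ht. destruct (H t Ht). assumption. Qed.

Lemma Ccont_on_Cmod D f : interval D -> Ccont_on D f -> locint D (fun t => Cmod (f t)).
Proof. intros HD H. apply locint_continuous; auto. intros t Ht. now apply Ccont_Cmod, H. Qed.

Lemma Cimproper_unique D f l1 l2 : interval D -> Cimproper D f l1 -> Cimproper D f l2 -> l1 = l2.
Proof.
  intros HD [H1 H2] [K1 K2]. apply C_ext; eapply improper_unique; eassumption.
Qed.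

Lemma Cimproper_ext D f g l : interval D -> (forall t, D t -> f t = g t) ->
  Cimproper D f l -> Cimproper D g l.
Proof.
  intros HD H [H1 H2]. split.
  - apply (improper_ext D (fun t => Re (f t))); auto. intros t Ht; now rewrite H.
  - apply (improper_ext D (fun t => Im (f t))); auto. intros t Ht; now rewrite H.
Qed.

Lemma Cimproper_scal D f c l : interval D -> Ccont_on D f ->
  Cimproper D f l -> Cimproper D (fun t => (c * f t)%C) (c * l)%C.
Proof.
  intros HD Hf [H1 H2].
  assert (I1 := Ccont_on_Re D f HD Hf). assert (I2 := Ccont_on_Im D f HD Hf).
  split.
  - refine (improper_ext D (fun t => Re c * Re (f t) + (- Im c) * Im (f t)) _ _ HD _ _).
    { intros t _. cring. }
    replace (Re (c * l)%C) with (Re c * Re l + (- Im c) * Im l) by (cring).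
    now apply improper_lin.
  - refine (improper_ext D (fun t => Re c * Im (f t) + Im c * Re (f t)) _ _ HD _ _).
    { intros t _. cring. }
    replace (Im (c * l)%C) with (Re c * Im l + Im c * Re l) by (cring).
    now apply improper_lin.
Qed.

Lemma Cimproper_plus D f g lf lg : interval D -> Ccont_on D f -> Ccont_on D g ->
  Cimproper D f lf -> Cimproper D g lg -> Cimproper D (fun t => (f t + g t)%C) (lf + lg)%C.
Proof.
  intros HD Hf Hg [H1 H2] [K1 K2]. split.
  - refine (improper_ext D (fun t => 1 * Re (f t) + 1 * Re (g t)) _ _ HD _ _).
    { intros t _. cring. }
    replace (Re (lf + lg)%C) with (1 * Re lf + 1 * Re lg) by (cring).
    apply improper_lin; auto; now apply Ccont_on_Re.
  - refine (improper_ext D (fun t => 1 * Im (f t) + 1 * Im (g t)) _ _ HD _ _).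
    { intros t _. cring. }
    replace (Im (lf + lg)%C) with (1 * Im lf + 1 * Im lg) by (cring).
    apply improper_lin; auto; now apply Ccont_on_Im.
Qed.

Lemma Cimproper_abs D f (g : R -> R) B : interval D -> Ccont_on D f -> locint D g ->
  (forall t, D t -> Cmod (f t) <= g t) -> ibound D g B ->
  exists l, Cimproper D f l /\ Cmod l <= 2 * B.
Proof.
  intros HD Hf Ig H HB.
  destruct (improper_abs D (fun t => Re (f t)) g B) as (l1 & H1 & B1); auto.
  { now apply Ccont_on_Re. }
  { intros t Ht. eapply Rle_trans; [apply re_le_Cmod|auto]. }
  destruct (improper_abs D (fun t => Im (f t)) g B) as (l2 & H2 & B2); auto.
  { now apply Ccont_on_Im. }
  { intros t Ht. eapply Rle_trans; [apply im_le_Cmod|auto]. }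
  exists (l1, l2). split; [now split|]. eapply Rle_trans; [apply Cmod_le_abs|simpl; lra].
Qed.

Lemma Cimproper_derive D F f la lb : interval D ->
  (forall t, D t -> Cderiv F t (f t)) -> Ccont_on D f ->
  (forall eps, 0 < eps -> exists c, D c /\ forall a, D a -> a <= c -> Cmod (F a - la)%C < eps) ->
  (forall eps, 0 < eps -> exists c, D c /\ forall a, D a -> c <= a -> Cmod (F a - lb)%C < eps) ->
  Cimproper D f (lb - la)%C.
Proof.
  intros HD HF Hf Hlo Hhi. split.
  - apply (improper_derive D (fun t => Re (F t))); auto.
    + intros t Ht. split; [exact (proj1 (HF t Ht))|exact (proj1 (Hf t Ht))].
    + intros eps He. destruct (Hlo eps He) as (c & Hc & K). exists c. split; auto.
      intros a Ha h. eapply Rle_lt_trans; [|apply (K a Ha h)].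
      apply (re_le_Cmod (F a - la)%C).
    + intros eps He. destruct (Hhi eps He) as (c & Hc & K). exists c. split; auto.
      intros a Ha h. eapply Rle_lt_trans; [|apply (K a Ha h)].
      apply (re_le_Cmod (F a - lb)%C).
  - apply (improper_derive D (fun t => Im (F t))); auto.
    + intros t Ht. split; [exact (proj2 (HF t Ht))|exact (proj2 (Hf t Ht))].
    + intros eps He. destruct (Hlo eps He) as (c & Hc & K). exists c. split; auto.
      intros a Ha h. eapply Rle_lt_trans; [|apply (K a Ha h)].
      apply (im_le_Cmod (F a - la)%C).
    + intros eps He. destruct (Hhi eps He) as (c & Hc & K). exists c. split; auto.
      intros a Ha h. eapply Rle_lt_trans; [|apply (K a Ha h)].
      apply (im_le_Cmod (F a - lb)%C).
Qed.

Lemma Cimproper_subst D E f (phi dphi : R -> R) l : interval D -> interval E ->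
  Ccont_on D f ->
  (forall x, E x -> D (phi x) /\ is_derive phi x (dphi x) /\ continuous dphi x) ->
  (forall d, D d -> exists e, E e /\ forall x, E x -> x <= e -> phi x <= d) ->
  (forall d, D d -> exists e, E e /\ forall x, E x -> e <= x -> d <= phi x) ->
  Cimproper D f l -> Cimproper E (fun x => (RtoC (dphi x) * f (phi x))%C) l.
Proof.
  intros HD HE Cf Hphi Hlo Hhi [H1 H2]. split.
  - refine (improper_ext E (fun x => dphi x * Re (f (phi x))) _ _ HE _ _).
    { intros x _. cring. }
    apply (improper_subst D E (fun t => Re (f t))); auto. intros t Ht; exact (proj1 (Cf t Ht)).
  - refine (improper_ext E (fun x => dphi x * Im (f (phi x))) _ _ HE _ _).
    { intros x _. cring. }
    apply (improper_subst D E (fun t => Im (f t))); auto. intros t Ht; exact (proj2 (Cf t Ht)).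
Qed.

Definition Cnormal_on (D : R -> Prop) (f : nat -> R -> C) : Prop :=
  forall a b, D a -> D b -> a <= b -> exists M : nat -> R, ex_series M /\
    forall n t, a <= t <= b -> Cmod (f n t) <= M n.

Lemma Cimproper_series D (f : nat -> R -> C) (g : nat -> R -> R) (B : nat -> R) (l : nat -> C) :
  interval D -> (forall n, Ccont_on D (f n)) -> (forall n, locint D (g n)) ->
  (forall n t, D t -> Cmod (f n t) <= g n t) -> Cnormal_on D f ->
  (forall n, ibound D (g n) (B n)) -> ex_series B ->
  (forall n, Cimproper D (f n) (l n)) ->
  is_Cseries l (CSeries l) /\ Cimproper D (fun t => CSeries (fun n => f n t)) (CSeries l) /\
  locint D (fun t => Re (CSeries (fun n => f n t))) /\
  locint D (fun t => Im (CSeries (fun n => f n t))).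
Proof.
  intros HD Cf Ig Hfg HN HB HBs Hl.
  destruct (improper_series D (fun n t => Re (f n t)) g B (fun n => Re (l n)))
    as (A1 & A2 & A3); auto.
  { intros n. now apply Ccont_on_Re. }
  { intros n t Ht. eapply Rle_trans; [apply re_le_Cmod|auto]. }
  { intros a b Ha Hb Hab. destruct (HN a b Ha Hb Hab) as (M & HM & K). exists M. split; auto.
    intros n t Ht. eapply Rle_trans; [apply re_le_Cmod|auto]. }
  { intros n. exact (proj1 (Hl n)). }
  destruct (improper_series D (fun n t => Im (f n t)) g B (fun n => Im (l n)))
    as (B1 & B2 & B3); auto.
  { intros n. now apply Ccont_on_Im. }
  { intros n t Ht. eapply Rle_trans; [apply im_le_Cmod|auto]. }
  { intros a b Ha Hb Hab. destruct (HN a b Ha Hb Hab) as (M & HM & K). exists M. split; auto.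
    intros n t Ht. eapply Rle_trans; [apply im_le_Cmod|auto]. }
  { intros n. exact (proj2 (Hl n)). }
  split; [|split]; split; auto; now apply Series_correct.
Qed.

Lemma RInt_gen_pair (Fa Fb : (R -> Prop) -> Prop) {FFa : ProperFilter' Fa} {FFb : ProperFilter' Fb}
    (f : R -> C) (l : C) :
  is_RInt_gen (fun t => Re (f t)) Fa Fb (Re l) -> is_RInt_gen (fun t => Im (f t)) Fa Fb (Im l) ->
  RInt_gen (V := C_R_CompleteNormedModule) f Fa Fb = l.
Proof.
  intros H1 H2. refine (@is_RInt_gen_unique C_R_CompleteNormedModule Fa Fb _ _ f l _).
  destruct l as [l1 l2]. simpl in H1, H2. intros P [eps HP].
  destruct (H1 (ball l1 eps) (locally_ball l1 eps)) as [Q1 S1 A1 B1 K1].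
  destruct (H2 (ball l2 eps) (locally_ball l2 eps)) as [Q2 S2 A2 B2 K2].
  apply (Filter_prod _ _ _ (fun a => Q1 a /\ Q2 a) (fun b => S1 b /\ S2 b)).
  - now apply filter_and.
  - now apply filter_and.
  - intros a b [q1 q2] [s1 s2].
    destruct (K1 a b q1 s1) as (y1 & Y1 & Z1). destruct (K2 a b q2 s2) as (y2 & Y2 & Z2).
    exists (y1, y2). split; [|apply HP; now split].
    now apply (is_RInt_fct_extend_pair (U := R_NormedModule) (V := R_NormedModule)).
Qed.

Lemma Cimproper_CInt01 f l : locint D01 (fun t => Re (f t)) -> locint D01 (fun t => Im (f t)) ->
  Cimproper D01 f l -> CInt01 f = l.
Proof.
  intros I1 I2 [H1 H2]. unfold CInt01.
  apply improper_gen01 in H1; auto. apply improper_gen01 in H2; auto.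
  exact (RInt_gen_pair (at_right 0) (at_left 1) f l H1 H2).
Qed.

Lemma Cimproper_CInt0oo f l : locint D0oo (fun t => Re (f t)) -> locint D0oo (fun t => Im (f t)) ->
  Cimproper D0oo f l -> CInt0oo f = l.
Proof.
  intros I1 I2 [H1 H2]. unfold CInt0oo.
  apply improper_gen0oo in H1; auto. apply improper_gen0oo in H2; auto.
  exact (RInt_gen_pair (at_right 0) (Rbar_locally p_infty) f l H1 H2).
Qed.

(** * Complex powers of positive reals *)

Definition rpow (t : R) (s : C) : C := Cexp (s * RtoC (ln t))%C.

Lemma Cpower_pos t s : 0 < t -> Cpower (RtoC t) s = rpow t s.
Proof.
  intros Ht. unfold Cpower, rpow, Clog. do 2 f_equal.
  rewrite Cmod_R, Rabs_pos_eq by lra.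
  unfold RtoC at 2. f_equal. unfold Carg. destruct Rlt_dec as [h|_].
  - exfalso. simpl in h. lra.
  - rewrite Cmod_R, Rabs_pos_eq by lra. simpl.
    replace (t / t) with 1 by (field; lra). apply acos_1.
Qed.

Lemma rpow_plus t s r : rpow t (s + r)%C = (rpow t s * rpow t r)%C.
Proof. unfold rpow. rewrite <- Cexp_plus. f_equal. ring. Qed.

Lemma rpow_0 t : rpow t 0 = 1.
Proof. unfold rpow. rewrite <- Cexp_0. f_equal. ring. Qed.

Lemma rpow_neq_0 t s : rpow t s <> 0.
Proof. apply Cexp_neq_0. Qed.

Lemma rpow_R t x : rpow t (RtoC x) = RtoC (Rpower t x).
Proof. unfold rpow, Rpower. now rewrite <- RtoC_mult, Cexp_RtoC. Qed.

Lemma rpow_1 t : 0 < t -> rpow t 1 = RtoC t.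
Proof. intros Ht. rewrite rpow_R, Rpower_1; auto. Qed.

Lemma rpow_nat t n : 0 < t -> rpow t (RtoC (INR n)) = RtoC (t ^ n).
Proof. intros Ht. now rewrite rpow_R, Rpower_pow. Qed.

Lemma rpow_mult a b s : 0 < a -> 0 < b -> rpow (a * b) s = (rpow a s * rpow b s)%C.
Proof.
  intros Ha Hb. unfold rpow. rewrite <- Cexp_plus, ln_mult, RtoC_plus by auto. f_equal. ring.
Qed.

Lemma rpow_opp t s : (rpow t (- s) * rpow t s)%C = 1.
Proof. rewrite <- rpow_plus, <- (rpow_0 t). f_equal. ring. Qed.

Lemma rpow_inv c s : 0 < c -> rpow (/ c) s = rpow c (- s).
Proof. intros Hc. unfold rpow. rewrite ln_Rinv, RtoC_opp by auto. f_equal. ring. Qed.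

Lemma Cmod_rpow t s : Cmod (rpow t s) = Rpower t (Re s).
Proof. unfold rpow. rewrite Cmod_Cexp. unfold Rpower. f_equal. cring. Qed.

Lemma rpow_pred t s : 0 < t -> rpow t s = (RtoC t * rpow t (s - 1))%C.
Proof.
  intros Ht. rewrite <- (rpow_1 t Ht) at 1. rewrite <- rpow_plus. f_equal. ring.
Qed.

Lemma Cderiv_val f t l l' : Cderiv f t l -> l = l' -> Cderiv f t l'.
Proof. now intros H <-. Qed.

Lemma Cderiv_rpow t s : 0 < t -> Cderiv (fun x => rpow x s) t (s * rpow t (s - 1))%C.
Proof.
  intros Ht. eapply Cderiv_val.
  - apply Cderiv_Cexp. apply (Cderiv_mult (fun _ => s) (fun x => RtoC (ln x))).
    + apply Cderiv_const.
    + apply Cderiv_RtoC. apply is_derive_Reals, derivable_pt_lim_ln, Ht.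
  - cbv beta. change (Cexp (s * RtoC (ln t))%C) with (rpow t s).
    rewrite (rpow_pred t s Ht), RtoC_inv by lra. field.
    intros h. apply RtoC_inj in h. lra.
Qed.

Lemma Ccont_rpow t s : 0 < t -> Ccont (fun x => rpow x s) t.
Proof. intros Ht. eapply Cderiv_cont. now apply Cderiv_rpow. Qed.

Lemma continuous_Rpower t y : 0 < t -> continuous (fun x => Rpower x y) t.
Proof. intros H. apply: ex_derive_continuous. unfold Rpower. auto_derive; auto. Qed.

(** * Exponential decay beats powers *)

Lemma Rpower_exp_bound y d : 0 <= y -> 0 < d ->
  exists M, 0 < M /\ forall t, 0 < t -> Rpower t y * exp (- (d * t)) <= M.
Proof.
  intros Hy Hd. destruct (Req_dec y 0) as [->|Hy0].
  - exists 1. split; [lra|]. intros t Ht. rewrite Rpower_O, Rmult_1_l by auto.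
    apply exp_le_1. pose proof (Rmult_lt_0_compat _ _ Hd Ht). lra.
  - set (c := d / y). assert (Hc : 0 < c) by pos.
    exists (exp (- y - y * ln c)). split; [pos|]. intros t Ht.
    unfold Rpower. rewrite <- exp_plus.
    assert (y * ln t <= d * t - y - y * ln c).
    { pose proof (ln_le_pred (c * t) (Rmult_lt_0_compat _ _ Hc Ht)) as H.
      rewrite ln_mult in H by auto.
      assert (y * (ln c + ln t) <= y * (c * t - 1)) by (apply Rmult_le_compat_l; lra).
      replace (y * (c * t - 1)) with (d * t - y) in * by (unfold c; field; lra). lra. }
    apply exp_le. lra.
Qed.

Lemma Rpower_le_1_plus y x m : 0 < y -> 0 <= x <= INR m -> Rpower y x <= 1 + y ^ m.
Proof.
  intros Hy Hx. assert (0 < y ^ m) by pos.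
  destruct (Rle_dec 1 y) as [h|h].
  - apply Rle_trans with (y ^ m); [|lra]. rewrite <- Rpower_pow by auto.
    apply Rle_Rpower; lra.
  - assert (Rpower y x <= 1); [|lra].
    rewrite <- exp_0. unfold Rpower.
    assert (ln y < 0) by (rewrite <- ln_1; apply ln_increasing; lra).
    assert (x * ln y <= 0) by (replace 0 with (x * 0) by ring; apply Rmult_le_compat_l; lra).
    apply exp_le. lra.
Qed.

(** The exponential beats [(1 + t^s)^2], which leaves a multiple of the derivative of the bounded
    function [t^s / (1 + t^s)]. *)
Lemma ibound_gamma s d : 0 < s -> 0 < d ->
  exists B, ibound D0oo (fun t => Rpower t (s - 1) * exp (- (d * t))) B.
Proof.
  intros Hs Hd.
  destruct (Rpower_exp_bound (2 * s) d) as (M & HM & KM); [lra|auto|].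
  set (K := (2 + 2 * M) / s).
  set (F := fun t => K * (Rpower t s / (1 + Rpower t s))).
  exists (K - 0).
  assert (HK : 0 < K) by pos.
  apply (ibound_derive D0oo F _ (fun t => K * (s * Rpower t (s - 1) / (1 + Rpower t s) ^ 2))).
  - apply interval_D0oo.
  - apply locint_continuous; [apply interval_D0oo|]. intros t Ht.
    apply Rcont_mult; [now apply continuous_Rpower|].
    apply: ex_derive_continuous. auto_derive; auto.
  - intros t Ht. unfold D0oo in Ht. pose proof (Rpower_pos t s) as Hp. split.
    + unfold F. unfold Rpower in *. auto_derive; [split; [lra|split; auto]; lra|].
      replace ((s - 1) * ln t) with (s * ln t - ln t) by ring.
      unfold Rminus. rewrite exp_plus, exp_Ropp, exp_ln by auto. field. split; lra.
    + apply Rcont_mult; [apply continuous_const|].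
      apply: ex_derive_continuous. unfold Rpower in *. auto_derive.
      set (u := exp (s * ln t)) in *.
      repeat split; auto. apply Rgt_not_eq. pos.
  - intros t Ht. unfold D0oo in Ht. pose proof (Rpower_pos t s) as Hp.
    pose proof (Rpower_pos t (s - 1)) as Hp'.
    specialize (KM t Ht). replace (2 * s) with (s + s) in KM by ring.
    rewrite Rpower_plus in KM.
    set (u := Rpower t s) in *.
    assert (He : exp (- (d * t)) <= 1).
    { apply exp_le_1. pose proof (Rmult_lt_0_compat _ _ Hd Ht). lra. }
    pose proof (exp_pos (- (d * t))) as He0. set (e := exp (- (d * t))) in *.
    assert ((1 + u) ^ 2 * e <= 2 + 2 * M).
    { assert (Hsq : 0 <= (1 - u) ^ 2) by (apply pow2_ge_0).
      assert ((1 + u) ^ 2 * e <= (2 + 2 * (u * u)) * e) by (apply Rmult_le_compat_r; lra). lra. }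
    replace (K * (s * Rpower t (s - 1) / (1 + u) ^ 2))
      with (Rpower t (s - 1) * ((2 + 2 * M) / (1 + u) ^ 2)) by (unfold K; field; lra).
    apply Rmult_le_compat_l; [lra|].
    apply Rmult_le_reg_r with ((1 + u) ^ 2); [pos|].
    unfold Rdiv. rewrite Rmult_assoc, Rinv_l by (apply pow_nonzero; lra). lra.
  - intros t Ht. pose proof (Rpower_pos t s) as Hp. set (u := Rpower t s) in *. unfold F. fold u.
    assert (0 <= u / (1 + u) <= 1).
    { split; [pos|].
      apply Rmult_le_reg_r with (1 + u); [lra|]. unfold Rdiv. rewrite Rmult_assoc, Rinv_l; lra. }
    split.
    + pos.
    + replace K with (K * 1) at 2 by ring. apply Rmult_le_compat_l; lra.
Qed.

(** * The Gamma function *)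

(** [xi] is a complex scale: the integral over (0, oo) is [Gamma(s) xi^(-s)]. *)
Definition gamma_kernel (s xi : C) (t : R) : C := (rpow t (s - 1) * Cexp (- (xi * RtoC t)))%C.

Lemma Cmod_gamma_kernel s xi t :
  Cmod (gamma_kernel s xi t) = Rpower t (Re s - 1) * exp (- (Re xi * t)).
Proof.
  unfold gamma_kernel. rewrite Cmod_mult, Cmod_rpow, Cmod_Cexp. f_equal; f_equal; cring.
Qed.

Lemma Ccont_Cexp_lin xi t : Ccont (fun t => Cexp (- (xi * RtoC t))%C) t.
Proof.
  apply Ccont_Cexp. apply (Ccont_ext_loc (fun t => ((- xi) * RtoC t)%C)).
  - apply filter_forall. intros x. ring.
  - apply Ccont_mult; [apply Ccont_const|]. apply Ccont_RtoC, continuous_id.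
Qed.

Lemma Ccont_gamma_kernel s xi : Ccont_on D0oo (gamma_kernel s xi).
Proof.
  intros t Ht. apply Ccont_mult; [now apply Ccont_rpow|apply Ccont_Cexp_lin].
Qed.

Lemma locint_gamma x d : locint D0oo (fun t => Rpower t x * exp (- (d * t))).
Proof.
  apply locint_continuous; [apply interval_D0oo|]. intros t Ht.
  apply Rcont_mult; [now apply continuous_Rpower|].
  apply: ex_derive_continuous. auto_derive; auto.
Qed.

Lemma gamma_kernel_1 s t : gamma_kernel s 1 t = (rpow t (s - 1) * RtoC (exp (- t)))%C.
Proof.
  unfold gamma_kernel. f_equal. rewrite <- Cexp_RtoC, RtoC_opp. f_equal. ring.
Qed.

Lemma ex_gamma_kernel s xi : 0 < Re s -> 0 < Re xi ->
  exists l, Cimproper D0oo (gamma_kernel s xi) l.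
Proof.
  intros Hs Hx. destruct (ibound_gamma (Re s) (Re xi) Hs Hx) as [B HB].
  destruct (Cimproper_abs D0oo (gamma_kernel s xi)
    (fun t => Rpower t (Re s - 1) * exp (- (Re xi * t))) B) as (l & Hl & _).
  - apply interval_D0oo.
  - apply Ccont_gamma_kernel.
  - apply locint_gamma.
  - intros t _. rewrite Cmod_gamma_kernel. apply Rle_refl.
  - exact HB.
  - now exists l.
Qed.

Lemma Ccont_on_ext D f g : (forall t, D t -> locally t D) -> (forall t, D t -> f t = g t) ->
  Ccont_on D f -> Ccont_on D g.
Proof.
  intros HD H Hf t Ht. apply (Ccont_ext_loc f); [|now apply Hf].
  generalize (HD t Ht). apply filter_imp. exact H.
Qed.

Lemma open_D0oo t : D0oo t -> locally t D0oo.
Proof.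
  intros Ht. exists (mkposreal t Ht). intros y Hy. apply Rabs_def2 in Hy.
  unfold minus, plus, opp in Hy; simpl in Hy. unfold D0oo. lra.
Qed.

Lemma open_D01 t : D01 t -> locally t D01.
Proof.
  intros Ht. assert (0 < Rmin t (1 - t)) as Hp by (apply Rmin_glb_lt; unfold D01 in Ht; lra).
  exists (mkposreal _ Hp). intros y Hy. apply Rabs_def2 in Hy.
  unfold minus, plus, opp in Hy; simpl in Hy. unfold D01.
  pose proof (Rmin_l t (1 - t)). pose proof (Rmin_r t (1 - t)). lra.
Qed.

Lemma CInt0oo_spec f g l : Ccont_on D0oo g -> (forall t, 0 < t -> g t = f t) ->
  Cimproper D0oo g l -> CInt0oo f = l.
Proof.
  intros Hg H Hl. assert (HD := interval_D0oo).
  assert (Hf : Ccont_on D0oo f) by (apply (Ccont_on_ext D0oo g); [apply open_D0oo|exact H|auto]).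
  apply Cimproper_CInt0oo.
  - now apply Ccont_on_Re.
  - now apply Ccont_on_Im.
  - now apply (Cimproper_ext D0oo g).
Qed.

Lemma CGamma_spec s : 0 < Re s -> Cimproper D0oo (gamma_kernel s 1) (CGamma s).
Proof.
  intros Hs. destruct (ex_gamma_kernel s 1 Hs) as [l Hl]; [simpl; lra|].
  replace (CGamma s) with l; auto. symmetry.
  unfold CGamma. apply (CInt0oo_spec _ (gamma_kernel s 1)); auto.
  - apply Ccont_gamma_kernel.
  - intros t Ht. rewrite gamma_kernel_1, Cpower_pos; auto.
Qed.

Lemma Cderiv_Cexp_lin xi t :
  Cderiv (fun t => Cexp (- (xi * RtoC t))%C) t (- xi * Cexp (- (xi * RtoC t)))%C.
Proof.
  apply (Cderiv_Cexp (fun t => (- (xi * RtoC t))%C)).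
  split.
  - apply (is_derive_ext (fun x => (- Re xi) * x)); [intros x; cring|].
    apply (is_derive_val _ _ (- Re xi)); [auto_derive; auto; ring|reflexivity].
  - apply (is_derive_ext (fun x => (- Im xi) * x)); [intros x; cring|].
    apply (is_derive_val _ _ (- Im xi)); [auto_derive; auto; ring|reflexivity].
Qed.

Lemma Rpower_small x eps : 0 < x -> 0 < eps ->
  exists c, 0 < c /\ forall t, 0 < t -> t <= c -> Rpower t x < eps.
Proof.
  intros Hx He. exists (Rpower (eps / 2) (/ x)). split; [pos|].
  intros t Ht h. apply Rle_lt_trans with (Rpower (Rpower (eps / 2) (/ x)) x).
  - apply Rle_Rpower_l; lra.
  - rewrite Rpower_mult, Rinv_l, Rpower_1; lra.
Qed.

Lemma CGamma_S s : 0 < Re s -> CGamma (s + 1)%C = (s * CGamma s)%C.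
Proof.
  intros Hs. assert (HD := interval_D0oo).
  assert (Hs1 : 0 < Re (s + 1)%C) by (change (0 < Re s + 1); lra).
  set (F := fun t => (rpow t s * Cexp (- (1 * RtoC t)))%C).
  set (f := fun t => (s * gamma_kernel s 1 t + (-(1)) * gamma_kernel (s + 1) 1 t)%C).
  assert (Hf : Ccont_on D0oo f).
  { intros t Ht. apply Ccont_plus; apply Ccont_mult; try apply Ccont_const;
      now apply Ccont_gamma_kernel. }
  assert (Hm : forall t, 0 < t -> Cmod (F t - 0)%C = Rpower t (Re s) * exp (- t)).
  { intros t Ht. replace (F t - 0)%C with (F t) by ring. unfold F.
    rewrite Cmod_mult, Cmod_rpow, Cmod_Cexp. do 2 f_equal. cring. }
  assert (H0 : Cimproper D0oo f (0 - 0)%C).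
  { apply (Cimproper_derive D0oo F); auto.
    - intros t Ht. eapply Cderiv_val.
      + apply Cderiv_mult; [apply Cderiv_rpow, Ht|apply Cderiv_Cexp_lin].
      + unfold f, gamma_kernel. replace (s + 1 - 1)%C with s by ring. ring.
    - intros eps He. destruct (Rpower_small (Re s) eps Hs He) as (c & Hc & K).
      exists c. split; auto. intros t Ht h. rewrite Hm by auto.
      apply Rle_lt_trans with (Rpower t (Re s) * 1); [|rewrite Rmult_1_r; now apply K].
      apply Rmult_le_compat_l; [pos|].
      apply exp_le_1. unfold D0oo in Ht. lra.
    - intros eps He. destruct (Rpower_exp_bound (Re s + 1) 1) as (M & HM & K); [lra|lra|].
      exists (2 * M / eps). split; [pos|].
      intros t Ht h. rewrite Hm by auto. specialize (K t Ht).
      rewrite Rpower_plus, Rpower_1, Rmult_1_l in K by auto.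
      apply Rmult_lt_reg_r with t; [auto|].
      apply Rle_lt_trans with M.
      { replace (Rpower t (Re s) * exp (- t) * t) with (Rpower t (Re s) * t * exp (- t)) by ring.
        exact K. }
      assert (2 * M <= eps * t).
      { apply Rmult_le_compat_l with (r := eps) in h; [|lra].
        replace (eps * (2 * M / eps)) with (2 * M) in h by (field; lra). lra. }
      lra. }
  assert (H1 : Cimproper D0oo f (s * CGamma s + (-(1)) * CGamma (s + 1))%C).
  { apply Cimproper_plus; auto.
    - intros t Ht. apply Ccont_mult; [apply Ccont_const|now apply Ccont_gamma_kernel].
    - intros t Ht. apply Ccont_mult; [apply Ccont_const|now apply Ccont_gamma_kernel].
    - apply Cimproper_scal; auto; [apply Ccont_gamma_kernel|now apply CGamma_spec].
    - apply Cimproper_scal; auto; [apply Ccont_gamma_kernel|now apply CGamma_spec]. }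
  pose proof (Cimproper_unique _ _ _ _ HD H0 H1) as HH.
  replace (CGamma (s + 1)%C) with
    (s * CGamma s - (s * CGamma s + (-(1)) * CGamma (s + 1)))%C by ring.
  rewrite <- HH. ring.
Qed.

Definition RGamma (x : R) : R := Re (CGamma (RtoC x)).

Lemma RGamma_improper x : 0 < x ->
  improper D0oo (fun t => Rpower t (x - 1) * exp (- (1 * t))) (RGamma x).
Proof.
  intros Hx. destruct (CGamma_spec (RtoC x)) as [H _]; [exact Hx|].
  refine (improper_ext _ _ _ _ interval_D0oo _ H).
  intros t Ht. rewrite gamma_kernel_1, <- RtoC_minus, rpow_R, <- RtoC_mult, Rmult_1_l. reflexivity.
Qed.

Lemma CGamma_R x : 0 < x -> CGamma (RtoC x) = RtoC (RGamma x).
Proof.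
  intros Hx. apply C_ext; [reflexivity|].
  destruct (CGamma_spec (RtoC x)) as [_ H]; [exact Hx|].
  apply (improper_unique D0oo (fun t => Im (gamma_kernel (RtoC x) 1 t))); auto.
  - apply interval_D0oo.
  - apply (improper_ext D0oo (fun t => 0 * (Rpower t (x - 1) * exp (- (1 * t))))).
    + apply interval_D0oo.
    + intros t Ht. rewrite gamma_kernel_1, <- RtoC_minus, rpow_R, <- RtoC_mult. cring.
    + replace (Im (RtoC (RGamma x))) with (0 * RGamma x) by cring.
      apply improper_scal; [apply interval_D0oo|apply locint_gamma|now apply RGamma_improper].
Qed.

(** The part of the integral over [A, A + 1] already gives the bound. *)
Lemma RGamma_ge x A : 0 <= x -> 0 < A -> Rpower A x * exp (- (A + 1)) <= RGamma (x + 1).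
Proof.
  intros Hx HA.
  assert (HI : ibound D0oo (fun t => Rpower t (x + 1 - 1) * exp (- (1 * t))) (RGamma (x + 1))).
  { apply improper_ge.
    - apply interval_D0oo.
    - apply locint_gamma.
    - intros t _. pos.
    - apply RGamma_improper. lra. }
  apply Rle_trans with (RInt (fun t => Rpower t (x + 1 - 1) * exp (- (1 * t))) A (A + 1)).
  2:{ apply HI; unfold D0oo; lra. }
  replace (Rpower A x * exp (- (A + 1))) with
    (RInt (fun _ => Rpower A x * exp (- (A + 1))) A (A + 1)).
  2:{ rewrite (is_RInt_unique _ _ _ _ (is_RInt_const _ _ _)). unfold scal; simpl; unfold mult; simpl. ring. }
  apply RInt_le; [lra|apply ex_RInt_const|apply locint_gamma; unfold D0oo; lra|].
  intros t Ht. replace (x + 1 - 1) with x by ring.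
  apply Rmult_le_compat; try (apply Rlt_le; pos).
  - apply Rle_Rpower_l; lra.
  - apply exp_le; lra.
Qed.

Lemma RGamma_pos x : 0 <= x -> 0 < RGamma (x + 1).
Proof.
  intros Hx. eapply Rlt_le_trans; [|apply (RGamma_ge x 1); lra].
  pos.
Qed.

Lemma RGamma_S x : 0 < x -> RGamma (x + 1) = x * RGamma x.
Proof.
  intros Hx. unfold RGamma at 1. rewrite RtoC_plus, CGamma_S by auto.
  rewrite (CGamma_R x Hx). cring.
Qed.

Lemma RGamma_1 : RGamma 1 = 1.
Proof.
  assert (HD := interval_D0oo).
  apply (improper_unique D0oo (fun t => Rpower t (1 - 1) * exp (- (1 * t)))); auto.
  - apply RGamma_improper; lra.
  - apply (improper_ext D0oo (fun t => exp (- t))); auto.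
    { intros t Ht. replace (1 - 1) with 0 by ring. rewrite Rpower_O, !Rmult_1_l; auto. }
    replace 1 with (0 - - (1)) at 1 by ring.
    apply (improper_derive D0oo (fun t => - exp (- t))); auto.
    + intros t Ht. split; [auto_derive; auto; ring|].
      apply: ex_derive_continuous. auto_derive; auto.
    + intros eps He. exists (eps / 2). split; [unfold D0oo; lra|]. intros a Ha h.
      unfold D0oo in Ha. pose proof (exp_ineq1_le (- a)).
      assert (exp (- a) < 1) by (rewrite <- exp_0; apply exp_increasing; lra).
      apply Rabs_def1; lra.
    + intros eps He. exists (/ eps). split; [pos|]. intros a Ha h.
      unfold D0oo in Ha. pose proof (exp_ineq1_le a). pose proof (exp_pos (- a)).
      assert (exp (- a) < eps).
      { rewrite exp_Ropp. rewrite <- (Rinv_inv eps).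
        apply Rinv_lt_contravar; [|lra].
        pos. }
      apply Rabs_def1; lra.
Qed.

Lemma RGamma_fact n : RGamma (INR n + 1) = INR (fact n).
Proof.
  induction n as [|n IH].
  - simpl. rewrite Rplus_0_l. apply RGamma_1.
  - rewrite S_INR, RGamma_S by (pose proof (pos_INR n); lra).
    rewrite IH. rewrite fact_simpl, mult_INR, S_INR. reflexivity.
Qed.

Lemma improper_moment n : improper D0oo (fun t => t ^ n * exp (- t)) (INR (fact n)).
Proof.
  rewrite <- RGamma_fact. pose proof (pos_INR n).
  refine (improper_ext _ _ _ _ interval_D0oo _ (RGamma_improper (INR n + 1) ltac:(lra))).
  intros t Ht. replace (INR n + 1 - 1) with (INR n) by ring.
  now rewrite Rpower_pow, Rmult_1_l.
Qed.

(** * Gauss' limit for the Gamma function *)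

(** Close to 1 continuity gives [d]; elsewhere [(y - 1)^2] is bounded below while
    [|y^s| <= 1 + y^m]. A majorant quadratic at 1 is what second moments can integrate. *)
Lemma rpow_near_one s d : 0 <= Re s -> 0 < d -> exists K m, 0 <= K /\
  forall y, 0 < y -> Cmod (rpow y s - 1)%C <= d + K * ((y - 1) ^ 2 * (1 + y ^ m)).
Proof.
  intros Hs Hd.
  destruct (nfloor_ex (Re s) Hs) as [m0 [_ Hm]]. set (m := S m0).
  assert (Hm' : Re s <= INR m) by (unfold m; rewrite S_INR; lra).
  assert (Hc : continuous (fun y => Cmod (rpow y s + - (1))%C) 1).
  { apply Ccont_Cmod. apply Ccont_plus; [apply Ccont_rpow; lra|apply Ccont_const]. }
  destruct (proj1 (filterlim_locally _ _) Hc (mkposreal d Hd)) as [eta He].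
  pose proof (cond_pos eta) as Hp.
  exists (2 / eta ^ 2), m. split.
  { apply Rlt_le, Rdiv_lt_0_compat; [lra|]. pos. }
  intros y Hy. assert (Hym : 0 < y ^ m) by pos.
  assert (Hsq : 0 <= (y - 1) ^ 2) by apply pow2_ge_0.
  destruct (Rlt_dec (Rabs (y - 1)) eta) as [h|h].
  - specialize (He y h). unfold ball in He; simpl in He. unfold AbsRing_ball in He; simpl in He.
    apply Rabs_def2 in He. unfold minus, plus, opp in He; simpl in He.
    unfold rpow at 2 in He. rewrite ln_1 in He.
    replace (Cexp (s * RtoC 0) + - (1))%C with (RtoC 0) in He.
    2:{ replace (s * RtoC 0)%C with (RtoC 0) by ring. rewrite Cexp_0. ring. }
    rewrite Cmod_0 in He.
    assert (0 <= 2 / eta ^ 2 * ((y - 1) ^ 2 * (1 + y ^ m))).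
    { apply Rmult_le_pos; [pos|].
      pos. }
    replace (rpow y s - 1)%C with (rpow y s + - (1))%C by ring. lra.
  - apply Rnot_lt_le in h.
    assert (Hle : eta ^ 2 <= (y - 1) ^ 2).
    { rewrite <- (pow2_abs (y - 1)). apply pow_incr. lra. }
    assert (Cmod (rpow y s - 1)%C <= 2 + y ^ m).
    { eapply Rle_trans; [apply Cmod_triangle|]. rewrite Cmod_opp, Cmod_1, Cmod_rpow.
      pose proof (Rpower_le_1_plus y (Re s) m Hy ltac:(lra)). lra. }
    assert (2 * (1 + y ^ m) <= 2 / eta ^ 2 * ((y - 1) ^ 2 * (1 + y ^ m))).
    { replace (2 / eta ^ 2 * ((y - 1) ^ 2 * (1 + y ^ m)))
        with (((y - 1) ^ 2 / eta ^ 2) * (2 * (1 + y ^ m))) by (field; lra).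
      rewrite <- (Rmult_1_l (2 * (1 + y ^ m))) at 1. apply Rmult_le_compat_r; [lra|].
      assert (0 < eta ^ 2) by pos.
      apply Rmult_le_reg_r with (eta ^ 2); auto. unfold Rdiv. rewrite Rmult_assoc, Rinv_l; lra. }
    lra.
Qed.

(** Mean of [(t / N)^k] under the Gamma density [t^N e^(-t) / N!]. *)
Definition moment (N k : nat) : R := INR (fact (N + k)) / (INR (fact N) * INR N ^ k).

Lemma moment_lim k : is_lim_seq (fun N => moment N k) 1.
Proof.
  assert (Hinv : is_lim_seq (fun N => / INR N) 0).
  { change (Finite 0) with (Rbar_inv p_infty). apply is_lim_seq_inv; [apply is_lim_seq_INR|easy]. }
  induction k as [|k IH].
  - apply (is_lim_seq_ext (fun _ => 1)); [|apply is_lim_seq_const].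
    intros N. unfold moment. rewrite Nat.add_0_r. simpl. field. apply INR_fact_neq_0.
  - apply (is_lim_seq_ext_loc (fun N => moment N k * (1 + (INR k + 1) * / INR N))).
    + exists 1%nat. intros N HN. unfold moment.
      replace (N + S k)%nat with (S (N + k)) by lia.
      rewrite fact_simpl, mult_INR, S_INR, plus_INR. simpl pow.
      assert (0 < INR N) by (apply lt_0_INR; lia).
      field. split; [|split]; try apply INR_fact_neq_0; try apply pow_nonzero; lra.
    + replace 1 with (1 * (1 + (INR k + 1) * 0)) at 1 by ring.
      apply is_lim_seq_mult'; auto. apply is_lim_seq_plus'; [apply is_lim_seq_const|].
      apply is_lim_seq_mult'; auto. apply is_lim_seq_const.
Qed.

Definition moment_kernel (N k : nat) (t : R) : R := t ^ N * exp (- t) * (t / INR N) ^ k.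

Lemma locint_moment N k : locint D0oo (moment_kernel N k).
Proof.
  apply locint_continuous; [apply interval_D0oo|]. intros t Ht. unfold moment_kernel.
  apply: ex_derive_continuous. auto_derive; auto.
Qed.

Lemma improper_moment_kernel N k : (0 < N)%nat ->
  improper D0oo (moment_kernel N k) (INR (fact N) * moment N k).
Proof.
  intros HN. assert (0 < INR N) by now apply lt_0_INR.
  assert (Hk : 0 < INR N ^ k) by pos.
  replace (INR (fact N) * moment N k) with (/ INR N ^ k * INR (fact (N + k))).
  2:{ unfold moment. field. split; [lra|apply INR_fact_neq_0]. }
  refine (improper_ext _ _ _ _ interval_D0oo _
    (improper_scal _ _ _ _ interval_D0oo _ (improper_moment (N + k)))).
  - intros t _. unfold moment_kernel. rewrite pow_add. unfold Rdiv.
    rewrite Rpow_mult_distr, pow_inv. ring.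
  - apply locint_continuous; [apply interval_D0oo|]. intros t Ht.
    apply: ex_derive_continuous. auto_derive; auto.
Qed.

Lemma improper_moment_square N k : (0 < N)%nat ->
  locint D0oo (fun t => t ^ N * exp (- t) * ((t / INR N - 1) ^ 2 * (t / INR N) ^ k)) /\
  improper D0oo (fun t => t ^ N * exp (- t) * ((t / INR N - 1) ^ 2 * (t / INR N) ^ k))
    (INR (fact N) * (moment N (S (S k)) - 2 * moment N (S k) + moment N k)).
Proof.
  intros HN. split.
  { apply locint_continuous; [apply interval_D0oo|]. intros t Ht.
    apply: ex_derive_continuous. auto_derive; auto. }
  apply (improper_ext D0oo (fun t => 1 * (1 * moment_kernel N (S (S k)) t + (-2) * moment_kernel N (S k) t)
    + 1 * moment_kernel N k t)); [apply interval_D0oo| |].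
  { intros t _. unfold moment_kernel. simpl. ring. }
  replace (INR (fact N) * (moment N (S (S k)) - 2 * moment N (S k) + moment N k)) with
    (1 * (1 * (INR (fact N) * moment N (S (S k))) + (-2) * (INR (fact N) * moment N (S k)))
     + 1 * (INR (fact N) * moment N k)) by ring.
  assert (HD := interval_D0oo).
  apply improper_lin; auto using locint_moment, improper_moment_kernel.
  - apply locint_plus; apply locint_scal; apply locint_moment.
  - apply improper_lin; auto using locint_moment, improper_moment_kernel.
Qed.

(** The Gamma density [t^N e^(-t) / N!] concentrates around [t = N], so that
    [(t / N)^s] has mean close to 1; the second moment controls the deviation. *)
Lemma gauss_limit s eps : 0 <= Re s -> 0 < eps -> eventually (fun N =>
  Cmod (CGamma (s + RtoC (INR N) + 1) - RtoC (INR (fact N)) * rpow (INR N) s)%C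
   <= eps * (INR (fact N) * Rpower (INR N) (Re s))).
Proof.
  intros Hs He. assert (HD := interval_D0oo).
  destruct (rpow_near_one s (eps / 4) Hs) as (K & m & HK & Hnear); [lra|].
  set (v := fun N => eps / 4 * moment N 0 + K * ((moment N 2 - 2 * moment N 1 + moment N 0)
     + (moment N (S (S m)) - 2 * moment N (S m) + moment N m))).
  assert (Hv : is_lim_seq v (eps / 4 * 1 + K * ((1 - 2 * 1 + 1) + (1 - 2 * 1 + 1)))).
  { unfold v. repeat match goal with
      | |- is_lim_seq (fun N => moment N _) _ => apply moment_lim
      | |- is_lim_seq (fun _ => ?c) _ => apply is_lim_seq_const
      | |- is_lim_seq (fun N => _ + _) _ => apply is_lim_seq_plus'
      | |- is_lim_seq (fun N => _ - _) _ => apply is_lim_seq_minus'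
      | |- is_lim_seq (fun N => _ * _) _ => apply is_lim_seq_mult'
      end. }
  assert (Hp : 0 < eps / 4) by lra.
  apply is_lim_seq_spec in Hv. destruct (Hv (mkposreal _ Hp)) as [N0 HN0]. simpl in HN0.
  exists (S N0). intros N HN. specialize (HN0 N ltac:(lia)).
  apply Rabs_def2 in HN0.
  assert (HvN : v N <= eps / 2) by lra. clear HN0 Hv.
  assert (HNpos : 0 < INR N) by (apply lt_0_INR; lia).
  set (g := fun t => t ^ N * exp (- t) * (eps / 4 + K * ((t / INR N - 1) ^ 2 * (1 + (t / INR N) ^ m)))).
  assert (Ig : locint D0oo g).
  { apply locint_continuous; auto. intros t Ht. unfold g.
    apply: ex_derive_continuous. auto_derive; auto. }
  assert (Hg : improper D0oo g (INR (fact N) * v N)).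
  { destruct (improper_moment_square N 0 ltac:(lia)) as [I0 H0].
    destruct (improper_moment_square N m ltac:(lia)) as [Im Hm].
    apply (improper_ext D0oo (fun t => eps / 4 * moment_kernel N 0 t +
      K * (1 * (t ^ N * exp (- t) * ((t / INR N - 1) ^ 2 * (t / INR N) ^ 0)) +
           1 * (t ^ N * exp (- t) * ((t / INR N - 1) ^ 2 * (t / INR N) ^ m))))); auto.
    { intros t _. unfold g, moment_kernel. simpl. ring. }
    replace (INR (fact N) * v N) with (eps / 4 * (INR (fact N) * moment N 0) +
      K * (1 * (INR (fact N) * (moment N 2 - 2 * moment N 1 + moment N 0)) +
           1 * (INR (fact N) * (moment N (S (S m)) - 2 * moment N (S m) + moment N m))))
      by (unfold v; ring).
    apply improper_lin; auto.
    - apply locint_moment.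
    - apply locint_plus; apply locint_scal; auto.
    - apply improper_moment_kernel; lia.
    - apply improper_lin; auto. }
  assert (g0 : forall t, D0oo t -> 0 <= g t).
  { intros t Ht. unfold D0oo in Ht. unfold g.
    assert (0 <= (t / INR N) ^ m) by pos.
    pose proof (pow2_ge_0 (t / INR N - 1)).
    apply Rmult_le_pos; [pos|].
    assert (0 <= K * ((t / INR N - 1) ^ 2 * (1 + (t / INR N) ^ m)));
      [|lra]. pos. }
  set (r := RtoC (INR N)).
  set (f := fun t => (gamma_kernel (s + r + 1) 1 t + (- rpow (INR N) s) * gamma_kernel (r + 1) 1 t)%C).
  assert (Cf : Ccont_on D0oo f).
  { intros t Ht. apply Ccont_plus; [|apply Ccont_mult; [apply Ccont_const|]];
      now apply Ccont_gamma_kernel. }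
  assert (Hr1 : 0 < Re (r + 1)%C) by (change (0 < INR N + 1); lra).
  assert (Hr2 : 0 < Re (s + r + 1)%C) by (change (0 < Re s + INR N + 1); lra).
  assert (Hf : Cimproper D0oo f (CGamma (s + r + 1) + (- rpow (INR N) s) * CGamma (r + 1))%C).
  { apply Cimproper_plus; auto.
    - apply Ccont_gamma_kernel.
    - intros t Ht. apply Ccont_mult; [apply Ccont_const|now apply Ccont_gamma_kernel].
    - now apply CGamma_spec.
    - apply Cimproper_scal; auto; [apply Ccont_gamma_kernel|now apply CGamma_spec]. }
  set (P := Rpower (INR N) (Re s)). assert (HP : 0 < P) by pos.
  destruct (Cimproper_abs D0oo f (fun t => P * g t) (P * (INR (fact N) * v N)))
    as (l & Hl & Bl); auto.
  - now apply locint_scal.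
  - intros t Ht. unfold D0oo in Ht.
    replace (f t) with (rpow (INR N) s * (RtoC (t ^ N * exp (- t)) * (rpow (t / INR N) s - 1)))%C.
    + rewrite 2!Cmod_mult, Cmod_rpow, Cmod_R. fold P. apply Rmult_le_compat_l; [lra|].
      rewrite Rabs_pos_eq by pos.
      apply Rmult_le_compat_l;
        [pos|].
      apply Hnear. pos.
    + unfold f. rewrite 2!gamma_kernel_1.
      replace (s + r + 1 - 1)%C with (s + r)%C by ring.
      replace (r + 1 - 1)%C with r by ring.
      rewrite rpow_plus. unfold r. rewrite rpow_nat by auto.
      replace (rpow t s) with (rpow (INR N) s * rpow (t / INR N) s)%C.
      * rewrite RtoC_mult. ring.
      * rewrite <- rpow_mult; auto; [f_equal; field; lra|pos].
  - apply ibound_scal; auto; [lra|]. now apply improper_ge.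
  - rewrite (Cimproper_unique _ _ _ _ HD Hl Hf) in Bl.
    assert (HG : CGamma (r + 1) = RtoC (INR (fact N))).
    { unfold r. rewrite <- RtoC_plus, CGamma_R by (pose proof (pos_INR N); lra).
      now rewrite RGamma_fact. }
    rewrite HG in Bl.
    replace (CGamma (s + r + 1) - RtoC (INR (fact N)) * rpow (INR N) s)%C with
      (CGamma (s + r + 1) + - rpow (INR N) s * RtoC (INR (fact N)))%C by ring.
    eapply Rle_trans; [exact Bl|].
    assert (0 < INR (fact N)) by pos.
    replace (2 * (P * (INR (fact N) * v N))) with (2 * v N * (INR (fact N) * P)) by ring.
    apply Rmult_le_compat_r; [pos|lra].
Qed.

Lemma CGamma_poch s n : 0 < Re s -> CGamma (s + RtoC (INR n))%C = (pochhammer s n * CGamma s)%C.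
Proof.
  intros Hs. induction n as [|n IH].
  - simpl. replace (s + 0)%C with s by ring. ring.
  - rewrite S_INR, RtoC_plus, Cplus_assoc, CGamma_S, IH; [simpl; ring|].
    change (0 < Re s + INR n). pose proof (pos_INR n). lra.
Qed.

(** If [Gamma(s)] vanished, so would all [Gamma(s + N + 1)], against their asymptotics
    [N! N^s]. *)
Lemma CGamma_neq_0 s : 0 < Re s -> CGamma s <> 0.
Proof.
  intros Hs H0. destruct (gauss_limit s (1 / 2)) as [N HN]; [lra|lra|].
  specialize (HN (S N) ltac:(lia)).
  replace (s + RtoC (INR (S N)) + 1)%C with (s + RtoC (INR (S (S N))))%C in HN.
  2:{ rewrite (S_INR (S N)), RtoC_plus. ring. }
  rewrite CGamma_poch, H0 in HN by auto.
  replace (pochhammer s (S (S N)) * 0 - RtoC (INR (fact (S N))) * rpow (INR (S N)) s)%C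
    with (- (RtoC (INR (fact (S N))) * rpow (INR (S N)) s))%C in HN by ring.
  rewrite Cmod_opp, Cmod_mult, Cmod_rpow, Cmod_R, Rabs_pos_eq in HN.
  2:{ pos. }
  pose proof (Rmult_lt_0_compat _ _ (INR_fact_lt_0 (S N)) (Rpower_pos (INR (S N)) (Re s))). lra.
Qed.

(** [(b)_n / n!], the coefficient of [q^n] in [(1 - q)^(-b)]. *)
Fixpoint rbin (b : R) (n : nat) : R :=
  match n with
  | O => 1
  | S m => rbin b m * ((b + INR m) / (INR m + 1))
  end.

Lemma RGamma_poch x n : 0 < x -> RGamma (x + INR n) = rbin x n * INR (fact n) * RGamma x.
Proof.
  intros Hx. induction n as [|n IH].
  - simpl. rewrite Rplus_0_r. ring.
  - pose proof (pos_INR n). rewrite S_INR, <- Rplus_assoc, RGamma_S, IH by lra.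
    rewrite fact_simpl, mult_INR, S_INR. simpl. field. lra.
Qed.

Lemma RGamma_rbin x n : 0 <= x ->
  RGamma (x + INR n + 1) = RGamma (x + 1) * rbin (x + 1) n * INR (fact n).
Proof.
  intros Hx. replace (x + INR n + 1) with (x + 1 + INR n) by ring.
  rewrite RGamma_poch by lra. ring.
Qed.

(** [(x + 1)_N / N! = Gamma(x + 1 + N) / (Gamma(x + 1) N!)], so this is Gauss' limit. *)
Lemma rbin_lim x : 0 <= x ->
  is_lim_seq (fun N => rbin (x + 1) N * Rpower (INR N) (- x)) (/ RGamma (x + 1)).
Proof.
  intros Hx. apply is_lim_seq_spec. intros eps.
  pose proof (RGamma_pos x Hx) as HG. pose proof (cond_pos eps) as He.
  destruct (gauss_limit (RtoC x) (eps * RGamma (x + 1) / 2)) as [N0 HN0].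
  { exact Hx. } { pos. }
  exists (S N0). intros N HN. specialize (HN0 N ltac:(lia)).
  assert (HNpos : 0 < INR N) by (apply lt_0_INR; lia).
  rewrite <- 2!RtoC_plus, CGamma_R, rpow_R, <- RtoC_mult, <- RtoC_minus, Cmod_R in HN0 by lra.
  change (Re (RtoC x)) with x in HN0. rewrite RGamma_rbin in HN0 by auto.
  rewrite Rpower_Ropp. set (P := Rpower (INR N) x) in *.
  assert (HP : 0 < P) by pos. pose proof (INR_fact_lt_0 N) as Hf.
  set (G := RGamma (x + 1)) in *. set (F := INR (fact N)) in *. set (r := rbin (x + 1) N) in *.
  replace (r * / P - / G) with ((G * r * F - F * P) * / (F * P * G)).
  2:{ field. repeat split; apply Rgt_not_eq; auto. }
  assert (HFPG : 0 < F * P * G) by pos.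
  rewrite Rabs_mult, (Rabs_pos_eq (/ _)) by pos.
  apply Rmult_lt_reg_r with (F * P * G); auto.
  rewrite Rmult_assoc, Rinv_l by lra.
  assert (eps * G / 2 * (F * P) = eps * (F * P * G) / 2) by field.
  assert (0 < eps * (F * P * G)) by pos. lra.
Qed.

(** * Binomial coefficients *)

Lemma RtoC_neq_0 x : x <> 0 -> RtoC x <> 0.
Proof. intros H h. apply RtoC_inj in h. contradiction. Qed.

Definition cbin (g : C) (n : nat) : C := (pochhammer g n / RtoC (INR (fact n)))%C.

Lemma cbin_0 g : cbin g 0 = 1.
Proof. unfold cbin. simpl. field. Qed.

Lemma cbin_S g n : cbin g (S n) = (cbin g n * ((g + RtoC (INR n)) / RtoC (INR n + 1)))%C.
Proof.
  unfold cbin. simpl pochhammer. rewrite fact_simpl, mult_INR, S_INR, RtoC_mult.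
  pose proof (pos_INR n). field. split; apply RtoC_neq_0; solve [apply INR_fact_neq_0 | lra].
Qed.

Lemma cbin_R b n : cbin (RtoC b) n = RtoC (rbin b n).
Proof.
  induction n as [|n IH].
  - now rewrite cbin_0.
  - rewrite cbin_S, IH, <- RtoC_plus, <- RtoC_div by (pose proof (pos_INR n); lra).
    now rewrite <- RtoC_mult.
Qed.

Lemma ln_1_plus_bounds u : 0 < u <= 1 -> Rabs (u - ln (1 + u)) <= u ^ 2.
Proof.
  intros Hu. assert (H1 : ln (1 + u) <= u) by (pose proof (ln_le_pred (1 + u)); lra).
  assert (H2 : - ln (1 + u) <= / (1 + u) - 1).
  { rewrite <- ln_Rinv by lra. apply ln_le_pred, Rinv_0_lt_compat. lra. }
  assert (H3 : u - ln (1 + u) <= u ^ 2).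
  { assert (u + / (1 + u) - 1 <= u ^ 2); [|lra].
    replace (u + / (1 + u) - 1) with (u ^ 2 * / (1 + u)) by (field; lra).
    rewrite <- (Rmult_1_r (u ^ 2)) at 2. apply Rmult_le_compat_l; [apply pow2_ge_0|].
    rewrite <- Rinv_1. apply Rinv_le_contravar; lra. }
  rewrite Rabs_pos_eq; lra.
Qed.

(** The factors of [(g)_n / n!] are [1 + z / k] with [z = g - 1]. They satisfy
    [|1 + z / k| <= exp (Re z / k + |z|^2 / (2 k^2))], and
    [1 / k = ln ((k+1) / k) + O(1 / k^2)]; the errors are summable. *)
Lemma cbin_bound g : exists M, 0 < M /\
  forall n, Cmod (cbin g n) <= M * Rpower (INR n + 1) (Re g - 1).
Proof.
  set (z := (g - 1)%C). set (x := Re g - 1).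
  assert (Hx : Re z = x) by reflexivity.
  set (A := Rabs x + Cmod z ^ 2 / 2).
  assert (HA : 0 <= A).
  { unfold A. pose proof (Rabs_pos x). pose proof (pow2_ge_0 (Cmod z)). lra. }
  exists (exp (2 * A)). split; [pos|].
  assert (Hstep : forall n, Cmod ((g + RtoC (INR n)) / RtoC (INR n + 1))%C <=
     exp (A / (INR n + 1) ^ 2) * exp (x * (ln (INR n + 2) - ln (INR n + 1)))).
  { intros n. pose proof (pos_INR n) as Hn. set (k := INR n + 1).
    assert (Hk : 1 <= k) by (unfold k; lra).
    replace (INR n + 2) with (k + 1) by (unfold k; ring).
    set (u := / k). assert (Hu : 0 < u <= 1).
    { split; [pos|]. unfold u. rewrite <- Rinv_1. apply Rinv_le_contravar; lra. }
    replace ((g + RtoC (INR n)) / RtoC k)%C with (1 + z * RtoC u)%C.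
    2:{ unfold u, z, k. rewrite RtoC_inv, RtoC_plus by lra. field.
        intros h. apply (RtoC_neq_0 (INR n + 1)); [lra|]. rewrite RtoC_plus. exact h. }
    assert (Hm : Cmod (1 + z * RtoC u)%C <= exp (x * u + Cmod z ^ 2 / 2 * u ^ 2)).
    { apply Rsqr_incr_0_var; [|pos].
      rewrite 2!Rsqr_pow2. rewrite Cmod2_alt.
      replace (exp (x * u + Cmod z ^ 2 / 2 * u ^ 2) ^ 2) with
        (exp (2 * (x * u) + Cmod z ^ 2 * u ^ 2)).
      2:{ rewrite <- (Rsqr_pow2 (exp _)). unfold Rsqr. rewrite <- exp_plus. f_equal. field. }
      eapply Rle_trans; [|apply exp_ineq1_le]. rewrite Cmod2_alt, <- Hx.
      apply Req_le. unfold Re, Im; simpl; ring. }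
    eapply Rle_trans; [exact Hm|]. rewrite <- exp_plus.
    assert (Hle : x * u + Cmod z ^ 2 / 2 * u ^ 2 <= A / k ^ 2 + x * (ln (k + 1) - ln k)).
    { replace (A / k ^ 2) with (A * u ^ 2) by (unfold u; field; lra).
      replace (ln (k + 1) - ln k) with (ln (1 + u)).
      2:{ rewrite <- ln_div by lra. f_equal. unfold u. field. lra. }
      pose proof (ln_1_plus_bounds u Hu) as Hb.
      assert (x * (u - ln (1 + u)) <= Rabs x * u ^ 2).
      { eapply Rle_trans; [apply Rle_abs|]. rewrite Rabs_mult.
        apply Rmult_le_compat_l; [pos|auto]. }
      unfold A. lra. }
    apply exp_le. lra. }
  assert (Hinv : forall n, Cmod (cbin g n) <=
     exp (2 * A * (1 - / (INR n + 1))) * Rpower (INR n + 1) x).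
  { induction n as [|n IH].
    - rewrite cbin_0, Cmod_1. simpl. rewrite Rplus_0_l, Rinv_1.
      unfold Rpower. rewrite ln_1. replace (2 * A * (1 - 1)) with 0 by ring.
      rewrite Rmult_0_r, exp_0. lra.
    - rewrite cbin_S, Cmod_mult. rewrite S_INR.
      eapply Rle_trans; [apply Rmult_le_compat; [pos|pos|exact IH|apply Hstep]|].
      pose proof (pos_INR n) as Hn.
      replace (INR n + 1 + 1) with (INR n + 2) by ring.
      set (k := INR n + 1). replace (INR n + 2) with (k + 1) by (unfold k; ring).
      assert (Hk : 1 <= k) by (unfold k; lra).
      replace (Rpower (k + 1) x) with (Rpower k x * exp (x * (ln (k + 1) - ln k))).
      2:{ unfold Rpower. rewrite <- exp_plus. f_equal. ring. }
      replace (exp (2 * A * (1 - / k)) * Rpower k x * (exp (A / k ^ 2) * exp (x * (ln (k + 1) - ln k))))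
       with (exp (2 * A * (1 - / k) + A / k ^ 2) * (Rpower k x * exp (x * (ln (k + 1) - ln k))))
       by (rewrite exp_plus; ring).
      apply Rmult_le_compat_r; [pos|].
      assert (Hle : 2 * A * (1 - / k) + A / k ^ 2 <= 2 * A * (1 - / (k + 1))).
      { assert (/ k ^ 2 <= 2 * (/ k - / (k + 1))).
        { replace (2 * (/ k - / (k + 1))) with (/ (k ^ 2 * ((k + 1) / (2 * k)))) by (field; lra).
          apply Rinv_le_contravar.
          - pos.
          - rewrite <- (Rmult_1_r (k ^ 2)) at 2. apply Rmult_le_compat_l; [apply pow2_ge_0|].
            apply Rmult_le_reg_r with (2 * k); [lra|]. unfold Rdiv. rewrite Rmult_assoc, Rinv_l; lra. }
        assert (A * / k ^ 2 <= A * (2 * (/ k - / (k + 1)))) by (apply Rmult_le_compat_l; auto).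
        unfold Rdiv. lra. }
      apply exp_le. lra. }
  intros n. eapply Rle_trans; [apply Hinv|].
  apply Rmult_le_compat_r; [pos|].
  assert (Hle : 2 * A * (1 - / (INR n + 1)) <= 2 * A).
  { assert (0 < / (INR n + 1)) by pos.
    rewrite <- (Rmult_1_r (2 * A)) at 2. apply Rmult_le_compat_l; lra. }
  apply exp_le. lra.
Qed.

(** * Power series in a complex variable, along a ray *)

(** Half of the geometric decay absorbs the power of [n]. *)
Lemma pow_geom K q : 0 <= q < 1 -> exists M d, 0 < M /\ 0 <= d < 1 /\
  forall n, Rpower (INR n + 1) K * q ^ n <= M * d ^ n.
Proof.
  intros Hq. set (q1 := (1 + q) / 2). assert (Hq1 : 0 < q1 < 1) by (unfold q1; lra).
  set (d := - ln q1 / 2).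
  assert (Hd : 0 < d).
  { assert (ln q1 < 0) by (rewrite <- ln_1; apply ln_increasing; lra). unfold d. lra. }
  destruct (Rpower_exp_bound (Rabs K) d) as (M & HM & KM); [pos|auto|].
  exists (M * exp d), (exp (- d)). split; [pos|].
  split. { split; [pos|]. rewrite <- exp_0. apply exp_increasing. lra. }
  intros n. pose proof (pos_INR n) as Hn.
  apply Rle_trans with (Rpower (INR n + 1) (Rabs K) * q1 ^ n).
  { apply Rmult_le_compat.
    - pos. - pos.
    - apply Rle_Rpower; [lra|apply Rle_abs]. - apply pow_incr. unfold q1. lra. }
  replace (q1 ^ n) with (exp (- (d * (INR n + 1))) * (exp d * exp (- d) ^ n)).
  2:{ rewrite exp_pow, <- 2!exp_plus. rewrite <- Rpower_pow by lra. unfold Rpower. f_equal. unfold d. field. }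
  rewrite <- Rmult_assoc, (Rmult_assoc M).
  apply Rmult_le_compat_r; [|apply KM; lra].
  pos.
Qed.

Lemma ex_series_pow_geom K q : 0 <= q < 1 -> ex_series (fun n => Rpower (INR n + 1) K * q ^ n).
Proof.
  intros Hq. destruct (pow_geom K q Hq) as (M & d & HM & Hd & H).
  apply (ex_series_Rle _ (fun n => M * d ^ n)).
  - intros n. rewrite Rabs_pos_eq; auto.
    pos.
  - apply: ex_series_scal. apply ex_series_geom. rewrite Rabs_pos_eq; lra.
Qed.

Lemma CV_radius_ge (a : nat -> R) rho M : (forall n, Rabs (a n * rho ^ n) <= M) ->
  Rbar_le rho (CV_radius a).
Proof. intros H. apply (proj1 (CV_radius_bounded a)). now exists M. Qed.

Lemma PSeries_facts (a : nat -> R) rho M r : (forall n, Rabs (a n * rho ^ n) <= M) -> Rabs r < rho ->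
  is_derive (fun r => Series (fun n => a n * r ^ n)) r (Series (fun n => INR (S n) * a (S n) * r ^ n)) /\
  ex_series (fun n => a n * r ^ n) /\ ex_series (fun n => INR (S n) * a (S n) * r ^ n).
Proof.
  intros HM Hr.
  assert (Hcv : Rbar_lt (Rabs r) (CV_radius a)).
  { eapply Rbar_lt_le_trans; [|apply (CV_radius_ge a rho M HM)]. exact Hr. }
  split; [|split].
  - apply (is_derive_PSeries a r Hcv).
  - exact (proj1 (ex_pseries_R a r) (CV_radius_inside a r Hcv)).
  - exact (proj1 (ex_pseries_R (PS_derive a) r) (ex_pseries_derive a r Hcv)).
Qed.

Lemma Cpseries_facts (a : nat -> C) rho M r : 0 <= rho ->
  (forall n, Cmod (a n) * rho ^ n <= M) -> Rabs r < rho ->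
  Cderiv (fun r => CSeries (fun n => (a n * RtoC (r ^ n))%C)) r
    (CSeries (fun n => (RtoC (INR (S n)) * a (S n) * RtoC (r ^ n))%C)) /\
  is_Cseries (fun n => (a n * RtoC (r ^ n))%C) (CSeries (fun n => (a n * RtoC (r ^ n))%C)) /\
  is_Cseries (fun n => (RtoC (INR (S n)) * a (S n) * RtoC (r ^ n))%C)
    (CSeries (fun n => (RtoC (INR (S n)) * a (S n) * RtoC (r ^ n))%C)).
Proof.
  intros Hrho HM Hr.
  destruct (PSeries_facts (fun n => Re (a n)) rho M r) as (D1 & E1 & F1); auto.
  { intros n. rewrite Rabs_mult, (Rabs_pos_eq (rho ^ n)) by pos.
    eapply Rle_trans; [|apply HM]. apply Rmult_le_compat_r; [pos|apply re_le_Cmod]. }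
  destruct (PSeries_facts (fun n => Im (a n)) rho M r) as (D2 & E2 & F2); auto.
  { intros n. rewrite Rabs_mult, (Rabs_pos_eq (rho ^ n)) by pos.
    eapply Rle_trans; [|apply HM]. apply Rmult_le_compat_r; [pos|apply im_le_Cmod]. }
  assert (R1 : forall x n, Re (a n) * x ^ n = Re (a n * RtoC (x ^ n))%C) by (intros; cring).
  assert (R2 : forall x n, Im (a n) * x ^ n = Im (a n * RtoC (x ^ n))%C) by (intros; cring).
  assert (R3 : forall n, INR (S n) * Re (a (S n)) * r ^ n = Re (RtoC (INR (S n)) * a (S n) * RtoC (r ^ n))%C).
  { intros n. generalize (INR (S n)). intros y. cring. }
  assert (R4 : forall n, INR (S n) * Im (a (S n)) * r ^ n = Im (RtoC (INR (S n)) * a (S n) * RtoC (r ^ n))%C).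
  { intros n. generalize (INR (S n)). intros y. cring. }
  split; [|split].
  - split.
    + apply (is_derive_ext (fun x => Series (fun n => Re (a n) * x ^ n))).
      { intros x. apply Series_ext. intros n. apply R1. }
      eapply is_derive_val; [exact D1|]. apply Series_ext. exact R3.
    + apply (is_derive_ext (fun x => Series (fun n => Im (a n) * x ^ n))).
      { intros x. apply Series_ext. intros n. apply R2. }
      eapply is_derive_val; [exact D2|]. apply Series_ext. exact R4.
  - split; apply Series_correct.
    + apply (ex_series_ext (fun n => Re (a n) * r ^ n)); auto.
    + apply (ex_series_ext (fun n => Im (a n) * r ^ n)); auto.
  - split; apply Series_correct.
    + apply (ex_series_ext (fun n => INR (S n) * Re (a (S n)) * r ^ n)); auto.
    + apply (ex_series_ext (fun n => INR (S n) * Im (a (S n)) * r ^ n)); auto.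
Qed.

Lemma is_Cseries_det u l1 l2 : is_Cseries u l1 -> is_Cseries u l2 -> l1 = l2.
Proof.
  intros H K. rewrite <- (is_Cseries_unique _ _ H). now apply is_Cseries_unique.
Qed.

Lemma CSeries_pow0 (a : nat -> C) : CSeries (fun n => (a n * RtoC (0 ^ n))%C) = a O.
Proof.
  assert (H : forall (b : nat -> R), Series (fun n => b n * 0 ^ n) = b O).
  { intros b. apply PSeries_0. }
  apply C_ext; simpl.
  - etransitivity; [|apply (H (fun n => Re (a n)))]. apply Series_ext. intros n. cring.
  - etransitivity; [|apply (H (fun n => Im (a n)))]. apply Series_ext. intros n. cring.
Qed.

Lemma is_series_exp z : is_series (fun n => z ^ n / INR (fact n)) (exp z).
Proof.
  apply (is_series_ext (fun k => / INR (fact k) * z ^ k)).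
  { intros k. change (/ INR (fact k) * z ^ k = z ^ k / INR (fact k)). unfold Rdiv. ring. }
  exact (proj1 (is_pseries_R (fun k => / INR (fact k)) z (exp z)) (is_exp_Reals z)).
Qed.

Lemma pow_fact_le_exp x n : 0 <= x -> x ^ n / INR (fact n) <= exp x.
Proof.
  intros Hx. rewrite <- (is_series_unique _ _ (is_series_exp x)).
  apply (term_le_Series (fun n => x ^ n / INR (fact n))); [intros k; pos|].
  eexists. apply is_series_exp.
Qed.

(** Both the exponential and the binomial series are identified by the linear differential
    equation that they satisfy along a ray from the origin. *)
Lemma is_Cseries_exp z : is_Cseries (fun n => (z ^ n / RtoC (INR (fact n)))%C) (Cexp z).
Proof.
  set (a := fun n => (z ^ n / RtoC (INR (fact n)))%C).
  assert (HF : forall n, RtoC (INR (fact n)) <> 0) by (intros n; apply RtoC_neq_0, INR_fact_neq_0).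
  assert (HM : forall n, Cmod (a n) * 2 ^ n <= exp (2 * Cmod z)).
  { intros n. unfold a. rewrite Cmod_div, Cmod_pow, Cmod_R by apply HF.
    rewrite Rabs_pos_eq by pos.
    replace (Cmod z ^ n / INR (fact n) * 2 ^ n) with ((2 * Cmod z) ^ n / INR (fact n)).
    - apply pow_fact_le_exp. pose proof (Cmod_ge_0 z). lra.
    - rewrite Rpow_mult_distr. unfold Rdiv. ring. }
  set (F := fun r => CSeries (fun n => (a n * RtoC (r ^ n))%C)).
  assert (HD : forall r, 0 <= r <= 1 -> Cderiv F r (z * F r)%C).
  { intros r Hr. destruct (Cpseries_facts a 2 _ r ltac:(lra) HM) as (D & E & G).
    { rewrite Rabs_pos_eq; lra. }
    eapply Cderiv_val; [exact D|]. apply (is_Cseries_det _ _ _ G).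
    apply (is_Cseries_ext (fun n => (z * (a n * RtoC (r ^ n)))%C)).
    - intros n. unfold a. rewrite fact_simpl, mult_INR, RtoC_mult. simpl Cpow. field.
      split; [apply HF|]. apply RtoC_neq_0. apply not_0_INR. lia.
    - now apply is_Cseries_scal. }
  assert (Hc : (F 1 * Cexp (- (z * RtoC 1)))%C = (F 0 * Cexp (- (z * RtoC 0)))%C).
  { apply (Cderiv_zero_const (fun r => (F r * Cexp (- (z * RtoC r)))%C) 0 1); [lra|].
    intros r Hr. eapply Cderiv_val.
    - apply Cderiv_mult; [now apply HD|apply Cderiv_Cexp_lin].
    - cbv beta; match goal with |- ?a = ?b => change (@eq C a b) end; ring. }
  assert (H1 : is_Cseries a (F 1)).
  { destruct (Cpseries_facts a 2 _ 1 ltac:(lra) HM) as (_ & E & _); [rewrite Rabs_pos_eq; lra|].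
    eapply is_Cseries_ext; [|exact E]. intros n. simpl. rewrite pow1. ring. }
  replace (Cexp z) with (F 1); auto.
  unfold F at 2 in Hc. rewrite CSeries_pow0 in Hc.
  replace (a O) with (RtoC 1) in Hc by (unfold a; simpl; field).
  replace (- (z * RtoC 0))%C with (RtoC 0) in Hc by ring. rewrite Cexp_0 in Hc.
  replace (- (z * RtoC 1))%C with (- z)%C in Hc by ring.
  transitivity (F 1 * (Cexp (- z) * Cexp z))%C; [rewrite Cexp_opp; ring|].
  rewrite Cmult_assoc, Hc. ring.
Qed.

Lemma Clog_right z : 0 < Re z -> Clog z = (ln (Cmod z), atan (Im z / Re z)).
Proof.
  intros Hz. unfold Clog. f_equal. unfold Carg.
  set (y := Im z / Re z).
  assert (Hc : Re z / Cmod z = cos (atan y)).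
  { rewrite cos_atan. unfold y. unfold Cmod. fold (Re z) (Im z).
    replace (1 + (Im z / Re z)²) with ((Re z ^ 2 + Im z ^ 2) * (/ Re z)²).
    2:{ unfold Rsqr. field. lra. }
    rewrite sqrt_mult_alt by (pose proof (pow2_ge_0 (Re z)); pose proof (pow2_ge_0 (Im z)); lra).
    rewrite sqrt_Rsqr by pos.
    assert (0 < sqrt (Re z ^ 2 + Im z ^ 2)).
    { apply sqrt_lt_R0. pose proof (pow_lt (Re z) 2 Hz). pose proof (pow2_ge_0 (Im z)). lra. }
    field. lra. }
  rewrite Hc. pose proof (atan_bound y) as Hb. pose proof PI_RGT_0.
  destruct Rlt_dec as [h|h].
  - assert (y < 0).
    { apply Rmult_lt_reg_r with (Re z); auto. unfold y, Rdiv. rewrite Rmult_assoc, Rinv_l; lra. }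
    assert (atan y < 0) by (rewrite <- atan_0; now apply atan_increasing).
    rewrite <- cos_neg, acos_cos; lra.
  - assert (0 <= y).
    { unfold y. pos. }
    assert (0 <= atan y).
    { rewrite <- atan_0. destruct (Req_dec y 0) as [->|]; [lra|].
      apply Rlt_le, atan_increasing. lra. }
    apply acos_cos; lra.
Qed.

Lemma Re_lt_1 w : Cmod w < 1 -> 0 < Re (1 - w)%C.
Proof.
  intros Hw. change (0 < 1 + - Re w). pose proof (re_le_Cmod w). pose proof (Rle_abs (Re w)). lra.
Qed.

Lemma Cderiv_Clog w r : 0 < Re (1 - w * RtoC r)%C ->
  Cderiv (fun r => Clog (1 - w * RtoC r)%C) r (- w / (1 - w * RtoC r))%C.
Proof.
  intros Hr. destruct w as [u v].
  assert (HR : forall x, Re (1 - (u, v) * RtoC x)%C = 1 - u * x) by (intros; cring).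
  assert (HI : forall x, Im (1 - (u, v) * RtoC x)%C = - (v * x)) by (intros; cring).
  rewrite HR in Hr.
  assert (Hloc : locally r (fun x => 0 < 1 - u * x)).
  { assert (Hc : continuous (fun x => 1 - u * x) r).
    { apply: ex_derive_continuous. auto_derive; auto. }
    destruct (proj1 (filterlim_locally _ _) Hc (mkposreal _ Hr)) as [e He].
    exists e. intros y Hy. specialize (He y Hy). apply Rabs_def2 in He.
    unfold minus, plus, opp in He; simpl in He. lra. }
  assert (Hq : 0 < (1 - u * r) ^ 2 + (v * r) ^ 2).
  { pose proof (pow_lt _ 2 Hr). pose proof (pow2_ge_0 (v * r)). lra. }
  assert (Hval : (- (u, v) / (1 - (u, v) * RtoC r))%C =
    ((- u * (1 - u * r) + v * (v * r)) / ((1 - u * r) ^ 2 + (v * r) ^ 2),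
     - v / ((1 - u * r) ^ 2 + (v * r) ^ 2))).
  { unfold Cdiv, Cinv, Cmult, Copp, Cminus, Cplus, RtoC; simpl.
    apply C_ext; simpl; field; simpl in Hq; intros h; match type of Hq with 0 < ?e =>
      assert (e = 0); [|lra] end; rewrite <- h; ring. }
  rewrite Hval. split.
  - apply (is_derive_ext_loc (fun x => / 2 * ln ((1 - u * x) ^ 2 + (v * x) ^ 2))).
    + revert Hloc; apply filter_imp. intros x Hx.
      change (/ 2 * ln ((1 - u * x) ^ 2 + (v * x) ^ 2) =
        ln (sqrt (Re (1 - (u, v) * RtoC x)%C ^ 2 + Im (1 - (u, v) * RtoC x)%C ^ 2))).
      rewrite HR, HI.
      assert (0 < (1 - u * x) ^ 2 + (- (v * x)) ^ 2).
      { pose proof (pow_lt _ 2 Hx). pose proof (pow2_ge_0 (- (v * x))). lra. }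
      rewrite <- Rpower_sqrt by auto. unfold Rpower. rewrite ln_exp.
      replace ((- (v * x)) ^ 2) with ((v * x) ^ 2) by ring. reflexivity.
    + apply (is_derive_val _ _ (/ 2 * (((- u) * (2 * (1 - u * r)) + v * (2 * (v * r)))
         / ((1 - u * r) ^ 2 + (v * r) ^ 2)))).
      * auto_derive; [simpl in Hq; lra|]. simpl in Hq. simpl. field. lra.
      * simpl in Hq |- *. field. lra.
  - apply (is_derive_ext_loc (fun x => atan (- (v * x) / (1 - u * x)))).
    + revert Hloc; apply filter_imp. intros x Hx.
      rewrite Clog_right by (rewrite HR; auto).
      change (atan (- (v * x) / (1 - u * x)) =
        atan (Im (1 - (u, v) * RtoC x)%C / Re (1 - (u, v) * RtoC x)%C)).
      now rewrite HR, HI.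
    + change (Im (((- u * (1 - u * r) + v * (v * r)) / ((1 - u * r) ^ 2 + (v * r) ^ 2),
        - v / ((1 - u * r) ^ 2 + (v * r) ^ 2)))) with (- v / ((1 - u * r) ^ 2 + (v * r) ^ 2)).
      auto_derive; [lra|]. unfold Rsqr. field.
      simpl in Hq; repeat split; lra.
Qed.

Lemma is_Cseries_binomial g w : Cmod w < 1 ->
  is_Cseries (fun n => (cbin g n * w ^ n)%C) (Cpower (1 - w)%C (- g)%C).
Proof.
  intros Hw. pose proof (Cmod_ge_0 w) as Hw0.
  set (a := fun n => (cbin g n * w ^ n)%C).
  set (rho := 2 / (1 + Cmod w)).
  assert (Hrho : 1 < rho).
  { unfold rho. apply Rmult_lt_reg_r with (1 + Cmod w); [lra|].
    unfold Rdiv. rewrite Rmult_assoc, Rinv_l; lra. }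
  assert (HM : exists M, forall n, Cmod (a n) * rho ^ n <= M).
  { destruct (cbin_bound g) as (M1 & HM1 & K1).
    destruct (pow_geom (Re g - 1) (Cmod w * rho)) as (M2 & d & HM2 & Hd & K2).
    { split; [pos|]. unfold rho.
      apply Rmult_lt_reg_r with (1 + Cmod w); [lra|].
      replace (Cmod w * (2 / (1 + Cmod w)) * (1 + Cmod w)) with (2 * Cmod w) by (field; lra). lra. }
    exists (M1 * M2). intros n. unfold a. rewrite Cmod_mult, Cmod_pow.
    rewrite Rmult_assoc, <- Rpow_mult_distr.
    apply Rle_trans with (M1 * (Rpower (INR n + 1) (Re g - 1) * (Cmod w * rho) ^ n)).
    - rewrite <- Rmult_assoc. apply Rmult_le_compat_r; [|apply K1].
      pos.
    - apply Rmult_le_compat_l; [lra|]. eapply Rle_trans; [apply K2|].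
      rewrite <- (Rmult_1_r M2) at 2. apply Rmult_le_compat_l; [lra|].
      rewrite <- (pow1 n). apply pow_incr. lra. }
  destruct HM as [M HM].
  set (F := fun r => CSeries (fun n => (a n * RtoC (r ^ n))%C)).
  assert (Hre : forall r, 0 <= r <= 1 -> 0 < Re (1 - w * RtoC r)%C).
  { intros r Hr. apply Re_lt_1. rewrite Cmod_mult, Cmod_R, Rabs_pos_eq by lra.
    apply Rle_lt_trans with (Cmod w * 1); [|lra]. apply Rmult_le_compat_l; lra. }
  assert (HD : forall r, 0 <= r <= 1 -> exists G, Cderiv F r G /\
     ((1 - w * RtoC r) * G = g * w * F r)%C).
  { intros r Hr. destruct (Cpseries_facts a rho M r ltac:(lra) HM) as (D & E & G).
    { rewrite Rabs_pos_eq; lra. }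
    fold (F r) in E. set (G' := CSeries _) in G, D. exists G'. split; auto.
    assert (Hs : is_Cseries (fun n => (RtoC (INR n) * a n * RtoC (r ^ n))%C) (RtoC r * G')%C).
    { replace (RtoC r * G')%C with (RtoC (INR 0) * a O * RtoC (r ^ 0) + RtoC r * G')%C by (simpl; ring).
      apply (is_Cseries_shift (fun n => (RtoC (INR n) * a n * RtoC (r ^ n))%C)).
      eapply is_Cseries_ext; [|apply (is_Cseries_scal (RtoC r) _ _ G)].
      intros n. cbv beta. simpl pow. rewrite RtoC_mult. ring. }
    assert (HG : G' = (g * w * F r + w * (RtoC r * G'))%C).
    { apply (is_Cseries_det _ _ _ G).
      eapply is_Cseries_ext; [|apply (is_Cseries_plus _ _ _ _ (is_Cseries_scal (g * w) _ _ E)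
        (is_Cseries_scal w _ _ Hs))].
      intros n. cbv beta. unfold a. rewrite cbin_S, S_INR. simpl Cpow.
      field. apply RtoC_neq_0. pose proof (pos_INR n); lra. }
    rewrite <- Cplus_0_r with (x := (g * w * F r)%C).
    replace ((1 - w * RtoC r) * G')%C with (G' - w * (RtoC r * G'))%C by ring.
    rewrite HG at 1. ring. }
  assert (Hc : (F 1 * Cexp (g * Clog (1 - w * RtoC 1)))%C = (F 0 * Cexp (g * Clog (1 - w * RtoC 0)))%C).
  { apply (Cderiv_zero_const (fun r => (F r * Cexp (g * Clog (1 - w * RtoC r)))%C) 0 1); [lra|].
    intros r Hr. destruct (HD r Hr) as (G & DG & EG).
    assert (Hne : (1 - w * RtoC r)%C <> 0).
    { intros h. pose proof (Hre r Hr) as hh. rewrite h in hh. simpl in hh. lra. }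
    eapply Cderiv_val.
    - apply Cderiv_mult; [exact DG|]. apply (Cderiv_Cexp (fun r => (g * Clog (1 - w * RtoC r))%C)).
      apply (Cderiv_mult (fun _ => g) (fun r => Clog (1 - w * RtoC r)%C)); [apply Cderiv_const|].
      apply Cderiv_Clog. now apply Hre.
    - replace G with (g * w * F r / (1 - w * RtoC r))%C by (rewrite <- EG; field; auto).
      field. auto. }
  assert (H1 : is_Cseries a (F 1)).
  { destruct (Cpseries_facts a rho M 1 ltac:(lra) HM) as (_ & E & _); [rewrite Rabs_pos_eq; lra|].
    eapply is_Cseries_ext; [|exact E]. intros n. simpl. rewrite pow1. ring. }
  replace (Cpower (1 - w)%C (- g)%C) with (F 1); auto.
  unfold F at 2 in Hc. rewrite CSeries_pow0 in Hc.
  replace (a O) with (RtoC 1) in Hc by (unfold a; rewrite cbin_0; simpl; ring).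
  replace (1 - w * RtoC 0)%C with (RtoC 1) in Hc by ring.
  replace (1 - w * RtoC 1)%C with (1 - w)%C in Hc by ring.
  replace (Clog (RtoC 1)) with (RtoC 0) in Hc.
  2:{ rewrite Clog_right by (simpl; lra). rewrite Cmod_1, ln_1. simpl.
      replace (0 / 1) with 0 by field. now rewrite atan_0. }
  replace (g * RtoC 0)%C with (RtoC 0) in Hc by ring. rewrite Cexp_0 in Hc.
  unfold Cpower. replace (- g * Clog (1 - w))%C with (- (g * Clog (1 - w)))%C by ring.
  set (E := (g * Clog (1 - w))%C) in *.
  transitivity (F 1 * Cexp E * Cexp (- E))%C.
  - rewrite <- Cmult_assoc, (Cmult_comm (Cexp E)), Cexp_opp. ring.
  - rewrite Hc. ring.
Qed.

(** * Gamma integrals with a complex scale *)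

Lemma gamma_scaled_R s c : 0 < Re s -> 0 < c ->
  Cimproper D0oo (gamma_kernel s (RtoC c)) (rpow c (- s) * CGamma s)%C.
Proof.
  intros Hs Hc. assert (HD := interval_D0oo).
  assert (H : Cimproper D0oo (fun t => (RtoC c * gamma_kernel s 1 (c * t))%C) (CGamma s)).
  { apply (Cimproper_subst D0oo D0oo (gamma_kernel s 1) (fun t => c * t) (fun _ => c)); auto.
    - apply Ccont_gamma_kernel.
    - intros x Hx. split; [pos|]. split; [|apply continuous_const].
      auto_derive; auto; ring.
    - intros d Hd. exists (d / c). split; [pos|]. intros x _ h.
      apply Rmult_le_compat_l with (r := c) in h; [|lra].
      replace (c * (d / c)) with d in h by (field; lra). exact h.
    - intros d Hd. exists (d / c). split; [pos|]. intros x _ h.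
      apply Rmult_le_compat_l with (r := c) in h; [|lra].
      replace (c * (d / c)) with d in h by (field; lra). exact h.
    - now apply CGamma_spec. }
  apply (Cimproper_scal _ _ (rpow c (- s))) in H; auto.
  - refine (Cimproper_ext _ _ _ _ HD _ H). intros t Ht. cbv beta.
    unfold gamma_kernel. rewrite rpow_mult, RtoC_mult by auto.
    replace (RtoC c * (rpow c (s - 1) * rpow t (s - 1) * Cexp (- (1 * (RtoC c * RtoC t)))))%C
      with ((RtoC c * rpow c (s - 1)) * (rpow t (s - 1) * Cexp (- (1 * (RtoC c * RtoC t)))))%C by ring.
    rewrite <- rpow_pred, Cmult_assoc, rpow_opp by auto. rewrite !Cmult_1_l. reflexivity.
  - intros t Ht. apply Ccont_mult; [apply Ccont_const|].
    apply (Ccont_on_ext D0oo (fun t => (rpow c (s - 1) * gamma_kernel s (RtoC c) t)%C)); auto.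
    + apply open_D0oo.
    + intros x Hx. unfold gamma_kernel. rewrite rpow_mult, RtoC_mult by auto.
      rewrite Cmult_1_l. ring.
    + intros x Hx. apply Ccont_mult; [apply Ccont_const|now apply Ccont_gamma_kernel].
Qed.

Lemma RGamma_scaled x c : 0 < x -> 0 < c ->
  improper D0oo (fun t => Rpower t (x - 1) * exp (- (c * t))) (Rpower c (- x) * RGamma x).
Proof.
  intros Hx Hc. destruct (gamma_scaled_R (RtoC x) c Hx Hc) as [H _].
  rewrite <- RtoC_opp, rpow_R, CGamma_R, <- RtoC_mult in H by auto.
  refine (improper_ext _ _ _ _ interval_D0oo _ H).
  intros t Ht. unfold gamma_kernel.
  rewrite <- RtoC_minus, rpow_R, <- RtoC_mult, <- RtoC_opp, Cexp_RtoC, <- RtoC_mult. reflexivity.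
Qed.

Lemma Rpower_segment a b t y : 0 < a -> a <= t <= b -> Rpower t y <= Rpower a y + Rpower b y.
Proof.
  intros Ha Ht. pose proof (Rpower_pos a y). pose proof (Rpower_pos b y).
  assert (Hl : ln a <= ln t <= ln b) by (split; apply ln_le; lra).
  destruct (Rle_dec 0 y) as [h|h].
  - assert (Rpower t y <= Rpower b y); [|lra]. apply exp_le. apply Rmult_le_compat_l; lra.
  - assert (Rpower t y <= Rpower a y); [|lra]. apply exp_le. apply Rmult_le_compat_neg_l; lra.
Qed.

Lemma rbin_nonneg b n : 0 <= b -> 0 <= rbin b n.
Proof.
  intros Hb. induction n as [|n IH]; simpl; [lra|]. pose proof (pos_INR n).
  pos.
Qed.

Lemma ex_series_cbin g q : 0 <= q < 1 -> ex_series (fun n => Cmod (cbin g n) * q ^ n).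
Proof.
  intros Hq. destruct (cbin_bound g) as (M & HM & H).
  apply (ex_series_Rle _ (fun n => M * (Rpower (INR n + 1) (Re g - 1) * q ^ n))).
  - intros n. rewrite Rabs_mult, (Rabs_pos_eq (Cmod _)), Rabs_pos_eq;
      [|pos|pos].
    rewrite <- Rmult_assoc. apply Rmult_le_compat_r; [pos|auto].
  - apply: ex_series_scal. now apply ex_series_pow_geom.
Qed.

(** Principal powers are multiplicative when one factor is positive, since the argument is
    unchanged. *)
Lemma Cpower_scale (c : R) (z s : C) : 0 < c -> z <> 0 -> Cpower (RtoC c * z)%C s = (rpow c s * Cpower z s)%C.
Proof.
  intros Hc Hz. assert (HC : 0 < Cmod z) by now apply Cmod_gt_0.
  unfold Cpower, rpow. rewrite <- Cexp_plus. f_equal.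
  replace (Clog (RtoC c * z)%C) with (RtoC (ln c) + Clog z)%C; [ring|].
  assert (HR : Re (RtoC c * z)%C = c * Re z) by cring.
  assert (HI : Im (RtoC c * z)%C = c * Im z) by cring.
  assert (HM : Cmod (RtoC c * z)%C = c * Cmod z).
  { rewrite Cmod_mult, Cmod_R, Rabs_pos_eq by lra. reflexivity. }
  unfold Clog. rewrite HM, ln_mult by auto.
  unfold Carg. rewrite HM, HR, HI.
  replace (c * Re z / (c * Cmod z)) with (Re z / Cmod z) by (field; lra).
  destruct (Rlt_dec (Im z) 0) as [h|h]; destruct (Rlt_dec (c * Im z) 0) as [h'|h'].
  - apply C_ext; cring.
  - exfalso. apply h'. assert (0 < c * - Im z) by pos. lra.
  - exfalso. apply h. apply Rmult_lt_reg_l with c; lra.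
  - apply C_ext; cring.
Qed.

(** Expand [e^(-xi t)] around a real point so large that its disc of convergence, which reaches
    the imaginary axis, contains [xi]; the resulting series is a binomial series. *)
Lemma gamma_scaled s xi : 0 < Re s -> 0 < Re xi ->
  Cimproper D0oo (gamma_kernel s xi) (CGamma s * Cpower xi (- s))%C.
Proof.
  intros Hs Hxi. assert (HD := interval_D0oo).
  set (c := Cmod xi ^ 2 / Re xi).
  assert (Hxi2 : 0 < Cmod xi ^ 2).
  { apply pow_lt. pose proof (re_le_Cmod xi). pose proof (Rle_abs (Re xi)). lra. }
  assert (Hc : 0 < c) by pos.
  set (w := (RtoC c - xi)%C). set (d := Cmod w). assert (Hd0 : 0 <= d) by pos.
  assert (Hd : d < c).
  { apply Rsqr_incrst_0; [|auto|lra]. rewrite 2!Rsqr_pow2. unfold d. rewrite Cmod2_alt.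
    replace (Re w) with (c - Re xi) by (unfold w; cring).
    replace (Im w) with (- Im xi) by (unfold w; cring).
    assert (c * Re xi = Re xi ^ 2 + Im xi ^ 2).
    { rewrite <- Cmod2_alt. unfold c. field. lra. }
    nra. }
  set (f := fun n t => (w ^ n / RtoC (INR (fact n)) * gamma_kernel (s + RtoC (INR n)) (RtoC c) t)%C).
  set (g := fun n t => d ^ n / INR (fact n) * (Rpower t (Re s + INR n - 1) * exp (- (c * t)))).
  set (B := fun n => d ^ n / INR (fact n) * (Rpower c (- (Re s + INR n)) * RGamma (Re s + INR n))).
  set (l := fun n => (w ^ n / RtoC (INR (fact n)) *
      (rpow c (- (s + RtoC (INR n))) * CGamma (s + RtoC (INR n))))%C).
  assert (HF : forall n, RtoC (INR (fact n)) <> 0) by (intros n; apply RtoC_neq_0, INR_fact_neq_0).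
  assert (HsN : forall n, 0 < Re (s + RtoC (INR n))%C).
  { intros n. change (0 < Re s + INR n). pose proof (pos_INR n). lra. }
  assert (Hcoef : forall n, Cmod (w ^ n / RtoC (INR (fact n)))%C = d ^ n / INR (fact n)).
  { intros n. rewrite Cmod_div, Cmod_pow, Cmod_R by auto.
    rewrite Rabs_pos_eq by pos. reflexivity. }
  assert (Hcoef0 : forall n, 0 <= d ^ n / INR (fact n)).
  { intros n. rewrite <- Hcoef. pos. }
  assert (Hfg : forall n t, Cmod (f n t) <= g n t).
  { intros n t. unfold f, g. rewrite Cmod_mult, Hcoef, Cmod_gamma_kernel. apply Rle_refl. }
  assert (Hsum : forall t, 0 < t -> CSeries (fun n => f n t) = gamma_kernel s xi t).
  { intros t Ht. apply is_Cseries_unique.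
    apply (is_Cseries_ext (fun n => (gamma_kernel s (RtoC c) t *
        ((w * RtoC t) ^ n / RtoC (INR (fact n))))%C)).
    - intros n. unfold f, gamma_kernel.
      replace (s + RtoC (INR n) - 1)%C with ((s - 1) + RtoC (INR n))%C by ring.
      rewrite rpow_plus, rpow_nat, RtoC_pow, Cpow_mult_l by auto. field. auto.
    - replace (gamma_kernel s xi t) with (gamma_kernel s (RtoC c) t * Cexp (w * RtoC t))%C.
      + apply is_Cseries_scal, is_Cseries_exp.
      + unfold gamma_kernel. rewrite <- Cmult_assoc, <- Cexp_plus. do 2 f_equal. unfold w. ring. }
  destruct (Cimproper_series D0oo f g B l) as (A1 & A2 & _ & _); auto.
  - intros n t Ht. apply Ccont_mult; [apply Ccont_const|now apply Ccont_gamma_kernel].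
  - intros n. apply locint_scal, locint_gamma.
  - intros a b Ha Hb Hab. unfold D0oo in Ha, Hb.
    exists (fun n => (Rpower a (Re s - 1) + Rpower b (Re s - 1)) * ((d * b) ^ n / INR (fact n))).
    split; [apply: ex_series_scal; eexists; apply is_series_exp|].
    intros n t Ht. eapply Rle_trans; [apply Hfg|]. unfold g.
    replace (Re s + INR n - 1) with ((Re s - 1) + INR n) by ring.
    rewrite Rpower_plus, Rpower_pow by lra.
    replace ((Rpower a (Re s - 1) + Rpower b (Re s - 1)) * ((d * b) ^ n / INR (fact n)))
      with (d ^ n / INR (fact n) * ((Rpower a (Re s - 1) + Rpower b (Re s - 1)) * b ^ n * 1)).
    2:{ rewrite Rpow_mult_distr. field. apply INR_fact_neq_0. }
    apply Rmult_le_compat_l; auto.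
    apply Rmult_le_compat.
    + pos.
    + pos.
    + apply Rmult_le_compat; [pos|pos| |apply pow_incr; lra].
      apply Rpower_segment; lra.
    + apply exp_le_1.
      assert (0 < c * t) by pos. lra.
  - intros n. apply ibound_scal; auto; [apply locint_gamma|].
    apply improper_ge; auto; [apply locint_gamma| |].
    + intros t _. pos.
    + apply RGamma_scaled; auto. apply (HsN n).
  - apply (ex_series_ext (fun n => (Rpower c (- Re s) * RGamma (Re s)) *
      (Cmod (cbin (RtoC (Re s)) n) * (d / c) ^ n))).
    + intros n. unfold B. rewrite RGamma_poch, cbin_R, Cmod_R by auto.
      rewrite Rabs_pos_eq by (apply rbin_nonneg; lra).
      rewrite Ropp_plus_distr, Rpower_plus, (Rpower_Ropp c (INR n)), Rpower_pow by auto.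
      unfold Rdiv. rewrite Rpow_mult_distr, pow_inv. match goal with |- ?a = ?b => change (@eq R a b) end. field.
      split; solve [apply INR_fact_neq_0 | apply pow_nonzero; lra].
    + apply: ex_series_scal. apply ex_series_cbin.
      split; [pos|].
      apply Rdiv_lt_1; lra.
  - intros n. unfold f, l. apply Cimproper_scal; auto; [apply Ccont_gamma_kernel|].
    apply gamma_scaled_R; auto.
  - apply (Cimproper_ext _ _ (gamma_kernel s xi)) in A2; auto.
    replace (CGamma s * Cpower xi (- s))%C with (CSeries l); auto.
    apply is_Cseries_unique.
    assert (Hw1 : Cmod (w / RtoC c)%C < 1).
    { rewrite Cmod_div, Cmod_R, Rabs_pos_eq by (try apply RtoC_neq_0; lra). fold d.
      apply Rdiv_lt_1; lra. }
    assert (Hcne : RtoC c <> 0) by (apply RtoC_neq_0; lra).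
    replace (CGamma s * Cpower xi (- s))%C with
      ((CGamma s * rpow c (- s)) * Cpower (1 - w / RtoC c) (- s))%C.
    + eapply is_Cseries_ext; [|apply is_Cseries_scal, is_Cseries_binomial, Hw1].
      intros n. unfold l. cbv beta. rewrite CGamma_poch by auto.
      assert (Hq : ((w / RtoC c) ^ n = w ^ n * / RtoC c ^ n)%C).
      { unfold Cdiv. now rewrite Cpow_mult_l, Cpow_inv. }
      rewrite Hq.
      replace (- (s + RtoC (INR n)))%C with (- s + - RtoC (INR n))%C by ring.
      rewrite rpow_plus, <- RtoC_opp, (rpow_R c (- INR n)), Rpower_Ropp, Rpower_pow, RtoC_inv, RtoC_pow
        by (try apply pow_nonzero; lra).
      unfold cbin. field. split; auto. rewrite <- RtoC_pow. apply RtoC_neq_0, pow_nonzero. lra.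
    + replace (1 - w / RtoC c)%C with (RtoC (/ c) * xi)%C.
      2:{ unfold w. rewrite RtoC_inv by lra. field. auto. }
      assert (Hxi0 : xi <> 0).
      { intros h. rewrite h in Hxi. simpl in Hxi. lra. }
      rewrite Cpower_scale, rpow_inv by (auto using Rinv_0_lt_compat).
      replace (- - s)%C with s by ring.
      replace (CGamma s * rpow c (- s) * (rpow c s * Cpower xi (- s)))%C
        with (CGamma s * (rpow c (- s) * rpow c s) * Cpower xi (- s))%C by ring.
      rewrite rpow_opp. ring.
Qed.

(** * The Mittag-Leffler function on the real line *)

Definition ml (lambda s : R) : R := Series (fun n => s ^ n / RGamma (lambda * INR n + 1)).

Lemma RGamma_ml_pos lambda n : 0 < lambda -> 0 < RGamma (lambda * INR n + 1).
Proof. intros H. apply RGamma_pos. pos. Qed.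

Lemma ml_summable lambda q : 0 < lambda -> 0 <= q ->
  ex_series (fun n => q ^ n / RGamma (lambda * INR n + 1)).
Proof.
  intros Hl Hq. set (A := Rpower (2 * q + 1) (/ lambda)).
  assert (HA : 0 < A) by pos.
  assert (HAl : forall n, Rpower A (lambda * INR n) = (2 * q + 1) ^ n).
  { intros n. rewrite <- Rpower_mult. replace (Rpower A lambda) with (2 * q + 1).
    - apply Rpower_pow. lra.
    - unfold A. rewrite Rpower_mult, Rinv_l, Rpower_1; lra. }
  apply (ex_series_Rle _ (fun n => exp (A + 1) * (q / (2 * q + 1)) ^ n)).
  - intros n. pose proof (RGamma_ml_pos lambda n Hl) as HG.
    rewrite Rabs_pos_eq.
    2:{ pos. }
    pose proof (RGamma_ge (lambda * INR n) A) as H. rewrite HAl in H.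
    assert (Hp : 0 < (2 * q + 1) ^ n) by pos.
    assert (Hx : 0 <= lambda * INR n) by pos.
    specialize (H Hx HA). rewrite exp_Ropp in H. pose proof (exp_pos (A + 1)) as He.
    unfold Rdiv at 2. rewrite Rpow_mult_distr, pow_inv.
    replace (exp (A + 1) * (q ^ n * / (2 * q + 1) ^ n)) with
      (q ^ n * / ((2 * q + 1) ^ n * / exp (A + 1))) by (field; lra).
    apply Rmult_le_compat_l; [pos|]. apply Rinv_le_contravar; auto.
    pos.
  - apply: ex_series_scal. apply ex_series_geom. rewrite Rabs_pos_eq.
    + apply Rdiv_lt_1; lra.
    + pos.
Qed.

Lemma mittag_leffler_R lambda s : 0 < lambda -> mittag_leffler lambda (RtoC s) = RtoC (ml lambda s).
Proof.
  intros Hl. unfold mittag_leffler.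
  assert (H : forall n, (RtoC s ^ n / CGamma (RtoC (lambda * INR n + 1)))%C =
     RtoC (s ^ n / RGamma (lambda * INR n + 1))).
  { intros n. assert (Hx : 0 <= lambda * INR n) by pos.
    rewrite CGamma_R by lra.
    rewrite RtoC_div, RtoC_pow; [reflexivity|]. apply Rgt_not_eq, RGamma_ml_pos, Hl. }
  now rewrite (CSeries_ext _ _ H), CSeries_R.
Qed.

Lemma continuous_ml lambda s : 0 < lambda -> continuous (ml lambda) s.
Proof.
  intros Hl. set (a := fun n => / RGamma (lambda * INR n + 1)). set (rho := Rabs s + 1).
  assert (Hrho : 0 <= rho) by (unfold rho; pose proof (Rabs_pos s); lra).
  assert (Hpos : forall k, 0 <= rho ^ k / RGamma (lambda * INR k + 1)).
  { intros k. apply Rmult_le_pos; [now apply pow_le|].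
    apply Rlt_le, Rinv_0_lt_compat, RGamma_ml_pos, Hl. }
  destruct (PSeries_facts a rho (Series (fun n => rho ^ n / RGamma (lambda * INR n + 1))) s)
    as (D & _ & _).
  - intros n. specialize (Hpos n) as Hn. unfold a.
    replace (/ RGamma (lambda * INR n + 1) * rho ^ n) with (rho ^ n / RGamma (lambda * INR n + 1))
      by (unfold Rdiv; ring).
    rewrite Rabs_pos_eq by auto.
    apply (term_le_Series (fun n => rho ^ n / RGamma (lambda * INR n + 1))); auto.
    now apply ml_summable.
  - unfold rho. lra.
  - apply: ex_derive_continuous. eexists. refine (is_derive_ext _ _ _ _ _ D).
    intros t. apply Series_ext. intros n. unfold a, Rdiv. ring.
Qed.

(** * Discrete relaxation *)

Lemma rbin_S a n : (INR n + 1) * rbin a (S n) = rbin a n * (a + INR n).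
Proof. simpl. field. pose proof (pos_INR n). lra. Qed.

(** Coefficients of [(1-q)^(-a) (1-q)^(-b) = (1-q)^(-(a+b))]. In the induction [n + 1] is split
    as [j + (n + 1 - j)], and each half is reduced to rank [n] by [rbin_S]. *)
Lemma rbin_vandermonde a b n :
  sum_f_R0 (fun j => rbin a j * rbin b (n - j)) n = rbin (a + b) n.
Proof.
  induction n as [|n IH]; [simpl; ring|].
  pose proof (pos_INR n) as Hn.
  apply Rmult_eq_reg_l with (INR n + 1); [|lra].
  rewrite rbin_S, <- IH, scal_sum.
  rewrite (sum_eq _ (fun j => INR j * rbin a j * rbin b (S n - j) +
     rbin a j * ((INR n + 1 - INR j) * rbin b (S n - j))) (S n)) by (intros; ring).
  rewrite sum_plus.
  rewrite (decomp_sum (fun j => INR j * rbin a j * rbin b (S n - j))) by lia. simpl pred.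
  rewrite (tech5 (fun j => rbin a j * ((INR n + 1 - INR j) * rbin b (S n - j)))).
  rewrite (sum_eq (fun i => INR (S i) * rbin a (S i) * rbin b (S n - S i))
     (fun i => (a + INR i) * (rbin a i * rbin b (n - i)))).
  2:{ intros i Hi. rewrite S_INR, rbin_S. replace (S n - S i)%nat with (n - i)%nat by lia. ring. }
  rewrite (sum_eq (fun j => rbin a j * ((INR n + 1 - INR j) * rbin b (S n - j)))
     (fun i => (b + INR n - INR i) * (rbin a i * rbin b (n - i)))).
  2:{ intros i Hi. replace (S n - i)%nat with (S (n - i)) by lia.
      replace (INR n + 1 - INR i) with (INR (n - i) + 1) by (rewrite minus_INR by lia; ring).
      rewrite rbin_S, minus_INR by lia. ring. }
  rewrite S_INR. replace (INR 0) with 0 by reflexivity.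
  match goal with |- 0 * ?x * ?y + ?s1 + (?s2 + ?u * ((?v) * ?w)) = _ =>
    replace (0 * x * y + s1 + (s2 + u * (v * w))) with (s1 + s2) by ring end.
  rewrite <- sum_plus. rewrite Rmult_comm, scal_sum. apply sum_eq. intros i Hi. ring.
Qed.

Lemma rbin_1 n : rbin 1 n = 1.
Proof.
  induction n as [|n IH]; [reflexivity|]. simpl. rewrite IH. field. pose proof (pos_INR n). lra.
Qed.

Lemma rbin_le_pow x n : 0 <= x -> rbin (x + 1) n <= (x + 1) ^ n.
Proof.
  intros Hx. induction n as [|n IH]; simpl; [lra|]. pose proof (pos_INR n) as Hn.
  rewrite (Rmult_comm (x + 1)). apply Rmult_le_compat; auto.
  - apply rbin_nonneg; lra.
  - pos.
  - apply Rmult_le_reg_r with (INR n + 1); [lra|]. unfold Rdiv. rewrite Rmult_assoc, Rinv_l by lra.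
    nra.
Qed.

Lemma ex_series_rbin alpha q n : 0 <= alpha -> 0 <= q < 1 ->
  ex_series (fun k => q ^ k * rbin (alpha * INR k + 1) n).
Proof.
  intros Ha Hq.
  apply (ex_series_Rle _ (fun k => (alpha + 1) ^ n * (Rpower (INR k + 1) (INR n) * q ^ k))).
  - intros k. pose proof (pos_INR k) as Hk.
    assert (Hak : 0 <= alpha * INR k) by pos.
    pose proof (rbin_nonneg (alpha * INR k + 1) n ltac:(lra)) as Hr.
    pose proof (pow_le q k (proj1 Hq)) as Hqk.
    rewrite Rabs_pos_eq by pos.
    rewrite Rpower_pow by lra. rewrite <- Rmult_assoc, <- Rpow_mult_distr, Rmult_comm.
    apply Rmult_le_compat_r; auto.
    eapply Rle_trans; [now apply rbin_le_pow|]. apply pow_incr. split; [lra|]. nra.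
  - apply: ex_series_scal. now apply ex_series_pow_geom.
Qed.

(** A time discretisation of the fractional relaxation equation of order [alpha], whose
    solution is a Mittag-Leffler function: the generating function of this sequence is
    [(1-q)^(alpha-1) / ((1-q)^alpha - omega)], with [1 - q] in the role of the Laplace
    variable. *)
Definition xs (alpha : R) (omega : C) (n : nat) : C :=
  CSeries (fun k => (omega ^ k * RtoC (rbin (alpha * INR k + 1) n))%C).

Lemma is_Cseries_xs alpha omega n : 0 <= alpha -> Cmod omega < 1 ->
  is_Cseries (fun k => (omega ^ k * RtoC (rbin (alpha * INR k + 1) n))%C) (xs alpha omega n).
Proof.
  intros Ha Ho. apply (Cseries_abs _ (fun k => Cmod omega ^ k * rbin (alpha * INR k + 1) n)).
  - intros k. rewrite Cmod_mult, Cmod_pow, Cmod_R, Rabs_pos_eq; [apply Rle_refl|].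
    apply rbin_nonneg. pose proof (Rmult_le_pos _ _ Ha (pos_INR k)). lra.
  - apply ex_series_rbin; auto. split; [pos|auto].
Qed.

Fixpoint csum (u : nat -> C) (n : nat) : C :=
  match n with O => u O | S m => (csum u m + u (S m))%C end.

Lemma csum_ext u v n : (forall j, (j <= n)%nat -> u j = v j) -> csum u n = csum v n.
Proof.
  induction n as [|n IH]; intros H; simpl; [apply H; lia|].
  rewrite IH, H; auto.
Qed.

Lemma csum_scal c u n : csum (fun j => (c * u j)%C) n = (c * csum u n)%C.
Proof. induction n as [|n IH]; simpl; [reflexivity|]. rewrite IH. ring. Qed.

Lemma csum_R (a : nat -> R) n : csum (fun j => RtoC (a j)) n = RtoC (sum_f_R0 a n).
Proof. induction n as [|n IH]; simpl; [reflexivity|]. now rewrite IH, RtoC_plus. Qed.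

Lemma csum_decomp u n : csum u (S n) = (u O + csum (fun j => u (S j)) n)%C.
Proof.
  induction n as [|n IH]; [reflexivity|].
  change (csum u (S (S n))) with (csum u (S n) + u (S (S n)))%C. rewrite IH. simpl. ring.
Qed.

Lemma Cmod_csum u n : Cmod (csum u n) <= sum_f_R0 (fun j => Cmod (u j)) n.
Proof.
  induction n as [|n IH]; simpl; [lra|]. eapply Rle_trans; [apply Cmod_triangle|]. lra.
Qed.

Lemma is_Cseries_csum (u : nat -> nat -> C) (l : nat -> C) n :
  (forall j, is_Cseries (u j) (l j)) -> is_Cseries (fun k => csum (fun j => u j k) n) (csum l n).
Proof.
  intros H. induction n as [|n IH]; simpl; [apply H|]. now apply is_Cseries_plus.
Qed.

(** Convolution with the coefficients of [(1-q)^alpha] lowers the parameter [alpha k + 1] by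
    [alpha], which shifts the series in [k] by one place. *)
Lemma xs_recurrence alpha omega n : 0 <= alpha -> Cmod omega < 1 ->
  csum (fun j => (RtoC (rbin (- alpha) j) * xs alpha omega (n - j))%C) n =
  (RtoC (rbin (1 - alpha) n) + omega * xs alpha omega n)%C.
Proof.
  intros Ha Ho.
  set (u := fun k => (omega ^ k * RtoC (rbin (alpha * INR k + 1 - alpha) n))%C).
  apply (is_Cseries_det u).
  - apply (is_Cseries_ext (fun k => csum (fun j => (RtoC (rbin (- alpha) j) *
      (omega ^ k * RtoC (rbin (alpha * INR k + 1) (n - j))))%C) n)).
    + intros k. unfold u.
      replace (alpha * INR k + 1 - alpha) with (- alpha + (alpha * INR k + 1)) by ring.
      rewrite <- rbin_vandermonde, <- csum_R, <- csum_scal. apply csum_ext. intros j _.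
      rewrite RtoC_mult. ring.
    + apply (is_Cseries_csum (fun j k => (RtoC (rbin (- alpha) j) *
       (omega ^ k * RtoC (rbin (alpha * INR k + 1) (n - j))))%C)).
      intros j. apply is_Cseries_scal. now apply is_Cseries_xs.
  - replace (RtoC (rbin (1 - alpha) n)) with (u O).
    2:{ unfold u. simpl. rewrite Cmult_1_l. do 2 f_equal. ring. }
    apply is_Cseries_shift.
    eapply is_Cseries_ext; [|apply is_Cseries_scal, is_Cseries_xs; eassumption].
    intros k. unfold u. cbv beta. rewrite S_INR.
    replace (alpha * (INR k + 1) + 1 - alpha) with (alpha * INR k + 1) by ring.
    simpl Cpow. ring.
Qed.

Lemma rbin_opp_nonpos alpha j : 0 < alpha <= 1 -> rbin (- alpha) (S j) <= 0.
Proof.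
  intros Ha. induction j as [|j IH].
  - simpl. lra.
  - assert (Hs := rbin_S (- alpha) (S j)). pose proof (pos_INR j) as Hj. rewrite S_INR in Hs.
    apply Rmult_le_reg_l with (INR j + 1 + 1); [lra|]. rewrite Hs, Rmult_0_r.
    assert (0 <= (- rbin (- alpha) (S j)) * (- alpha + (INR j + 1))).
    { pos. }
    lra.
Qed.

(** For [0 < alpha <= 1] the coefficients of [(1-q)^alpha] after the first are nonpositive, so
    the recurrence makes [(1 - omega) x_n] a convex combination of earlier values and 1. *)
Lemma xs_bound alpha omega n : 0 < alpha <= 1 -> Cmod omega < 1 -> 1 <= Cmod (1 - omega)%C ->
  Cmod (xs alpha omega n) <= 1.
Proof.
  intros Ha Ho H1.
  induction n as [n IH] using (well_founded_induction Wf_nat.lt_wf).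
  assert (Hrec := xs_recurrence alpha omega n ltac:(lra) Ho).
  assert (Hle : Cmod ((1 - omega) * xs alpha omega n)%C <= 1).
  { destruct n as [|n].
    - simpl in Hrec. replace ((1 - omega) * xs alpha omega 0)%C with (RtoC 1).
      + rewrite Cmod_1. lra.
      + transitivity (1 * xs alpha omega 0 - omega * xs alpha omega 0)%C; [rewrite Hrec; ring|ring].
    - rewrite csum_decomp in Hrec. change (rbin (- alpha) 0) with 1 in Hrec.
      rewrite Nat.sub_0_r in Hrec.
      set (T := csum _ n) in Hrec.
      replace ((1 - omega) * xs alpha omega (S n))%C with (RtoC (rbin (1 - alpha) (S n)) - T)%C.
      2:{ transitivity ((1 * xs alpha omega (S n) + T) - T - omega * xs alpha omega (S n))%C;
          [rewrite Hrec; ring|ring]. }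
      assert (Hr0 : 0 <= rbin (1 - alpha) (S n)) by (apply rbin_nonneg; lra).
      eapply Rle_trans; [apply Cmod_triangle|]. rewrite Cmod_opp, Cmod_R, Rabs_pos_eq by auto.
      assert (HT : Cmod T <= sum_f_R0 (fun j => - rbin (- alpha) (S j)) n).
      { eapply Rle_trans; [apply Cmod_csum|]. apply sum_Rle. intros j Hj.
        rewrite Cmod_mult, Cmod_R. rewrite Rabs_left1 by now apply rbin_opp_nonpos.
        rewrite <- Rmult_1_r. apply Rmult_le_compat_l; [|apply IH; lia].
        pose proof (rbin_opp_nonpos alpha j Ha). lra. }
      assert (HS : 1 + sum_f_R0 (fun j => rbin (- alpha) (S j)) n = rbin (1 - alpha) (S n)).
      { replace (1 - alpha) with (- alpha + 1) by ring. rewrite <- rbin_vandermonde.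
        rewrite (decomp_sum _ (S n)) by lia. simpl pred. rewrite rbin_1. change (rbin (- alpha) 0) with 1.
        rewrite Rmult_1_r. f_equal. apply sum_eq. intros i _. rewrite rbin_1. ring. }
      assert (HN : forall m, sum_f_R0 (fun j => - rbin (- alpha) (S j)) m =
         - sum_f_R0 (fun j => rbin (- alpha) (S j)) m).
      { induction m as [|m IHm]; simpl in *; [ring|]. rewrite IHm. ring. }
      rewrite HN in HT. lra. }
  rewrite Cmod_mult in Hle. pose proof (Cmod_ge_0 (xs alpha omega n)). nra.
Qed.

(** Monotonicity makes the terms of rank [N] dominate the later ones in Tannery's theorem. *)
Lemma rbin_decreasing x N M : 0 <= x -> (0 < N <= M)%nat ->
  rbin (x + 1) M * Rpower (INR M) (- x) <= rbin (x + 1) N * Rpower (INR N) (- x).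
Proof.
  intros Hx [HN HM]. induction HM as [|M HM IH]; [lra|].
  eapply Rle_trans; [|exact IH].
  assert (HMp : 0 < INR M) by (apply lt_0_INR; lia).
  simpl rbin. rewrite S_INR.
  rewrite Rmult_assoc. apply Rmult_le_compat_l; [apply rbin_nonneg; lra|].
  set (k := INR M) in *.
  replace (Rpower k (- x)) with (exp (x * (ln (k + 1) - ln k)) * Rpower (k + 1) (- x)).
  2:{ unfold Rpower. rewrite <- exp_plus. f_equal. ring. }
  apply Rmult_le_compat_r; [pos|].
  replace ((x + 1 + k) / (k + 1)) with (1 + x * / (k + 1)) by (field; lra).
  eapply Rle_trans; [apply exp_ineq1_le|].
  assert (Hl := ln_step k HMp).
  assert (Hle : x * / (k + 1) <= x * (ln (k + 1) - ln k)) by now apply Rmult_le_compat_l.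
  now apply exp_le.
Qed.

Lemma Ci_pow_2 n : (Ci ^ (2 * n))%C = RtoC ((-1) ^ n).
Proof.
  rewrite Cpow_mult_r. replace (Ci ^ 2)%C with (RtoC (-1)).
  - now rewrite RtoC_pow.
  - simpl. apply C_ext; unfold Ci; cring.
Qed.

Lemma Cmod_Ci_pow n : Cmod (Ci ^ n)%C = 1.
Proof. rewrite Cmod_pow, Cmod_Ci. apply pow1. Qed.

(** The series is [Re E_alpha (i y)]. With [omega = i y N^(-alpha)], for which
    [|1 - omega| >= 1], the values [xs alpha omega N] converge to [E_alpha (i y)] by Gauss' limit
    and Tannery's theorem. *)
Lemma ml_half_bound alpha y : 0 < alpha <= 1 ->
  Rabs (Series (fun k => Re (Ci ^ k)%C * y ^ k / RGamma (alpha * INR k + 1))) <= 1.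
Proof.
  intros Ha.
  set (v := fun k => Re (Ci ^ k)%C * y ^ k / RGamma (alpha * INR k + 1)).
  set (u := fun N k => Re (Ci ^ k)%C * y ^ k *
     (rbin (alpha * INR k + 1) N * Rpower (INR N) (- (alpha * INR k)))).
  assert (Hak : forall k, 0 <= alpha * INR k) by (intros k; pos).
  assert (Hh : forall N k, Rpower (INR N) (- (alpha * INR k)) = Rpower (INR N) (- alpha) ^ k).
  { intros N k. rewrite <- Rpower_pow by pos. rewrite Rpower_mult. f_equal. ring. }
  assert (Hsmall : exists N0, (0 < N0)%nat /\ forall N, (N0 <= N)%nat ->
     Rabs y * Rpower (INR N) (- alpha) < 1).
  { destruct (INR_unbounded (Rpower (Rabs y + 1) (/ alpha))) as [N0 HN0].
    exists N0. assert (Hp := Rpower_pos (Rabs y + 1) (/ alpha)).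
    split; [apply INR_lt; simpl; lra|]. intros N HN. apply le_INR in HN.
    rewrite Rpower_Ropp. pose proof (Rabs_pos y) as Hy.
    assert (Rabs y + 1 <= Rpower (INR N) alpha).
    { replace (Rabs y + 1) with (Rpower (Rpower (Rabs y + 1) (/ alpha)) alpha).
      - apply Rle_Rpower_l; lra.
      - rewrite Rpower_mult, Rinv_l, Rpower_1; lra. }
    pose proof (Rpower_pos (INR N) alpha).
    apply Rmult_lt_reg_r with (Rpower (INR N) alpha); auto. rewrite Rmult_assoc, Rinv_l; lra. }
  destruct Hsmall as (N0 & HN0 & Hsmall).
  set (M := fun k => Rabs y ^ k * (rbin (alpha * INR k + 1) N0 * Rpower (INR N0) (- (alpha * INR k)))).
  assert (HM : ex_series M).
  { apply (ex_series_ext (fun k => (Rabs y * Rpower (INR N0) (- alpha)) ^ k * rbin (alpha * INR k + 1) N0)).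
    - intros k. unfold M. rewrite Hh, Rpow_mult_distr.
      rring.
    - apply ex_series_rbin; [lra|]. split; [|now apply Hsmall].
      pos. }
  assert (Hcoef : forall k, Rabs (Re (Ci ^ k)%C * y ^ k) <= Rabs y ^ k).
  { intros k. rewrite Rabs_mult, <- RPow_abs. rewrite <- (Rmult_1_l (Rabs y ^ k)) at 2.
    apply Rmult_le_compat_r; [pos|].
    rewrite <- (Cmod_Ci_pow k). apply re_le_Cmod. }
  assert (Hr0 : forall N k, 0 <= rbin (alpha * INR k + 1) N * Rpower (INR N) (- (alpha * INR k))).
  { intros N k. apply Rmult_le_pos; [apply rbin_nonneg; specialize (Hak k); lra|apply Rlt_le, Rpower_pos]. }
  assert (Hdom : forall N k, (N0 <= N)%nat -> Rabs (u N k) <= M k).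
  { intros N k HN. unfold u, M. rewrite Rabs_mult, (Rabs_pos_eq (rbin _ _ * _)) by auto.
    apply Rmult_le_compat; auto using Rabs_pos. apply rbin_decreasing; auto. }
  assert (Hlim : forall k, is_lim_seq (fun N => u N k) (v k)).
  { intros k. unfold u, v, Rdiv. apply is_lim_seq_mult'; [apply is_lim_seq_const|].
    now apply rbin_lim. }
  assert (Hv : forall k, Rabs (v k) <= M k).
  { intros k. assert (Hl := is_lim_seq_abs _ _ (Hlim k)).
    apply (is_lim_seq_le_loc (fun N => Rabs (u N k)) (fun _ => M k) (Rabs (v k)) (M k)); auto.
    - exists N0. intros N HN. now apply Hdom.
    - apply is_lim_seq_const. }
  assert (Hx : forall N, (N0 <= N)%nat -> Rabs (Series (u N)) <= 1).
  { intros N HN. set (omega := (Ci * RtoC (y * Rpower (INR N) (- alpha)))%C).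
    assert (Ho : Cmod omega < 1).
    { unfold omega. rewrite Cmod_mult, Cmod_Ci, Cmod_R, Rabs_mult, Rmult_1_l.
      rewrite (Rabs_pos_eq (Rpower _ _)) by pos. now apply Hsmall. }
    assert (Ho1 : 1 <= Cmod (1 - omega)%C).
    { eapply Rle_trans; [|apply re_le_Cmod].
      replace (Re (1 - omega)%C) with 1 by (unfold omega, Ci; cring). rewrite Rabs_R1. lra. }
    apply Rle_trans with (Cmod (xs alpha omega N)); [|now apply xs_bound].
    eapply Rle_trans; [|apply re_le_Cmod]. apply Req_le. f_equal.
    apply Series_ext. intros k. unfold u, omega. rewrite Cpow_mult_l, <- RtoC_pow, Rpow_mult_distr, Hh.
    cring. }
  apply Rnot_lt_le. intros hlt.
  destruct (tannery eventually u v M HM) with (eps := Rabs (Series v) - 1) as [N1 HN1]; auto.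
  - exists N0. intros N HN k. now apply Hdom.
  - intros k eps He. destruct (proj2 (is_lim_seq_spec _ _) (Hlim k) (mkposreal eps He)) as [N2 HN2].
    exists N2. exact HN2.
  - unfold v in *; lra.
  - specialize (HN1 (N0 + N1)%nat ltac:(lia)). specialize (Hx (N0 + N1)%nat ltac:(lia)).
    rewrite Rabs_minus_sym in HN1. pose proof (Rabs_triang_inv (Series v) (Series (u (N0 + N1)%nat))).
    lra.
Qed.

(** The even part of the power series [E_(lambda/2) (i y)] is its real part, and is
    [E_lambda (- y^2)]. *)
Lemma ml_bound lambda s : 0 < lambda <= 2 -> 0 <= s -> Rabs (ml lambda (- s)) <= 1.
Proof.
  intros Hl Hs. set (alpha := lambda / 2).
  pose proof (ml_half_bound alpha (sqrt s) ltac:(unfold alpha; lra)) as H.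
  replace (ml lambda (- s)) with
    (Series (fun k => Re (Ci ^ k)%C * sqrt s ^ k / RGamma (alpha * INR k + 1))); [exact H|].
  set (a := fun k => Re (Ci ^ k)%C / RGamma (alpha * INR k + 1)).
  transitivity (PSeries a (sqrt s)).
  { apply Series_ext. intros k. unfold a, Rdiv. ring. }
  assert (Hsq : sqrt s ^ 2 = s) by (rewrite <- Rsqr_pow2; now apply Rsqr_sqrt).
  assert (He : forall n, a (2 * n)%nat = (-1) ^ n / RGamma (lambda * INR n + 1)).
  { intros n. unfold a. rewrite Ci_pow_2. change (Re (RtoC ((-1) ^ n))) with ((-1) ^ n).
    do 3 f_equal. rewrite mult_INR. unfold alpha. simpl. field. }
  assert (Ho : forall n, a (2 * n + 1)%nat = 0).
  { intros n. unfold a. rewrite Nat.add_1_r. change (Ci ^ S (2 * n))%C with (Ci * Ci ^ (2 * n))%C.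
    rewrite Ci_pow_2. replace (Re (Ci * RtoC ((-1) ^ n))%C) with 0 by (unfold Ci; cring).
    unfold Rdiv. ring. }
  assert (Hml : forall n, a (2 * n)%nat * s ^ n = (- s) ^ n / RGamma (lambda * INR n + 1)).
  { intros n. rewrite He. replace (- s) with ((-1) * s) by ring. rewrite Rpow_mult_distr.
    unfold Rdiv. ring. }
  rewrite PSeries_odd_even.
  - rewrite Hsq, (PSeries_ext (fun n => a (2 * n + 1)%nat) (fun _ => 0)), PSeries_const_0 by auto.
    rewrite Rmult_0_r, Rplus_0_r. apply Series_ext. exact Hml.
  - apply ex_pseries_R. rewrite Hsq.
    apply (ex_series_Rle _ (fun n => s ^ n / RGamma (lambda * INR n + 1))).
    + intros n. rewrite Hml. unfold Rdiv. rewrite Rabs_mult, <- RPow_abs, Rabs_Ropp.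
      rewrite (Rabs_pos_eq s) by auto. rewrite Rabs_pos_eq; [apply Rle_refl|].
      apply Rlt_le, Rinv_0_lt_compat, RGamma_ml_pos; lra.
    + apply ml_summable; lra.
  - apply ex_pseries_R. apply (ex_series_ext (fun _ => 0 * 0)).
    + intros n. rewrite Ho. rring.
    + apply (ex_series_ext (fun n => 0 * (1/2) ^ n)).
      * intros n. rring.
      * apply: ex_series_scal. apply ex_series_geom. rewrite Rabs_pos_eq; lra.
Qed.

(** * Divergence of the beta integrals for orders above 2 *)

Lemma Re_csum u n : Re (csum u n) = sum_f_R0 (fun j => Re (u j)) n.
Proof.
  induction n as [|n IH]; [reflexivity|]. simpl sum_f_R0. rewrite <- IH. reflexivity.
Qed.

Lemma Im_csum u n : Im (csum u n) = sum_f_R0 (fun j => Im (u j)) n.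
Proof.
  induction n as [|n IH]; [reflexivity|]. simpl sum_f_R0. rewrite <- IH. reflexivity.
Qed.

Lemma ex_series_abs_Re u : ex_series (fun n => Cmod (u n)) -> ex_series (fun n => Rabs (Re (u n))).
Proof.
  apply ex_series_Rle. intros n. rewrite Rabs_Rabsolu. apply re_le_Cmod.
Qed.

Lemma ex_series_abs_Im u : ex_series (fun n => Cmod (u n)) -> ex_series (fun n => Rabs (Im (u n))).
Proof.
  apply ex_series_Rle. intros n. rewrite Rabs_Rabsolu. apply im_le_Cmod.
Qed.

Lemma is_Cseries_mult a b la lb : is_Cseries a la -> is_Cseries b lb ->
  ex_series (fun n => Cmod (a n)) -> ex_series (fun n => Cmod (b n)) ->
  is_Cseries (fun n => csum (fun k => (a k * b (n - k)%nat)%C) n) (la * lb)%C.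
Proof.
  intros [A1 A2] [B1 B2] HA HB.
  assert (a1 := ex_series_abs_Re a HA). assert (a2 := ex_series_abs_Im a HA).
  assert (b1 := ex_series_abs_Re b HB). assert (b2 := ex_series_abs_Im b HB).
  split.
  - assert (H := is_series_lin _ _ 1 (-1) _ _ (is_series_mult _ _ _ _ A1 B1 a1 b1)
      (is_series_mult _ _ _ _ A2 B2 a2 b2)).
    replace (Re (la * lb)%C) with (1 * (Re la * Re lb) + -1 * (Im la * Im lb)) by cring.
    refine (is_series_ext _ _ _ _ H). intros n. cbv beta. rewrite Re_csum.
    rewrite 2!scal_sum, <- sum_plus. apply sum_eq. intros i _. cring.
  - assert (H := is_series_lin _ _ 1 1 _ _ (is_series_mult _ _ _ _ A1 B2 a1 b2)
      (is_series_mult _ _ _ _ A2 B1 a2 b1)).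
    replace (Im (la * lb)%C) with (1 * (Re la * Im lb) + 1 * (Im la * Re lb)) by cring.
    refine (is_series_ext _ _ _ _ H). intros n. cbv beta. rewrite Im_csum.
    rewrite 2!scal_sum, <- sum_plus. apply sum_eq. intros i _. cring.
Qed.

(** The integrand of the Laplace transform of [|E_lambda (- t^lambda)|] at [d]. *)
Definition ml_laplace (lambda d t : R) : R := Rabs (ml lambda (- Rpower t lambda)) * exp (- (d * t)).

Lemma continuous_ml_laplace lambda d t : 0 < lambda -> 0 < t -> continuous (ml_laplace lambda d) t.
Proof.
  intros Hl Ht. apply Rcont_mult.
  - apply: continuous_comp; [|apply continuous_Rabs].
    apply: continuous_comp; [|now apply continuous_ml].
    apply: continuous_opp. now apply continuous_Rpower.
  - apply: ex_derive_continuous. auto_derive; auto.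
Qed.

(** The real form of [xs] at [omega = - eta]. *)
Definition discrete_relaxation (lambda eta : R) (n : nat) : R :=
  Series (fun k => (- eta) ^ k * rbin (lambda * INR k + 1) n).

(** With [eta = c^(-lambda)], the [n]-th value is the integral of [E_lambda (- t^lambda)] against
    the Gamma density [c^(n+1) t^n e^(-ct) / n!], and [(rho c t)^n / n! <= e^(rho c t)] leaves
    the factor [e^(-(1-rho) c t)] to the Laplace transform. The series itself only shows a
    radius of convergence below 1; the bound extends it to [rho]. *)
Lemma discrete_relaxation_bound lambda c rho B n : 0 < lambda -> 1 < c -> 0 < rho < 1 ->
  ibound D0oo (ml_laplace lambda ((1 - rho) * c)) B ->
  Rabs (discrete_relaxation lambda (Rpower c (- lambda)) n) <= c * (/ rho) ^ n * B.
Proof.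
  intros Hl Hc Hrho HB. assert (HD := interval_D0oo).
  set (eta := Rpower c (- lambda)). assert (Heta0 : 0 < eta) by pos.
  assert (Heta : eta < 1).
  { unfold eta. rewrite <- (Rpower_O c) by lra. apply Rpower_lt; lra. }
  set (C0 := c ^ S n / INR (fact n)).
  assert (HC0 : 0 < C0) by pos.
  set (x := fun k => lambda * INR k).
  assert (Hx : forall k, 0 <= x k) by (intros k; unfold x; pos).
  set (a := fun k => / RGamma (x k + 1) * C0).
  assert (Ha : forall k, 0 < a k).
  { intros k. apply Rmult_lt_0_compat; auto. apply Rinv_0_lt_compat, RGamma_pos, Hx. }
  set (K := fun k t => Rpower t (x k + INR n + 1 - 1) * exp (- (c * t))).
  set (f := fun k t => (-1) ^ k * (a k * K k t)).
  set (g := fun k t => a k * K k t).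
  assert (HK0 : forall k t, 0 <= g k t).
  { intros k t. apply Rmult_le_pos; [apply Rlt_le, Ha|unfold K; pos]. }
  assert (Hpow1 : forall k, Rabs ((-1) ^ k) = 1) by (intros; apply pow_1_abs).
  assert (Hfg : forall k t, Rabs (f k t) = g k t).
  { intros k t. unfold f. fold (g k t). rewrite Rabs_mult, Hpow1, (Rabs_pos_eq (g k t)); auto. ring. }
  assert (Hxn : forall k, 0 < x k + INR n + 1).
  { intros k. specialize (Hx k). pose proof (pos_INR n). lra. }
  assert (HxR : forall k y, Rpower y (x k) = Rpower y lambda ^ k).
  { intros k y. rewrite <- Rpower_pow by pos. now rewrite Rpower_mult. }
  assert (HgI : forall k, improper D0oo (g k) (eta ^ k * rbin (x k + 1) n)).
  { intros k. replace (eta ^ k * rbin (x k + 1) n) with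
      (a k * (Rpower c (- (x k + INR n + 1)) * RGamma (x k + INR n + 1))).
    - apply improper_scal; auto; [apply locint_gamma|]. apply RGamma_scaled; [auto|lra].
    - rewrite RGamma_rbin by auto. rewrite Rpower_Ropp.
      replace (x k + INR n + 1) with (x k + INR (S n)) by (rewrite S_INR; ring).
      rewrite Rpower_plus, HxR, Rpower_pow by lra. unfold eta, a, C0.
      rewrite Rpower_Ropp, pow_inv.
      assert (RGamma (x k + 1) <> 0) by (apply Rgt_not_eq, RGamma_pos, Hx).
      pose proof (INR_fact_neq_0 n). pose proof (pow_nonzero c (S n) ltac:(lra)).
      pose proof (pow_nonzero (Rpower c lambda) k (Rgt_not_eq _ _ (Rpower_pos c lambda))).
      field. auto. }
  assert (Ig : forall k, locint D0oo (g k)) by (intros k; apply locint_scal, locint_gamma).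
  assert (If : forall k, locint D0oo (f k)) by (intros k; apply locint_scal, Ig).
  assert (Hml : forall t, 0 < t -> Series (fun k => f k t) =
     ml lambda (- Rpower t lambda) * (C0 * (t ^ n * exp (- (c * t))))).
  { intros t Ht. unfold ml. rewrite <- Series_scal_r. apply Series_ext. intros k.
    unfold f, a, K. fold (x k).
    replace (x k + INR n + 1 - 1) with (x k + INR n) by ring.
    rewrite Rpower_plus, HxR, Rpower_pow by auto.
    replace (- Rpower t lambda) with ((-1) * Rpower t lambda) by ring.
    rewrite Rpow_mult_distr. unfold Rdiv. ring. }
  destruct (improper_series D0oo f g (fun k => eta ^ k * rbin (x k + 1) n)
     (fun k => (- eta) ^ k * rbin (x k + 1) n)) as (_ & HI & HL); auto.
  - intros k t _. rewrite Hfg. apply Rle_refl.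
  - intros u v Hu Hv Huv. unfold D0oo in Hu, Hv.
    exists (fun k => (C0 * v ^ n) * (Rpower v lambda ^ k / RGamma (lambda * INR k + 1))).
    split; [apply: ex_series_scal; apply ml_summable; [auto|pos]|].
    intros k t Ht. rewrite Hfg. unfold g, K, a. fold (x k).
    replace (x k + INR n + 1 - 1) with (x k + INR n) by ring.
    rewrite Rpower_plus, HxR, Rpower_pow by lra.
    assert (HG : 0 < / RGamma (x k + 1)) by (apply Rinv_0_lt_compat, RGamma_pos, Hx).
    replace (C0 * v ^ n * (Rpower v lambda ^ k / RGamma (x k + 1))) with
      (/ RGamma (x k + 1) * C0 * (Rpower v lambda ^ k * v ^ n * 1)) by (unfold Rdiv; ring).
    apply Rmult_le_compat_l; [pos|].
    pose proof (Rpower_pos t lambda) as HP.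
    apply Rmult_le_compat.
    + pos.
    + pos.
    + apply Rmult_le_compat; try pos; apply pow_incr; [|lra].
      split; [lra|]. apply Rle_Rpower_l; lra.
    + apply exp_le_1.
      assert (0 < c * t) by pos. lra.
  - intros k. apply improper_ge; auto.
  - apply ex_series_rbin; lra.
  - intros k. replace (- eta) with ((-1) * eta) by ring. rewrite Rpow_mult_distr, Rmult_assoc.
    apply improper_scal; [auto|apply Ig|apply HgI].
  - destruct (improper_abs D0oo (fun t => Series (fun k => f k t))
      (fun t => c * (/ rho) ^ n * ml_laplace lambda ((1 - rho) * c) t) (c * (/ rho) ^ n * B))
      as (l & Hl1 & Hl2); auto.
    + apply locint_scal, locint_continuous; auto. intros t Ht. now apply continuous_ml_laplace.
    + intros t Ht. unfold D0oo in Ht. rewrite Hml by auto. unfold ml_laplace.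
      rewrite Rabs_mult, (Rabs_pos_eq (C0 * _)).
      2:{ pos. }
      replace (c * (/ rho) ^ n * (Rabs (ml lambda (- Rpower t lambda)) * exp (- ((1 - rho) * c * t))))
       with (Rabs (ml lambda (- Rpower t lambda)) * (c * (/ rho) ^ n * exp (- ((1 - rho) * c * t)))) by ring.
      apply Rmult_le_compat_l; [pos|].
      replace (- ((1 - rho) * c * t)) with (rho * c * t + - (c * t)) by ring. rewrite exp_plus.
      replace (C0 * (t ^ n * exp (- (c * t)))) with
        (c * (/ rho) ^ n * ((rho * c * t) ^ n / INR (fact n) * exp (- (c * t)))).
      2:{ unfold C0. rewrite 2!Rpow_mult_distr, pow_inv. simpl pow. field.
          split; [apply INR_fact_neq_0|apply pow_nonzero; lra]. }
      apply Rmult_le_compat_l.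
      { pos. }
      apply Rmult_le_compat_r; [pos|]. apply pow_fact_le_exp.
      pos.
    + apply ibound_scal; auto.
      * apply locint_continuous; auto. intros t Ht. now apply continuous_ml_laplace.
      * pos.
    + assert (HE := improper_unique D0oo _ _ _ HD HI Hl1).
      change (discrete_relaxation lambda eta n = l) in HE. now rewrite HE.
Qed.

(** The Laplace transform of [t -> E_lambda (- t^lambda)] would have a pole at
    [e^(i pi / lambda)], whose real part is positive when [lambda > 2]. In discrete form: the
    generating function [X] of the relaxation sequence satisfies
    [(1 - q)^lambda X = (1 - q)^(lambda - 1) - eta X] in the whole unit disc, and at
    [1 - q = e^(i pi / lambda) / c] the terms in [X] cancel, leaving [(1 - q)^(lambda - 1) = 0]. *)
Lemma ml_not_laplace lambda : 2 < lambda ->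
  (forall d, 0 < d -> exists B, ibound D0oo (ml_laplace lambda d) B) -> False.
Proof.
  intros Hl H.
  set (phi := PI / lambda). pose proof PI_RGT_0 as HPI.
  assert (Hphi : 0 < phi < PI / 2).
  { unfold phi. split; [pos|].
    apply Rmult_lt_compat_l; [lra|]. apply Rinv_lt_contravar; lra. }
  assert (Hcos : 0 < cos phi) by (apply cos_gt_0; lra).
  (* Any [c > 1 / cos phi] places [q = 1 - e^(i phi) / c] inside the unit disc. *)
  set (c := 2 + / cos phi). assert (Hic : 0 < / cos phi) by pos.
  assert (Hc : 1 < c) by (unfold c; lra).
  set (eta := Rpower c (- lambda)). assert (Heta0 : 0 < eta) by pos.
  assert (Heta : eta < 1).
  { unfold eta. rewrite <- (Rpower_O c) by lra. apply Rpower_lt; lra. }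
  set (e := (cos phi, sin phi) : C).
  set (q := (1 - RtoC (/ c) * e)%C).
  assert (Hq : Cmod q < 1).
  { apply Rsqr_incrst_0; [|pos|lra]. rewrite 2!Rsqr_pow2, Cmod2_alt, pow1.
    replace (Re q) with (1 - / c * cos phi) by (unfold q, e; cring).
    replace (Im q) with (- (/ c * sin phi)) by (unfold q, e; cring).
    pose proof (sin2_cos2 phi) as Hsc. unfold Rsqr in Hsc.
    assert (Hlt : / c < cos phi).
    { rewrite <- (Rinv_inv (cos phi)). apply Rinv_lt_contravar.
      - pos. - unfold c. lra. }
    assert (0 < / c) by pos.
    replace ((1 - / c * cos phi) ^ 2 + (- (/ c * sin phi)) ^ 2) with
      (1 - 2 * / c * cos phi + / c * / c * (sin phi * sin phi + cos phi * cos phi)) by ring.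
    rewrite Hsc.
    assert (/ c * / c < / c * cos phi) by (apply Rmult_lt_compat_l; auto).
    assert (0 < / c * cos phi) by pos. lra. }
  set (rho := (1 + Cmod q) / 2). pose proof (Cmod_ge_0 q) as Hq0.
  assert (Hrho : Cmod q < rho < 1) by (unfold rho; lra).
  destruct (H ((1 - rho) * c)) as [B HB]; [pos|].
  set (X := discrete_relaxation lambda eta).
  assert (HX : forall n, Rabs (X n) <= c * (/ rho) ^ n * B).
  { intros n. apply discrete_relaxation_bound; auto; lra. }
  assert (Ho : Cmod (RtoC (- eta)) < 1) by (rewrite Cmod_R, Rabs_Ropp, Rabs_pos_eq; lra).
  assert (Hxs : forall n, xs lambda (RtoC (- eta)) n = RtoC (X n)).
  { intros n. unfold xs, X, discrete_relaxation. rewrite <- CSeries_R. apply CSeries_ext. intros k.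
    now rewrite <- RtoC_pow, <- RtoC_mult. }
  set (x := fun n => (RtoC (X n) * q ^ n)%C).
  assert (HxM : ex_series (fun n => Cmod (x n))).
  { apply (ex_series_Rle _ (fun n => (c * B) * (Cmod q / rho) ^ n)).
    - intros n. rewrite Rabs_pos_eq by pos. unfold x. rewrite Cmod_mult, Cmod_pow, Cmod_R.
      unfold Rdiv. rewrite Rpow_mult_distr.
      replace (c * B * (Cmod q ^ n * (/ rho) ^ n)) with (c * (/ rho) ^ n * B * Cmod q ^ n) by ring.
      apply Rmult_le_compat_r; [pos|auto].
    - apply: ex_series_scal. apply ex_series_geom. rewrite Rabs_pos_eq.
      + apply Rdiv_lt_1; lra.
      + pos. }
  destruct (Cseries_abs x _ (fun n => Rle_refl _) HxM) as [HxS _].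
  set (S := CSeries x) in HxS.
  set (a := fun n => (cbin (- RtoC lambda) n * q ^ n)%C).
  assert (HaM : ex_series (fun n => Cmod (a n))).
  { apply (ex_series_ext (fun n => Cmod (cbin (- RtoC lambda) n) * Cmod q ^ n)).
    - intros n. unfold a. rewrite Cmod_mult, Cmod_pow. reflexivity.
    - apply ex_series_cbin. auto. }
  assert (HaS := is_Cseries_binomial (- RtoC lambda)%C q Hq).
  assert (HrS := is_Cseries_binomial (RtoC (1 - lambda)) q Hq).
  assert (Hprod := is_Cseries_mult a x _ _ HaS HxS HaM HxM).
  assert (Heq : (Cpower (1 - q) (- - RtoC lambda) * S =
     Cpower (1 - q) (- RtoC (1 - lambda)) + RtoC (- eta) * S)%C).
  { apply (is_Cseries_det _ _ _ Hprod).
    eapply is_Cseries_ext; [|apply (is_Cseries_plus _ _ _ _ HrS (is_Cseries_scal (RtoC (- eta)) _ _ HxS))].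
    intros n. cbv beta. unfold a, x.
    assert (Hrec := xs_recurrence lambda (RtoC (- eta)) n ltac:(lra) Ho).
    rewrite Hxs in Hrec. rewrite cbin_R.
    transitivity (q ^ n * (RtoC (rbin (1 - lambda) n) + RtoC (- eta) * RtoC (X n)))%C; [ring|].
    rewrite <- Hrec, <- csum_scal. apply csum_ext. intros j Hj.
    rewrite Hxs, <- RtoC_opp, cbin_R.
    replace (q ^ n)%C with (q ^ j * q ^ (n - j))%C; [ring|].
    rewrite <- Cpow_add_r. f_equal. lia. }
  assert (He0 : e <> 0).
  { intros h. apply (f_equal Re) in h. simpl in h. lra. }
  assert (H1q : (1 - q)%C = (RtoC (/ c) * e)%C) by (unfold q; ring).
  assert (Hpole : Cpower (1 - q) (- - RtoC lambda) = RtoC (- eta)).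
  { rewrite H1q, Cpower_scale by (auto; pos).
    replace (- - RtoC lambda)%C with (RtoC lambda) by ring.
    rewrite rpow_R. unfold Cpower.
    assert (Hlog : Clog e = (0, phi)).
    { rewrite Clog_right by exact Hcos. f_equal.
      - replace (Cmod e) with 1; [apply ln_1|]. unfold Cmod, e. simpl fst. simpl snd.
        rewrite <- !Rsqr_pow2. rewrite Rplus_comm, sin2_cos2. symmetry. apply sqrt_1.
      - change (atan (tan phi) = phi). apply atan_tan. lra. }
    rewrite Hlog. replace (RtoC lambda * (0, phi))%C with ((0, PI) : C).
    - replace (Cexp (0, PI)) with (RtoC (-1)).
      + rewrite <- RtoC_mult. f_equal. unfold eta, Rpower. rewrite ln_Rinv by lra.
        replace (- lambda * ln c) with (lambda * - ln c) by ring. ring.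
      + apply C_ext; unfold Cexp; simpl; rewrite exp_0; [rewrite cos_PI|rewrite sin_PI]; cring.
    - unfold phi. apply C_ext; unfold Re, Im; simpl; field; lra. }
  rewrite Hpole in Heq.
  apply (Cexp_neq_0 (- RtoC (1 - lambda) * Clog (1 - q))%C).
  change (Cpower (1 - q)%C (- RtoC (1 - lambda))%C = 0).
  transitivity (RtoC (- eta) * S - RtoC (- eta) * S)%C; [rewrite Heq at 1; ring|ring].
Qed.

(** Near [t = 1] the weight [(1 - t)^(b - 1)] decays at most polynomially in
    [tau = (p / (t (1 - t)))^(1 / lambda)], so that [e^(- d tau) dtau] is dominated by the
    beta weight. *)
Lemma beta_weight_dominates p lambda th b d : 0 < p -> 0 < lambda -> 0 < d ->
  let g := fun t => Rpower (p / (t * (1 - t))) (/ lambda) in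
  exists K, 0 <= K /\ forall t, 1 / 2 <= t < 1 ->
    / lambda * g t * ((2 * t - 1) / (t * (1 - t))) * exp (- (d * g t)) <=
      K * (Rpower t (th - 1) * Rpower (1 - t) (b - 1)).
Proof.
  intros Hp Hl Hd g.
  assert (Hin : forall t, D01 t -> 0 < t * (1 - t)).
  { intros t [h1 h2]. pos. }
  assert (Hgl : forall t, D01 t -> Rpower (g t) lambda = p / (t * (1 - t))).
  { intros t Ht. specialize (Hin t Ht). unfold g. rewrite Rpower_mult, Rinv_l, Rpower_1; [auto|pos|lra]. }
  set (be := Rabs (1 - b)). assert (Hbe : 0 <= be) by pos.
  destruct (Rpower_exp_bound (1 + lambda * (1 + be)) d) as (M & HM & KM);
    [assert (0 <= lambda * (1 + be)) by pos; lra|auto|].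
  set (c1 := Rpower (1 / 2) (Rabs (th - 1))). assert (Hc1 : 0 < c1) by pos.
  set (K := / lambda * / c1 * Rpower p (- (1 + be)) * M).
  exists K. split; [unfold K; apply Rlt_le; pos|].
  intros t Ht. assert (HtD : D01 t) by (unfold D01; lra).
  assert (Hgp : 0 < g t) by apply Rpower_pos. specialize (KM (g t) Hgp).
  specialize (Hin t HtD). set (s := / (t * (1 - t))).
  assert (Hs : 0 < s) by pos.
  assert (Hln : - ln (1 - t) <= ln s).
  { unfold s. rewrite ln_Rinv, ln_mult by lra.
    assert (ln t <= 0) by (rewrite <- ln_1; apply ln_le; lra). lra. }
  assert (Hln0 : 0 <= - ln (1 - t)).
  { assert (ln (1 - t) <= 0) by (rewrite <- ln_1; apply ln_le; lra). lra. }
  assert (H1 : c1 <= Rpower t (th - 1)).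
  { apply exp_le. assert (Hlt : ln (1 / 2) <= ln t <= 0).
    { split; [apply ln_le; lra|]. rewrite <- ln_1. apply ln_le; lra. }
    assert (Rabs (th - 1) * ln (1/2) <= Rabs (th - 1) * ln t)
      by (apply Rmult_le_compat_l; [pos|lra]).
    assert (0 <= (Rabs (th - 1) - (th - 1)) * - ln t).
    { apply Rmult_le_pos; [|lra]. pose proof (Rle_abs (th - 1)). lra. }
    lra. }
  assert (H2 : Rpower s (- be) <= Rpower (1 - t) (b - 1)).
  { apply exp_le.
    assert (be * - ln (1 - t) <= be * ln s) by (apply Rmult_le_compat_l; auto).
    assert (0 <= (be + (1 - b)) * - ln (1 - t)).
    { apply Rmult_le_pos; [|lra]. pose proof (Rle_abs (- (1 - b))) as h.
      rewrite Rabs_Ropp in h. unfold be. lra. }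
    lra. }
  assert (Hsg : s = Rpower (g t) lambda * / p).
  { rewrite Hgl by auto. unfold s. field. split; lra. }
  set (dg := / lambda * g t * ((2 * t - 1) / (t * (1 - t)))).
  assert (Hdg : dg <= / lambda * g t * s).
  { unfold dg. apply Rmult_le_compat_l.
    - pos.
    - unfold Rdiv. fold s. rewrite <- (Rmult_1_l s) at 2. apply Rmult_le_compat_r; lra. }
  pose proof (exp_pos (- (d * g t))) as He. set (E := exp (- (d * g t))) in *.
  apply Rle_trans with (/ lambda * g t * s * E); [apply Rmult_le_compat_r; lra|].
  assert (Hil : 0 < / lambda) by pos.
  assert (Hic1 : 0 < / c1) by pos.
  assert (Hsb : g t * s * E * Rpower s be <= Rpower p (- (1 + be)) * M).
  { replace (g t * s * E * Rpower s be) with (g t * Rpower s (1 + be) * E).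
    2:{ rewrite Rpower_plus, Rpower_1 by auto. ring. }
    rewrite Hsg. rewrite <- Rpower_mult_distr by pos.
    rewrite Rpower_mult.
    replace (Rpower (/ p) (1 + be)) with (Rpower p (- (1 + be))).
    2:{ unfold Rpower. rewrite ln_Rinv by auto. f_equal. ring. }
    rewrite Rpower_plus, Rpower_1 in KM by auto.
    replace (g t * (Rpower (g t) (lambda * (1 + be)) * Rpower p (- (1 + be))) * E) with
     (Rpower p (- (1 + be)) * (g t * Rpower (g t) (lambda * (1 + be)) * E)) by ring.
    apply Rmult_le_compat_l; [pos|exact KM]. }
  assert (HsN : Rpower s be * Rpower s (- be) = 1).
  { rewrite <- Rpower_plus. replace (be + - be) with 0 by ring. now apply Rpower_O. }
  apply Rle_trans with (K * (c1 * Rpower s (- be))).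
  - replace (/ lambda * g t * s * E) with (/ lambda * (g t * s * E * Rpower s be) * Rpower s (- be)).
    2:{ transitivity (/ lambda * (g t * s * E) * (Rpower s be * Rpower s (- be))); [ring|].
        rewrite HsN. ring. }
    replace (K * (c1 * Rpower s (- be))) with
      (/ lambda * (Rpower p (- (1 + be)) * M) * Rpower s (- be)) by (unfold K; field; lra).
    apply Rmult_le_compat_r; [pos|]. apply Rmult_le_compat_l; lra.
  - apply Rmult_le_compat_l.
    + unfold K. apply Rlt_le. pos.
    + apply Rmult_le_compat; auto; apply Rlt_le; [auto|pos].
Qed.

(** Change the variable to [tau = (p / (t (1 - t)))^(1 / lambda)] on [1/2, 1): this covers all
    large [tau], and the remaining bounded range is harmless by continuity. *)
Lemma laplace_of_beta p lambda th b B0 : 0 < p -> 0 < lambda ->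
  ibound D01 (fun t => Rpower t (th - 1) * Rpower (1 - t) (b - 1) *
     Rabs (ml lambda (- (p / (t * (1 - t)))))) B0 ->
  forall d, 0 < d -> exists B, ibound D0oo (ml_laplace lambda d) B.
Proof.
  intros Hp Hl HB0 d Hd. assert (HD := interval_D0oo).
  set (G := ml_laplace lambda d).
  assert (CG : forall t, 0 < t -> continuous G t) by (intros; now apply continuous_ml_laplace).
  assert (IG : locint D0oo G) by (apply locint_continuous; auto).
  assert (G0 : forall t, 0 <= G t) by (intros t; unfold G, ml_laplace; pos).
  set (w := fun t => Rpower t (th - 1) * Rpower (1 - t) (b - 1) *
     Rabs (ml lambda (- (p / (t * (1 - t)))))) in HB0.
  set (g := fun t => Rpower (p / (t * (1 - t))) (/ lambda)).
  set (dg := fun t => / lambda * g t * ((2 * t - 1) / (t * (1 - t)))).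
  assert (Hin : forall t, D01 t -> 0 < t * (1 - t)).
  { intros t [h1 h2]. pos. }
  assert (Hin' : forall t, D01 t -> 0 < p / (t * (1 - t))).
  { intros t Ht. specialize (Hin t Ht). pos. }
  assert (Cs : forall t, D01 t -> continuous (fun t => p / (t * (1 - t))) t).
  { intros t Ht. specialize (Hin t Ht). apply: ex_derive_continuous. auto_derive. lra. }
  assert (Cg : forall t, D01 t -> continuous g t).
  { intros t Ht. apply (continuous_comp (fun t => p / (t * (1 - t))) (fun x => Rpower x (/ lambda))); auto.
    apply continuous_Rpower. auto. }
  assert (Dg : forall t, D01 t -> is_derive g t (dg t)).
  { intros t Ht. specialize (Hin t Ht) as h. specialize (Hin' t Ht) as h'. unfold g, dg, g, Rpower.
    destruct Ht as [t0 t1].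
    auto_derive; [repeat split; try lra; exact h'|].
    change (p * / (t * (1 + - t))) with (p / (t * (1 - t))).
    set (E := exp (/ lambda * ln (p / (t * (1 - t))))). field. repeat split; lra. }
  assert (Cdg : forall t, D01 t -> continuous dg t).
  { intros t Ht. unfold dg. apply Rcont_mult.
    - apply Rcont_mult; [apply continuous_const|auto].
    - specialize (Hin t Ht). apply: ex_derive_continuous. auto_derive. lra. }
  assert (Hgl : forall t, D01 t -> Rpower (g t) lambda = p / (t * (1 - t))).
  { intros t Ht. unfold g. rewrite Rpower_mult, Rinv_l, Rpower_1; auto. lra. }
  assert (Cw : forall t, D01 t -> continuous w t).
  { intros t Ht. unfold w. apply Rcont_mult; [apply Rcont_mult|].
    - apply continuous_Rpower, Ht.
    - apply (continuous_comp (fun t => 1 - t) (fun x => Rpower x (b - 1))).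
      + apply: ex_derive_continuous. auto_derive; auto.
      + apply continuous_Rpower. destruct Ht; lra.
    - apply: continuous_comp; [|apply continuous_Rabs].
      apply: continuous_comp; [|now apply continuous_ml].
      apply: continuous_opp. now apply Cs. }
  destruct (beta_weight_dominates p lambda th b d Hp Hl Hd) as (K & HK & Hpt).
  set (tau0 := g (1 / 2)). assert (Ht0 : 0 < tau0) by apply Rpower_pos.
  assert (Hfar : forall t2, 1 / 2 <= t2 < 1 -> RInt G tau0 (g t2) <= K * B0).
  { intros t2 Ht2.
    assert (Hseg : forall x, Rmin (1/2) t2 <= x <= Rmax (1/2) t2 -> 1/2 <= x < 1).
    { intros x Hx. rewrite Rmin_left, Rmax_right in Hx by lra. lra. }
    unfold tau0. rewrite <- (RInt_comp G g dg).
    2:{ intros x Hx. apply CG, Rpower_pos. }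
    2:{ intros x Hx. assert (D01 x) by (specialize (Hseg x Hx); unfold D01; lra). split; auto. }
    apply Rle_trans with (RInt (fun t => K * w t) (1/2) t2).
    - apply RInt_le; [lra| | |].
      + apply: ex_RInt_continuous. intros x Hx.
        assert (D01 x) by (specialize (Hseg x Hx); unfold D01; lra).
        apply Rcont_mult; auto. apply (continuous_comp g G); auto. apply CG, Rpower_pos.
      + apply: ex_RInt_continuous. intros x Hx.
        assert (D01 x) by (specialize (Hseg x Hx); unfold D01; lra).
        apply Rcont_mult; [apply continuous_const|auto].
      + intros x Hx. assert (HxD : D01 x) by (unfold D01; lra).
        change (scal (dg x) (G (g x))) with (dg x * G (g x)). unfold G, ml_laplace, w.
        rewrite Hgl by auto.
        replace (dg x * (Rabs (ml lambda (- (p / (x * (1 - x))))) * exp (- (d * g x)))) with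
          (dg x * exp (- (d * g x)) * Rabs (ml lambda (- (p / (x * (1 - x)))))) by ring.
        rewrite <- Rmult_assoc. apply Rmult_le_compat_r; [pos|]. apply Hpt. lra.
    - assert (Iw : locint D01 w) by (apply locint_continuous; [apply interval_D01|exact Cw]).
      rewrite (is_RInt_unique _ _ _ (K * RInt w (1/2) t2)).
      2:{ apply: is_RInt_scal. apply RInt_correctR. apply Iw; unfold D01; lra. }
      apply Rmult_le_compat_l; auto. apply HB0; unfold D01; lra. }
  set (M0 := Series (fun n => Rpower tau0 lambda ^ n / RGamma (lambda * INR n + 1))).
  assert (Hnear : forall t, 0 < t <= tau0 -> G t <= M0).
  { intros t Ht. unfold G, ml_laplace. apply Rle_trans with (M0 * 1); [|lra].
    apply Rmult_le_compat; [pos|pos| |].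
    - unfold ml. apply Series_abs_le.
      + intros n. unfold Rdiv. rewrite Rabs_mult, <- RPow_abs, Rabs_Ropp.
        rewrite (Rabs_pos_eq (Rpower _ _)) by pos.
        assert (0 < / RGamma (lambda * INR n + 1)) by (apply Rinv_0_lt_compat, RGamma_ml_pos, Hl).
        rewrite Rabs_pos_eq by lra. apply Rmult_le_compat_r; [lra|]. apply pow_incr.
        split; [pos|]. apply Rle_Rpower_l; lra.
      + apply ml_summable; [auto|pos].
    - apply exp_le_1. assert (0 < d * t) by pos. lra. }
  assert (HM0 : 0 <= M0) by (apply Rle_trans with (G tau0); auto; apply Hnear; lra).
  exists (M0 * tau0 + K * B0). intros u v Hu Hv Huv. unfold D0oo in Hu, Hv.
  set (y := Rmin (1 / 2) (p * Rpower v (- lambda))).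
  assert (Hy : 0 < y <= 1 / 2).
  { split; [|apply Rmin_l]. apply Rmin_glb_lt; [lra|]. pos. }
  assert (Hv2 : v <= g (1 - y)).
  { unfold g. replace v with (Rpower (Rpower v lambda) (/ lambda)) at 1.
    2:{ rewrite Rpower_mult, Rinv_r, Rpower_1; lra. }
    apply Rle_Rpower_l; [apply Rlt_le, Rinv_0_lt_compat, Hl|]. split; [pos|].
    assert (Hyv : y <= p * / Rpower v lambda).
    { rewrite <- Rpower_Ropp. apply Rmin_r. }
    pose proof (Rpower_pos v lambda) as HV. set (V := Rpower v lambda) in *.
    replace (1 - (1 - y)) with y by ring.
    assert (0 < (1 - y) * y) by pos.
    apply Rmult_le_reg_r with ((1 - y) * y); auto.
    unfold Rdiv. rewrite Rmult_assoc, Rinv_l by lra. rewrite Rmult_1_r.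
    apply Rle_trans with (V * y); [apply Rmult_le_compat_l; [lra|]; nra|].
    apply Rmult_le_compat_l with (r := V) in Hyv; [|lra].
    replace (V * (p * / V)) with p in Hyv by (field; lra). exact Hyv. }
  set (u' := Rmin u tau0). set (v' := Rmax (g (1 - y)) tau0).
  assert (Hu' : 0 < u') by now apply Rmin_glb_lt.
  assert (Hv' : 0 < v') by (apply Rlt_le_trans with tau0; [auto|apply Rmax_r]).
  apply Rle_trans with (RInt G u' v').
  { apply (RInt_le_wider D0oo); auto. apply Rmin_l.
    apply Rle_trans with (g (1 - y)); [auto|apply Rmax_l]. }
  rewrite <- (RInt_Chasles G u' tau0 v') by (apply IG; auto).
  change (RInt G u' tau0 + RInt G tau0 v' <= M0 * tau0 + K * B0).
  assert (Hut : u' <= tau0) by apply Rmin_r.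
  apply Rplus_le_compat.
  - apply Rle_trans with (RInt (fun _ => M0) u' tau0).
    + apply RInt_le; [auto|now apply IG|apply ex_RInt_const|]. intros x Hx. apply Hnear. lra.
    + rewrite (is_RInt_unique _ _ _ _ (is_RInt_const _ _ _)). unfold scal; simpl; unfold mult; simpl.
      rewrite Rmult_comm. apply Rmult_le_compat_l; lra.
  - assert (HKB : 0 <= K * B0).
    { apply Rle_trans with (RInt G tau0 (g (1 / 2))); [|apply Hfar; lra].
      unfold tau0. rewrite RInt_point. apply Rle_refl. }
    unfold v', Rmax. destruct Rle_dec as [h|h].
    + rewrite RInt_point. exact HKB.
    + apply Hfar. lra.
Qed.

(** * Growth of the coefficients *)

Lemma Carg_bound z : Rabs (Carg z) <= PI.
Proof.
  unfold Carg. pose proof (acos_bound (Re z / Cmod z)).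
  destruct Rlt_dec; [rewrite Rabs_Ropp|]; rewrite Rabs_pos_eq; lra.
Qed.

(** From some rank on [|n + a|] exceeds half of [n + 1]; the finitely many earlier values are
    nonzero. *)
Lemma shift_lower_bound (a : C) : (forall n : nat, a <> - RtoC (INR n))%C ->
  exists m, 0 < m /\ forall n, m * (INR n + 1) <= Cmod (RtoC (INR n) + a)%C.
Proof.
  intros Ha.
  assert (Hpos : forall n, 0 < Cmod (RtoC (INR n) + a)%C).
  { intros n. apply Cmod_gt_0. intros h. apply (Ha n).
    replace a with ((RtoC (INR n) + a) - RtoC (INR n))%C by ring. rewrite h. ring. }
  assert (Hfin : forall N, exists m, 0 < m <= 1/2 /\ forall n, (n < N)%nat ->
    m * (INR n + 1) <= Cmod (RtoC (INR n) + a)%C).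
  { induction N as [|N (m & Hm & K)].
    - exists (1/2). split; [lra|]. intros n Hn. lia.
    - pose proof (pos_INR N) as HN.
      set (y := Cmod (RtoC (INR N) + a)%C / (INR N + 1)).
      assert (Hy : 0 < y) by (apply Rdiv_lt_0_compat; [apply Hpos|lra]).
      exists (Rmin m y). split; [split; [apply Rmin_glb_lt; lra|]|].
      + eapply Rle_trans; [apply Rmin_l|lra].
      + intros n Hn. pose proof (pos_INR n). destruct (Nat.eq_dec n N) as [->|h].
        * apply Rle_trans with (y * (INR N + 1)); [apply Rmult_le_compat_r; [lra|apply Rmin_r]|].
          unfold y. apply Req_le. field. lra.
        * apply Rle_trans with (m * (INR n + 1)); [apply Rmult_le_compat_r; [lra|apply Rmin_l]|].
          apply K. lia. }
  destruct (INR_unbounded (2 * Cmod a + 1)) as [N HN].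
  destruct (Hfin N) as (m & Hm & K). exists m. split; [lra|]. intros n.
  destruct (Nat.lt_ge_cases n N) as [h|h]; [auto|]. apply le_INR in h.
  pose proof (pos_INR n).
  assert (Ht : INR n <= Cmod (RtoC (INR n) + a)%C + Cmod a).
  { rewrite <- (Rabs_pos_eq (INR n)) at 1 by auto. rewrite <- Cmod_R.
    replace (RtoC (INR n)) with ((RtoC (INR n) + a) + - a)%C at 1 by ring.
    eapply Rle_trans; [apply Cmod_triangle|]. rewrite Cmod_opp. lra. }
  apply Rle_trans with (1 / 2 * (INR n + 1)); [apply Rmult_le_compat_r; lra|]. lra.
Qed.

Lemma inv_Cpower z s : (/ Cpower z s)%C = Cpower z (- s)%C.
Proof.
  unfold Cpower. replace (- s * Clog z)%C with (- (s * Clog z))%C by ring.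
  pose proof (Cexp_neq_0 (s * Clog z)%C) as H.
  transitivity (Cexp (- (s * Clog z)) * Cexp (s * Clog z) * / Cexp (s * Clog z))%C.
  - rewrite Cexp_opp. ring.
  - field. auto.
Qed.

(** [|(n + a)^(-sigma)| = |n + a|^(- Re sigma) e^(Im sigma arg (n + a))], where the argument is
    bounded by [pi] and [|n + a| / (n + 1)] is bounded from both sides. *)
Lemma coef_bound (g sigma a : C) : (forall n : nat, a <> - RtoC (INR n))%C ->
  exists M, 0 < M /\ forall n, Cmod (cbin g n / Cpower (RtoC (INR n) + a) sigma)%C <=
    M * Rpower (INR n + 1) (Re g - Re sigma - 1).
Proof.
  intros Ha. destruct (cbin_bound g) as (M1 & HM1 & K1).
  destruct (shift_lower_bound a Ha) as (m & Hm & Km).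
  set (L := Rabs (ln m) + Rabs (ln (1 + Cmod a))).
  set (E := exp (Rabs (Re sigma) * L + Rabs (Im sigma) * PI)).
  exists (M1 * E). split; [pos|]. intros n.
  pose proof (pos_INR n) as Hn. specialize (Km n). set (r := Cmod (RtoC (INR n) + a)%C) in *.
  assert (Hmn : 0 < m * (INR n + 1)) by pos.
  assert (Hr : 0 < r) by lra.
  pose proof (Cmod_ge_0 a) as Ha0.
  assert (Hr2 : r <= (1 + Cmod a) * (INR n + 1)).
  { unfold r. eapply Rle_trans; [apply Cmod_triangle|]. rewrite Cmod_R, Rabs_pos_eq by auto. nra. }
  assert (HL : Rabs (ln r - ln (INR n + 1)) <= L).
  { apply ln_le in Km; [|auto]. apply ln_le in Hr2; [|auto].
    rewrite ln_mult in Km, Hr2 by lra.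
    pose proof (Rle_abs (- ln m)) as h1. rewrite Rabs_Ropp in h1.
    pose proof (Rle_abs (ln (1 + Cmod a))) as h2.
    pose proof (Rabs_pos (ln m)). pose proof (Rabs_pos (ln (1 + Cmod a))).
    unfold L. apply Rabs_le. lra. }
  unfold Cdiv. rewrite Cmod_mult, inv_Cpower.
  replace (Re g - Re sigma - 1) with ((Re g - 1) + - Re sigma) by ring. rewrite Rpower_plus.
  replace (M1 * E * (Rpower (INR n + 1) (Re g - 1) * Rpower (INR n + 1) (- Re sigma))) with
    (M1 * Rpower (INR n + 1) (Re g - 1) * (E * Rpower (INR n + 1) (- Re sigma))) by ring.
  apply Rmult_le_compat; [pos|pos|apply K1|].
  unfold Cpower. rewrite Cmod_Cexp. unfold E, Rpower. rewrite <- exp_plus. apply exp_le.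
  assert (HRe : Re (- sigma * Clog (RtoC (INR n) + a))%C =
    - Re sigma * ln r + Im sigma * Carg (RtoC (INR n) + a)%C) by (unfold Clog, r; cring).
  rewrite HRe.
  assert (H1 : - Re sigma * (ln r - ln (INR n + 1)) <= Rabs (Re sigma) * L).
  { eapply Rle_trans; [apply Rle_abs|]. rewrite Rabs_mult, Rabs_Ropp.
    apply Rmult_le_compat_l; [pos|auto]. }
  assert (H2 : Im sigma * Carg (RtoC (INR n) + a)%C <= Rabs (Im sigma) * PI).
  { eapply Rle_trans; [apply Rle_abs|]. rewrite Rabs_mult.
    apply Rmult_le_compat_l; [pos|apply Carg_bound]. }
  lra.
Qed.

(** Comparison with the telescoping series of [(n + 1)^(e + 1)]. *)
Lemma ex_series_Rpower e : e < - 1 -> ex_series (fun n => Rpower (INR n + 1) e).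
Proof.
  intros He. set (d := - e - 1). assert (Hd : 0 < d) by (unfold d; lra).
  set (v := fun n => Rpower (INR n + 1) (- d)).
  assert (Hv : forall n, d * Rpower (INR (S n) + 1) e <= v n - v (S n)).
  { intros n. unfold v. rewrite S_INR. pose proof (pos_INR n).
    set (k := INR n + 1). assert (Hk : 1 <= k) by (unfold k; lra).
    replace (Rpower k (- d)) with (exp (d * (ln (k + 1) - ln k)) * Rpower (k + 1) (- d)).
    2:{ unfold Rpower. rewrite <- exp_plus. f_equal. ring. }
    replace (Rpower (k + 1) e) with (/ (k + 1) * Rpower (k + 1) (- d)).
    2:{ replace e with (- (1) + - d) by (unfold d; ring).
        rewrite Rpower_plus, (Rpower_Ropp _ 1), Rpower_1 by lra. reflexivity. }
    assert (Hl := ln_step k ltac:(lra)).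
    pose proof (exp_ineq1_le (d * (ln (k + 1) - ln k))) as H1.
    assert (d * / (k + 1) <= d * (ln (k + 1) - ln k)) by (apply Rmult_le_compat_l; lra).
    pose proof (Rpower_pos (k + 1) (- d)) as HP.
    assert (d * / (k + 1) * Rpower (k + 1) (- d) <=
      (exp (d * (ln (k + 1) - ln k)) - 1) * Rpower (k + 1) (- d)) by (apply Rmult_le_compat_r; lra).
    lra. }
  assert (Hdec : forall n, v (S n) <= v n).
  { intros n. specialize (Hv n).
    assert (0 < d * Rpower (INR (S n) + 1) e) by pos. lra. }
  destruct (ex_finite_lim_seq_decr v 0) as [lv Hlv]; auto.
  { intros n. unfold v. pos. }
  apply ex_series_incr_1.
  apply (ex_series_Rle _ (fun n => / d * (v n - v (S n)))).
  - intros n. rewrite Rabs_pos_eq by pos.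
    apply Rmult_le_reg_l with d; auto. rewrite <- Rmult_assoc, Rinv_r, Rmult_1_l by lra. apply Hv.
  - apply: ex_series_scal. exists (v O - lv).
    change (is_lim_seq (sum_n (fun n => v n - v (S n))) (v O - lv)).
    apply (is_lim_seq_ext (fun n => v O - v (S n))).
    + induction n as [|n IH]; [now rewrite sum_O|]. rewrite sum_Sn, <- IH. unfold plus; simpl. ring.
    + apply is_lim_seq_minus'; [apply is_lim_seq_const|]. now apply is_lim_seq_incr_1 in Hlv.
Qed.

(** * The substitution [t = x / (1 + x)] *)

Definition phi (x : R) : R := x / (1 + x).
Definition dphi (x : R) : R := / (1 + x) ^ 2.

Lemma phi_D01 x : D0oo x -> D01 (phi x).
Proof.
  unfold D0oo, D01, phi. intros Hx. split; [pos|].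
  apply Rdiv_lt_1; lra.
Qed.

Lemma phi_derive x : D0oo x -> D01 (phi x) /\ is_derive phi x (dphi x) /\ continuous dphi x.
Proof.
  intros Hx. split; [now apply phi_D01|]. unfold D0oo in Hx. unfold phi, dphi. split.
  - auto_derive; [lra|]. field. lra.
  - apply: ex_derive_continuous. auto_derive. apply Rgt_not_eq. nra.
Qed.

Lemma phi_mono x y : 0 < x -> x <= y -> phi x <= phi y.
Proof.
  intros Hx Hxy. unfold phi.
  replace (x / (1 + x)) with (1 - / (1 + x)) by (field; lra).
  replace (y / (1 + y)) with (1 - / (1 + y)) by (field; lra).
  assert (/ (1 + y) <= / (1 + x)) by (apply Rinv_le_contravar; lra). lra.
Qed.

Lemma phi_inv t : D01 t -> 0 < t / (1 - t) /\ phi (t / (1 - t)) = t.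
Proof.
  intros [h1 h2]. split; [pos|]. unfold phi. field. split; lra.
Qed.

Lemma phi_low d : D01 d -> exists e, D0oo e /\ forall x, D0oo x -> x <= e -> phi x <= d.
Proof.
  intros Hd. destruct (phi_inv d Hd) as [H1 H2]. exists (d / (1 - d)). split; auto.
  intros x Hx h. rewrite <- H2. now apply phi_mono.
Qed.

Lemma phi_high d : D01 d -> exists e, D0oo e /\ forall x, D0oo x -> e <= x -> d <= phi x.
Proof.
  intros Hd. destruct (phi_inv d Hd) as [H1 H2]. exists (d / (1 - d)). split; auto.
  intros x Hx h. rewrite <- H2. now apply phi_mono.
Qed.

Section Weight.

Variables (p lambda : R) (theta upsilon : C).
Hypothesis hlambda : 0 < lambda.

Definition weight01 (t : R) : C :=
  (rpow t (theta - 1) * rpow (1 - t) (upsilon - theta - 1) *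
   RtoC (ml lambda (- (p / (t * (1 - t))))))%C.

Definition weight0oo (x : R) : C :=
  (Cpower (RtoC x) (theta - 1) / Cpower (RtoC (1 + x)) upsilon
  * mittag_leffler lambda (RtoC (- (p * (2 + x + 1 / x)))))%C.

Lemma Ccont_comp (f : R -> C) (g : R -> R) t : Ccont f (g t) -> continuous g t ->
  Ccont (fun x => f (g x)) t.
Proof.
  intros [H1 H2] Hg. split.
  - exact (continuous_comp g (fun y => Re (f y)) t Hg H1).
  - exact (continuous_comp g (fun y => Im (f y)) t Hg H2).
Qed.

Lemma Ccont_weight01 : Ccont_on D01 weight01.
Proof.
  intros t Ht. assert (h : 0 < t * (1 - t)) by (destruct Ht; pos).
  apply Ccont_mult; [apply Ccont_mult|].
  - apply Ccont_rpow, Ht.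
  - apply (Ccont_comp (fun y => rpow y (upsilon - theta - 1)) (fun t => 1 - t)).
    + apply Ccont_rpow. destruct Ht; lra.
    + apply: ex_derive_continuous. auto_derive; auto.
  - apply Ccont_RtoC. apply: continuous_comp; [|now apply continuous_ml].
    apply: ex_derive_continuous. auto_derive. lra.
Qed.

Lemma weight_subst x : 0 < x -> (RtoC (dphi x) * weight01 (phi x))%C = weight0oo x.
Proof.
  intros Hx. unfold weight01, weight0oo.
  rewrite mittag_leffler_R, 2!Cpower_pos by (auto; lra).
  assert (H1 : phi x * (1 - phi x) = x / (1 + x) ^ 2) by (unfold phi; field; lra).
  assert (H2 : p / (x / (1 + x) ^ 2) = p * (2 + x + 1 / x)) by (field; lra).
  rewrite H1, H2. rewrite Cmult_assoc. f_equal.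
  assert (Hinv : 0 < / (1 + x)) by pos.
  replace (phi x) with (x * / (1 + x)) by reflexivity.
  replace (1 - x * / (1 + x)) with (/ (1 + x)) by (field; lra).
  rewrite rpow_mult by auto.
  replace (RtoC (dphi x)) with (rpow (/ (1 + x)) (RtoC 2)).
  2:{ rewrite rpow_R. f_equal. unfold dphi. replace 2 with (INR 2) by (simpl; ring).
      rewrite Rpower_pow, pow_inv; auto. }
  replace (rpow (/ (1 + x)) 2 * (rpow x (theta - 1) * rpow (/ (1 + x)) (theta - 1) *
     rpow (/ (1 + x)) (upsilon - theta - 1)))%C with
     (rpow x (theta - 1) * (rpow (/ (1 + x)) 2 * rpow (/ (1 + x)) (theta - 1) *
     rpow (/ (1 + x)) (upsilon - theta - 1)))%C by ring.
  unfold Cdiv. f_equal. rewrite <- 2!rpow_plus.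
  replace (RtoC 2 + (theta - 1) + (upsilon - theta - 1))%C with upsilon by ring.
  pose proof (rpow_neq_0 (1 + x) upsilon) as Hne.
  rewrite rpow_inv by lra.
  transitivity (rpow (1 + x) (- upsilon) * rpow (1 + x) upsilon * / rpow (1 + x) upsilon)%C.
  - field. auto.
  - rewrite rpow_opp. ring.
Qed.

Lemma ext_beta_integrand_weight n t : D01 t ->
  (RtoC (t ^ n) * weight01 t)%C =
  ext_beta_integrand (theta + RtoC (INR n)) (upsilon - theta) p lambda t.
Proof.
  intros [h1 h2]. unfold ext_beta_integrand, weight01.
  rewrite mittag_leffler_R, 2!Cpower_pos by lra.
  replace (theta + RtoC (INR n) - 1)%C with ((theta - 1) + RtoC (INR n))%C by ring.
  rewrite rpow_plus, rpow_nat by auto. ring.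
Qed.

Hypothesis hB : forall n : nat,
  abs_CInt01 (ext_beta_integrand (theta + RtoC (INR n)) (upsilon - theta) p lambda).

Lemma Ccont_on_powweight n : Ccont_on D01 (fun t => (RtoC (t ^ n) * weight01 t)%C).
Proof.
  intros t Ht. apply Ccont_mult; [|now apply Ccont_weight01].
  apply Ccont_RtoC. apply: ex_derive_continuous. auto_derive; auto.
Qed.

Lemma ibound_weight01 n : exists B, ibound D01 (fun t => Cmod (RtoC (t ^ n) * weight01 t)%C) B.
Proof.
  assert (HD := interval_D01). destruct (hB n) as [l Hl].
  assert (If : locint D01 (fun t => Cmod (RtoC (t ^ n) * weight01 t)%C)).
  { apply Ccont_on_Cmod; auto. apply Ccont_on_powweight. }
  set (h := fun t => Cmod (ext_beta_integrand (theta + RtoC (INR n)) (upsilon - theta) p lambda t)) in Hl.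
  assert (He : forall t, D01 t -> Cmod (RtoC (t ^ n) * weight01 t)%C = h t).
  { intros t Ht. unfold h. now rewrite ext_beta_integrand_weight. }
  assert (Ih : locint D01 h) by (apply (locint_ext D01 _ h HD He If)).
  apply (improper_gen01 h l Ih) in Hl.
  exists l. apply improper_ge; auto; [intros; pos|].
  apply (improper_ext D01 h); auto. intros t Ht. symmetry. auto.
Qed.

Lemma ext_beta_improper n : Cimproper D01 (fun t => (RtoC (t ^ n) * weight01 t)%C)
  (ext_beta (theta + RtoC (INR n)) (upsilon - theta) p lambda).
Proof.
  assert (HD := interval_D01). destruct (ibound_weight01 n) as [B HB].
  destruct (Cimproper_abs D01 (fun t => (RtoC (t ^ n) * weight01 t)%C)
    (fun t => Cmod (RtoC (t ^ n) * weight01 t)%C) B) as (l & Hl & _); auto.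
  - apply Ccont_on_powweight.
  - apply Ccont_on_Cmod; auto. apply Ccont_on_powweight.
  - intros; apply Rle_refl.
  - replace (ext_beta (theta + RtoC (INR n)) (upsilon - theta) p lambda) with l; auto.
    symmetry. unfold ext_beta.
    assert (Ce : Ccont_on D01 (ext_beta_integrand (theta + RtoC (INR n)) (upsilon - theta) p lambda)).
    { apply (Ccont_on_ext D01 (fun t => (RtoC (t ^ n) * weight01 t)%C)).
      - apply open_D01. - apply ext_beta_integrand_weight. - apply Ccont_on_powweight. }
    apply Cimproper_CInt01.
    + now apply Ccont_on_Re.
    + now apply Ccont_on_Im.
    + apply (Cimproper_ext D01 _ _ l HD (ext_beta_integrand_weight n) Hl).
Qed.

Lemma Cmod_weight01 t : Cmod (weight01 t) = Rpower t (Re theta - 1) *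
  Rpower (1 - t) (Re upsilon - Re theta - 1) * Rabs (ml lambda (- (p / (t * (1 - t))))).
Proof.
  unfold weight01. rewrite 2!Cmod_mult, 2!Cmod_rpow, Cmod_R. reflexivity.
Qed.

(** On a compact subinterval of (0, oo) the series is dominated geometrically, as [phi] stays
    below 1 there; the bounds [B] serve as the summable majorant towards the ends. *)
Lemma weighted_series (c : nat -> C) (B : nat -> R) :
  (forall r, 0 <= r < 1 -> ex_series (fun n => Cmod (c n) * r ^ n)) ->
  (forall n, ibound D01 (fun t => t ^ n * Cmod (weight01 t)) (B n)) ->
  ex_series (fun n => Cmod (c n) * B n) ->
  let l := fun n => (c n * ext_beta (theta + RtoC (INR n)) (upsilon - theta) p lambda)%C in
  is_Cseries l (CSeries l) /\
  forall F : R -> C,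
    (forall x, 0 < x -> F x = (weight0oo x * CSeries (fun n => (c n * RtoC (phi x ^ n))%C))%C) ->
    CInt0oo F = CSeries l.
Proof.
  intros Hc HB HcB l. assert (HD := interval_D0oo). assert (HD1 := interval_D01).
  set (W := fun x => (RtoC (dphi x) * weight01 (phi x))%C).
  assert (CW : forall n, Ccont_on D0oo (fun x => (RtoC (dphi x) * (RtoC (phi x ^ n) * weight01 (phi x)))%C)).
  { intros n x Hx. destruct (phi_derive x Hx) as (h1 & h2 & h3). apply Ccont_mult.
    - now apply Ccont_RtoC.
    - apply (Ccont_comp (fun t => (RtoC (t ^ n) * weight01 t)%C)); [now apply Ccont_on_powweight|].
      apply: ex_derive_continuous. eexists. exact h2. }
  assert (Hphi : forall x, D0oo x -> 0 < phi x < 1) by (intros x Hx; exact (phi_D01 x Hx)).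
  assert (Hdphi : forall x, D0oo x -> 0 <= dphi x).
  { intros x Hx. unfold D0oo in Hx. unfold dphi. pos. }
  set (f := fun n x => (c n * (RtoC (dphi x) * (RtoC (phi x ^ n) * weight01 (phi x))))%C).
  set (k := fun n x => dphi x * (phi x ^ n * Cmod (weight01 (phi x)))).
  assert (Hfk : forall n x, D0oo x -> Cmod (f n x) = Cmod (c n) * k n x).
  { intros n x Hx. unfold f, k. rewrite 3!Cmod_mult, 2!Cmod_R.
    rewrite (Rabs_pos_eq (dphi x)) by auto. rewrite Rabs_pos_eq; [reflexivity|].
    apply pow_le, Rlt_le, Hphi, Hx. }
  assert (Ck01 : forall n t, D01 t -> continuous (fun t => t ^ n * Cmod (weight01 t)) t).
  { intros n t Ht. apply Rcont_mult; [|apply Ccont_Cmod, Ccont_weight01, Ht].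
    apply: ex_derive_continuous. auto_derive; auto. }
  assert (Ck : forall n x, D0oo x -> continuous (k n) x).
  { intros n x Hx. destruct (phi_derive x Hx) as (h1 & h2 & h3). apply Rcont_mult; auto.
    apply (continuous_comp phi (fun t => t ^ n * Cmod (weight01 t))); [|now apply Ck01].
    apply: ex_derive_continuous. eexists. exact h2. }
  assert (Ik : forall n, locint D0oo (k n)) by (intros n; apply locint_continuous; auto).
  destruct (Cimproper_series D0oo f (fun n x => Cmod (c n) * k n x) (fun n => Cmod (c n) * B n) l)
    as (A1 & A2 & A3 & A4); auto.
  - intros n x Hx. apply Ccont_mult; [apply Ccont_const|]. now apply CW.
  - intros n. now apply locint_scal.
  - intros n x Hx. rewrite Hfk by auto. apply Rle_refl.
  - intros u v Hu Hv Huv. unfold D0oo in Hu, Hv.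
    destruct (continuity_ab_maj (k O) u v Huv) as (xm & Hxm & _).
    { intros y Hy. apply continuity_pt_filterlim. apply Ck. unfold D0oo. lra. }
    set (K := k O xm) in *.
    exists (fun n => K * (Cmod (c n) * phi v ^ n)). split.
    + apply: ex_series_scal. apply Hc. pose proof (Hphi v Hv). lra.
    + intros n t Ht. assert (HtD : D0oo t) by (unfold D0oo; lra).
      rewrite Hfk by auto. pose proof (Hphi t HtD) as Hpt.
      assert (Hk0 : k n t = k O t * phi t ^ n) by (unfold k; simpl; ring).
      rewrite Hk0. pose proof (Cmod_ge_0 (c n)) as Hc0.
      assert (Hk00 : 0 <= k O t).
      { unfold k. apply Rmult_le_pos; auto. simpl pow. pos. }
      assert (Hp : phi t ^ n <= phi v ^ n).
      { apply pow_incr. split; [lra|]. apply phi_mono; lra. }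
      assert (Hp0 : 0 <= phi t ^ n) by pos.
      replace (K * (Cmod (c n) * phi v ^ n)) with (Cmod (c n) * (K * phi v ^ n)) by ring.
      apply Rmult_le_compat_l; auto. now apply Rmult_le_compat; auto.
  - intros n. apply ibound_scal; auto; [pos|].
    unfold k. apply (ibound_subst D01 D0oo (fun t => t ^ n * Cmod (weight01 t)) phi dphi); auto.
    + apply phi_derive.
    + intros x y Hx Hy Hxy. now apply phi_mono.
  - intros n. apply Cimproper_scal; auto.
    apply (Cimproper_subst D01 D0oo (fun t => (RtoC (t ^ n) * weight01 t)%C) phi dphi); auto.
    + apply Ccont_on_powweight.
    + apply phi_derive.
    + apply phi_low.
    + apply phi_high.
    + apply ext_beta_improper.
  - split; auto. intros F HF.
    assert (HE : forall x, D0oo x -> CSeries (fun n => f n x) = F x).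
    { intros x Hx. rewrite HF by auto. apply is_Cseries_unique.
      rewrite <- weight_subst by auto.
      assert (Hs : is_Cseries (fun n => (c n * RtoC (phi x ^ n))%C)
         (CSeries (fun n => (c n * RtoC (phi x ^ n))%C))).
      { apply (Cseries_abs _ (fun n => Cmod (c n) * phi x ^ n)).
        - intros n. rewrite Cmod_mult, Cmod_R, Rabs_pos_eq; [apply Rle_refl|].
          apply pow_le, Rlt_le, Hphi, Hx.
        - apply Hc. pose proof (Hphi x Hx). lra. }
      eapply is_Cseries_ext; [|apply (is_Cseries_scal (RtoC (dphi x) * weight01 (phi x))%C _ _ Hs)].
      intros n. unfold f. cbv beta. ring. }
    apply Cimproper_CInt0oo.
    + apply (locint_ext D0oo (fun t => Re (CSeries (fun n => f n t)))); auto.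
      intros t Ht. now rewrite HE.
    + apply (locint_ext D0oo (fun t => Im (CSeries (fun n => f n t)))); auto.
      intros t Ht. now rewrite HE.
    + apply (Cimproper_ext D0oo (fun t => CSeries (fun n => f n t))); auto.
Qed.

(** The argument is constant for [p = 0], and the relaxation bound applies for [lambda <= 2]; for
    [lambda > 2] the assumed convergence of the beta integrals is contradictory. *)
Lemma ml_kernel_bounded : 0 <= p ->
  exists M, forall t, D01 t -> Rabs (ml lambda (- (p / (t * (1 - t))))) <= M.
Proof.
  intros Hp. destruct (Req_dec p 0) as [->|Hp0].
  { exists (Rabs (ml lambda 0)). intros t Ht.
    replace (- (0 / (t * (1 - t)))) with 0 by (unfold Rdiv; ring). apply Rle_refl. }
  destruct (Rle_dec lambda 2) as [Hl|Hl].
  - exists 1. intros t [h1 h2]. apply ml_bound; [lra|].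
    apply Rlt_le, Rdiv_lt_0_compat; [lra|]. pos.
  - exfalso. apply (ml_not_laplace lambda); [lra|].
    destruct (ibound_weight01 0) as [B HBd].
    apply (laplace_of_beta p lambda (Re theta) (Re upsilon - Re theta) B); [lra|auto|].
    intros a b Ha Hb Hab. rewrite <- (RInt_ext_on D01 (fun t => Cmod (RtoC (t ^ 0) * weight01 t)%C)); auto.
    + apply interval_D01.
    + intros t Ht. rewrite Cmod_mult, Cmod_R, Cmod_weight01. simpl. rewrite Rabs_R1. ring.
Qed.

Lemma ibound_Rpower01 s : 0 < s -> ibound D01 (fun t => Rpower t (s - 1)) (/ s).
Proof.
  intros Hs. replace (/ s) with (/ s - 0) by ring.
  assert (HC : forall t, D01 t -> continuous (fun t => Rpower t (s - 1)) t).
  { intros t Ht. apply continuous_Rpower, Ht. }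
  apply (ibound_derive D01 (fun t => / s * Rpower t s) _ (fun t => Rpower t (s - 1))).
  - apply interval_D01.
  - apply locint_continuous; [apply interval_D01|auto].
  - intros t Ht. split; auto. destruct Ht as [h1 h2]. unfold Rpower. auto_derive; auto.
    replace ((s - 1) * ln t) with (s * ln t - ln t) by ring.
    unfold Rminus. rewrite exp_plus, exp_Ropp, exp_ln by auto. field. split; lra.
  - intros; apply Rle_refl.
  - intros t [h1 h2]. pose proof (Rinv_0_lt_compat s Hs). pose proof (Rpower_pos t s).
    assert (Rpower t s <= 1).
    { apply exp_le_1.
      assert (ln t <= 0) by (rewrite <- ln_1; apply ln_le; lra). nra. }
    split; [pos|]. rewrite <- (Rmult_1_r (/ s)) at 2.
    apply Rmult_le_compat_l; lra.
Qed.

(** Let [b = Re (upsilon - theta)]. The factor [t^n (1 - t)^(b - 1)] is [O(n^(1-b))] uniformly in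
    [t], because [t^n <= e^(- n (1 - t))], and [t^(Re theta - 1)] remains to be integrated. One
    power of [n] is lost in this way, which is what the condition
    [Re (sigma + upsilon - gamma - theta) > 1] allows for. *)
Lemma weight_decay : 0 <= p -> 0 < Re theta -> exists M, forall n,
  ibound D01 (fun t => t ^ n * Cmod (weight01 t))
    (M * Rpower (INR n + 1) (- Rmax 0 (Re upsilon - Re theta - 1))).
Proof.
  intros Hp Hth. assert (HD := interval_D01).
  set (be := Re upsilon - Re theta - 1).
  assert (CW : forall n t, D01 t -> continuous (fun t => t ^ n * Cmod (weight01 t)) t).
  { intros n t Ht. apply Rcont_mult; [|apply Ccont_Cmod, Ccont_weight01, Ht].
    apply: ex_derive_continuous. auto_derive; auto. }
  assert (IW : forall n, locint D01 (fun t => t ^ n * Cmod (weight01 t)))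
    by (intros n; apply locint_continuous; auto).
  destruct (Rle_dec 0 be) as [Hbe|Hbe].
  - rewrite Rmax_right by auto.
    destruct (ml_kernel_bounded Hp) as [M1 HM1].
    destruct (Rpower_exp_bound be 1 Hbe) as (M2 & HM2 & K2); [lra|].
    exists (M1 * (M2 * exp 1) * / Re theta). intros n. pose proof (pos_INR n) as Hn.
    set (Q := Rpower (INR n + 1) (- be)). assert (HQ : 0 < Q) by pos.
    replace (M1 * (M2 * exp 1) * / Re theta * Q) with (M1 * (M2 * exp 1) * Q * / Re theta) by ring.
    assert (HM1p : 0 <= M1).
    { apply Rle_trans with (2 := HM1 (1/2) ltac:(unfold D01; lra)). pos. }
    assert (HCp : 0 <= M1 * (M2 * exp 1) * Q).
    { pos. }
    assert (IR : locint D01 (fun t => Rpower t (Re theta - 1))).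
    { apply locint_continuous; auto. intros t Ht. apply continuous_Rpower, Ht. }
    apply (ibound_le D01 _ (fun t => M1 * (M2 * exp 1) * Q * Rpower t (Re theta - 1))); auto.
    + now apply locint_scal.
    + intros t Ht. rewrite Cmod_weight01. fold be. specialize (HM1 t Ht). destruct Ht as [h1 h2].
      assert (Hkey : t ^ n * Rpower (1 - t) be <= M2 * exp 1 * Q).
      { set (y := (INR n + 1) * (1 - t)). assert (Hy : 0 < y) by pos.
        specialize (K2 y Hy).
        assert (Hpow : t ^ n <= exp 1 * exp (- (1 * y))).
        { rewrite <- Rpower_pow by auto. unfold Rpower. rewrite <- exp_plus. apply exp_le.
          pose proof (ln_le_pred t h1) as Hlt.
          assert (INR n * ln t <= INR n * (t - 1)) by (apply Rmult_le_compat_l; auto).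
          unfold y. lra. }
        replace (Rpower (1 - t) be) with (Rpower y be * Q).
        2:{ unfold y, Q. rewrite <- Rpower_mult_distr by lra. rewrite Rpower_Ropp. field.
            apply Rgt_not_eq, Rpower_pos. }
        apply Rle_trans with (exp 1 * exp (- (1 * y)) * (Rpower y be * Q)).
        - apply Rmult_le_compat_r; auto. pos.
        - replace (exp 1 * exp (- (1 * y)) * (Rpower y be * Q)) with
            ((Rpower y be * exp (- (1 * y))) * (exp 1 * Q)) by ring.
          replace (M2 * exp 1 * Q) with (M2 * (exp 1 * Q)) by ring.
          apply Rmult_le_compat_r; auto. pos. }
      replace (t ^ n * (Rpower t (Re theta - 1) * Rpower (1 - t) be *
        Rabs (ml lambda (- (p / (t * (1 - t))))))) with
        ((t ^ n * Rpower (1 - t) be) * Rabs (ml lambda (- (p / (t * (1 - t))))) * Rpower t (Re theta - 1))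
        by ring.
      apply Rmult_le_compat_r; [pos|].
      replace (M1 * (M2 * exp 1) * Q) with ((M2 * exp 1 * Q) * M1) by ring.
      apply Rmult_le_compat; auto; [|pos].
      pos.
    + apply ibound_scal; auto. now apply ibound_Rpower01.
  - rewrite Rmax_left by lra. destruct (ibound_weight01 0) as [B HBd].
    exists B. intros n. rewrite Ropp_0, Rpower_O, Rmult_1_r by (pose proof (pos_INR n); lra).
    apply (ibound_le D01 _ (fun t => Cmod (RtoC (t ^ 0) * weight01 t)%C)); auto.
    + apply Ccont_on_Cmod; auto. apply Ccont_on_powweight.
    + intros t [h1 h2]. rewrite Cmod_mult, Cmod_R. simpl. rewrite Rabs_R1.
      apply Rmult_le_compat_r; [pos|]. rewrite <- (pow1 n). apply pow_incr. lra.
Qed.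

End Weight.

(** * The Goyal-Laddha series as a Laplace integral *)

(** Expand the power of [1 - z e^(-t)] in a binomial series: [e^(-nt)] moves the scale of the Gamma
    kernel from [a] to [n + a], and the [n]-th integral is [Gamma(sigma) (n + a)^(-sigma)]. Since
    [e^(-nt) <= 1], one integrable majorant serves all the terms. The constant [w] stands for the
    factors of the double integrand that depend on [x] alone. *)
Lemma goyal_laddha_integral g z sigma a : 0 < Re sigma -> 0 < Re a -> Cmod z < 1 ->
  forall (w : C) (F : R -> C),
  (forall t, 0 < t -> F t = (w * (gamma_kernel sigma a t * Cpower (1 - z * RtoC (exp (- t))) (- g)))%C) ->
  CInt0oo F = (w * (CGamma sigma * goyal_laddha g z sigma a))%C.
Proof.
  intros Hs Ha Hz w F HF. assert (HD := interval_D0oo).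
  destruct (ibound_gamma (Re sigma) (Re a) Hs Ha) as [B HB].
  set (b := fun n => (w * (cbin g n * z ^ n))%C).
  set (xi := fun n => (RtoC (INR n) + a)%C).
  assert (Hxi : forall n, 0 < Re (xi n)).
  { intros n. change (0 < INR n + Re a). pose proof (pos_INR n). lra. }
  assert (Hb : forall n, Cmod (b n) = Cmod w * (Cmod (cbin g n) * Cmod z ^ n)).
  { intros n. unfold b. now rewrite 2!Cmod_mult, Cmod_pow. }
  assert (Hbs : ex_series (fun n => Cmod (b n))).
  { apply (ex_series_ext (fun n => Cmod w * (Cmod (cbin g n) * Cmod z ^ n))); [auto|].
    apply: ex_series_scal. apply ex_series_cbin. split; [pos|auto]. }
  set (f := fun n t => (b n * gamma_kernel sigma (xi n) t)%C).
  set (l := fun n => (b n * (CGamma sigma * Cpower (xi n) (- sigma)))%C).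
  set (k := fun t => Rpower t (Re sigma - 1) * exp (- (Re a * t))).
  assert (Hfk : forall n t, D0oo t -> Cmod (f n t) <= Cmod (b n) * k t).
  { intros n t Ht. unfold f, k. rewrite Cmod_mult, Cmod_gamma_kernel.
    apply Rmult_le_compat_l; [pos|].
    apply Rmult_le_compat_l; [pos|]. apply exp_le.
    change (Re (xi n)) with (INR n + Re a).
    assert (0 <= INR n * t) by pos. lra. }
  destruct (Cimproper_series D0oo f (fun n t => Cmod (b n) * k t) (fun n => Cmod (b n) * B) l)
    as (A1 & A2 & A3 & A4); auto.
  - intros n t Ht. apply Ccont_mult; [apply Ccont_const|now apply Ccont_gamma_kernel].
  - intros n. apply locint_scal, locint_gamma.
  - intros u v Hu Hv Huv. unfold D0oo in Hu, Hv.
    exists (fun n => (Rpower u (Re sigma - 1) + Rpower v (Re sigma - 1)) * Cmod (b n)).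
    split; [now apply: ex_series_scal|]. intros n t Ht.
    eapply Rle_trans; [apply Hfk; unfold D0oo; lra|]. rewrite Rmult_comm.
    apply Rmult_le_compat_r; [pos|]. unfold k.
    apply Rle_trans with (Rpower t (Re sigma - 1) * 1).
    + apply Rmult_le_compat_l; [pos|]. apply exp_le_1.
      assert (0 < Re a * t) by pos. lra.
    + rewrite Rmult_1_r. apply Rpower_segment; lra.
  - intros n. apply ibound_scal; auto; [apply locint_gamma|pos].
  - apply (ex_series_ext (fun n => B * Cmod (b n))).
    { intros n. rring. }
    now apply: ex_series_scal.
  - intros n. apply Cimproper_scal; auto; [apply Ccont_gamma_kernel|now apply gamma_scaled].
  - assert (HE : forall t, D0oo t -> CSeries (fun n => f n t) = F t).
    { intros t Ht. rewrite HF by auto. apply is_Cseries_unique.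
      assert (Hzt : Cmod (z * RtoC (exp (- t)))%C < 1).
      { rewrite Cmod_mult, Cmod_R, Rabs_pos_eq by pos.
        assert (exp (- t) <= 1) by (apply exp_le_1; unfold D0oo in Ht; lra).
        apply Rle_lt_trans with (Cmod z * 1); [|lra].
        apply Rmult_le_compat_l; [pos|auto]. }
      rewrite Cmult_assoc.
      eapply is_Cseries_ext; [|apply (is_Cseries_scal (w * gamma_kernel sigma a t)%C _ _
        (is_Cseries_binomial g _ Hzt))].
      intros n. cbv beta. unfold f, b, xi, gamma_kernel. rewrite Cpow_mult_l, <- RtoC_pow.
      replace (exp (- t) ^ n) with (exp (- (INR n * t))).
      2:{ rewrite exp_pow. f_equal. ring. }
      replace (- ((RtoC (INR n) + a) * RtoC t))%C with (RtoC (- (INR n * t)) + - (a * RtoC t))%C.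
      - rewrite Cexp_plus, Cexp_RtoC. ring.
      - rewrite RtoC_opp, RtoC_mult. ring. }
    transitivity (CSeries l).
    + apply Cimproper_CInt0oo.
      * apply (locint_ext D0oo (fun t => Re (CSeries (fun n => f n t)))); auto.
        intros t Ht. now rewrite HE.
      * apply (locint_ext D0oo (fun t => Im (CSeries (fun n => f n t)))); auto.
        intros t Ht. now rewrite HE.
      * apply (Cimproper_ext D0oo (fun t => CSeries (fun n => f n t))); auto.
      (* The Mittag-Leffler kernel inside [w] may vanish, so [w] cannot always be divided out. *)
    + destruct (Ceq_dec w 0) as [Hw|Hw].
      { rewrite Hw, Cmult_0_l. apply is_Cseries_unique.
        apply (is_Cseries_ext (fun n => (0 * l n)%C)).
        - intros n. unfold l, b. rewrite Hw. ring.
        - pose proof (is_Cseries_scal 0 _ _ A1) as H0. rewrite Cmult_0_l in H0. exact H0. }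
      pose proof (CGamma_neq_0 sigma Hs) as HG.
      replace (goyal_laddha g z sigma a) with (/ w * / CGamma sigma * CSeries l)%C; [field; auto|].
      symmetry. apply is_Cseries_unique.
      eapply is_Cseries_ext; [|apply (is_Cseries_scal (/ w * / CGamma sigma)%C _ _ A1)].
      intros n. cbv beta. unfold l, b. rewrite <- inv_Cpower. unfold Cdiv. fold (xi n).
      change (pochhammer g n * / RtoC (INR (fact n)))%C with (cbin g n). field.
      split; [|split]; auto. unfold Cpower. apply Cexp_neq_0.
Qed.

Lemma Cinv_0 : (/ 0)%C = 0.
Proof. apply C_ext; unfold Cinv, RtoC; simpl; unfold Rdiv; ring. Qed.

(** As [/ 0 = 0], zero factors are covered, and the normalising factor [1 / B] can be taken out of
    the sum whatever its value. *)
Lemma Cinv_mult_total (x y : C) : (/ (x * y) = / x * / y)%C.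
Proof.
  destruct (Ceq_dec x 0) as [->|Hx]; [rewrite Cmult_0_l, Cinv_0; ring|].
  destruct (Ceq_dec y 0) as [->|Hy]; [rewrite Cmult_0_r, Cinv_0; ring|].
  field. auto.
Qed.

Open Scope C_scope.

Theorem theorem3p2 (p lambda : R) (gamma theta upsilon sigma z a : C)
    (hp : (0 <= p)%R) (hlambda : (0 < lambda)%R)
    (ha : forall n : nat, a <> - RtoC (INR n))
    (hupsilon : (Re theta < Re upsilon)%R) (htheta : (0 < Re theta)%R)
    (hz : (Cmod z < 1)%R \/
          (Cmod z = 1 /\ (1 < Re (sigma + upsilon - gamma - theta)%C)%R))
    (hB : forall n : nat,
        abs_CInt01
          (ext_beta_integrand (theta + RtoC (INR n)) (upsilon - theta) p lambda)) :
  (ex_CInt0oo (single_integrand gamma theta upsilon z sigma a p lambda) ->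
   ext_hurwitz_lerch gamma theta upsilon z sigma a p lambda =
     1 / CBeta theta (upsilon - theta)
     * CInt0oo (single_integrand gamma theta upsilon z sigma a p lambda))
  /\
  ((0 < Rmin (Re sigma) (Re a))%R ->
   (forall x : R, (0 < x)%R ->
      ex_CInt0oo (double_integrand gamma theta upsilon z sigma a p lambda x)) ->
   ex_CInt0oo (fun x =>
      CInt0oo (double_integrand gamma theta upsilon z sigma a p lambda x)) ->
   ext_hurwitz_lerch gamma theta upsilon z sigma a p lambda =
     1 / (CGamma sigma * CBeta theta (upsilon - theta))
     * CInt0oo (fun x =>
         CInt0oo (double_integrand gamma theta upsilon z sigma a p lambda x))).
Proof.
  (* [c n * t ^ n] is the term of the Goyal-Laddha series at [z t]. *)
  set (c := fun n => (cbin gamma n / Cpower (RtoC (INR n) + a) sigma * z ^ n)%C).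
  assert (Hz1 : (Cmod z <= 1)%R) by lra. pose proof (Cmod_ge_0 z) as Hz0.
  destruct (coef_bound gamma sigma a ha) as (M1 & HM1 & K1).
  destruct (weight_decay p lambda theta upsilon hlambda hB hp htheta) as (M2 & K2).
  set (kap := (Re gamma - Re sigma - 1)%R) in *.
  set (mu := Rmax 0 (Re upsilon - Re theta - 1)) in *.
  assert (Hcn : forall n, (Cmod (c n) <= M1 * Rpower (INR n + 1) kap * Cmod z ^ n)%R).
  { intros n. unfold c. rewrite Cmod_mult, Cmod_pow. apply Rmult_le_compat_r; [pos|apply K1]. }
  assert (Hc : forall r, (0 <= r < 1)%R -> ex_series (fun n => (Cmod (c n) * r ^ n)%R)).
  { intros r Hr. apply (ex_series_Rle _ (fun n => (M1 * (Rpower (INR n + 1) kap * r ^ n))%R)).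
    - intros n. assert (Hrn : (0 <= r ^ n)%R) by pos.
      rewrite Rabs_pos_eq by pos.
      rewrite <- Rmult_assoc. apply Rmult_le_compat_r; auto.
      eapply Rle_trans; [apply Hcn|]. rewrite <- (Rmult_1_r (_ * Rpower _ _)) at 2.
      apply Rmult_le_compat_l; [pos|].
      rewrite <- (pow1 n). apply pow_incr. lra.
    - apply: ex_series_scal. now apply ex_series_pow_geom. }
  set (B := fun n => (Rabs M2 * Rpower (INR n + 1) (- mu))%R).
  assert (HB' : forall n, ibound D01 (fun t => (t ^ n * Cmod (weight01 p lambda theta upsilon t))%R) (B n)).
  { intros n u v Hu Hv Huv. eapply Rle_trans; [now apply K2|].
    apply Rmult_le_compat_r; [pos|apply Rle_abs]. }
  (* On the unit circle [kap - mu <= Re (gamma + theta - sigma - upsilon)], which is below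
     -1. *)
  assert (HcB : ex_series (fun n => (Cmod (c n) * B n)%R)).
  { apply (ex_series_Rle _ (fun n => (M1 * Rabs M2 * (Rpower (INR n + 1) (kap - mu) * Cmod z ^ n))%R)).
    - intros n. assert (HBn : (0 <= B n)%R) by (unfold B; pos).
      rewrite Rabs_pos_eq by pos.
      eapply Rle_trans; [apply Rmult_le_compat_r; [auto|apply Hcn]|].
      unfold B. unfold Rminus. rewrite Rpower_plus. apply Req_le. ring.
    - apply: ex_series_scal. destruct hz as [hz|[hz hRe]].
      + apply ex_series_pow_geom. lra.
      + apply (ex_series_ext (fun n => Rpower (INR n + 1) (kap - mu))).
        { intros n. rewrite hz, pow1, Rmult_1_r. reflexivity. }
        apply ex_series_Rpower.
        change (1 < Re sigma + Re upsilon + - Re gamma + - Re theta)%R in hRe.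
        pose proof (Rmax_r 0 (Re upsilon - Re theta - 1)) as Hmu. fold mu in Hmu. unfold kap. lra. }
  set (l := fun n => c n * ext_beta (theta + RtoC (INR n)) (upsilon - theta) p lambda).
  destruct (weighted_series p lambda theta upsilon hlambda hB c B Hc HB' HcB) as [HS HI].
  fold l in HS, HI.
  assert (HL : ext_hurwitz_lerch gamma theta upsilon z sigma a p lambda =
     / CBeta theta (upsilon - theta) * CSeries l).
  { apply is_Cseries_unique.
    eapply is_Cseries_ext; [|apply (is_Cseries_scal (/ CBeta theta (upsilon - theta)) _ _ HS)].
    intros n. cbv beta. unfold l, c, cbin, Cdiv. rewrite Cinv_mult_total. ring. }
  assert (Hw : forall x, (0 < x)%R -> z * RtoC x / RtoC (1 + x) = z * RtoC (phi x)).
  { intros x Hx. unfold phi. rewrite RtoC_div by lra. unfold Cdiv. ring. }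
  assert (HG : forall x, (0 < x)%R -> goyal_laddha gamma (z * RtoC (phi x)) sigma a =
     CSeries (fun n => c n * RtoC (phi x ^ n))).
  { intros x Hx. apply CSeries_ext. intros n. unfold c. fold (cbin gamma n).
    rewrite Cpow_mult_l, <- RtoC_pow. unfold Cdiv. ring. }
  split.
  - intros _. rewrite HL, (HI (single_integrand gamma theta upsilon z sigma a p lambda)).
    + unfold Cdiv. ring.
    + intros x Hx. unfold single_integrand. rewrite Hw, HG by auto. reflexivity.
  - intros Hmin _ _.
    assert (Hs : (0 < Re sigma)%R) by (eapply Rlt_le_trans; [apply Hmin|apply Rmin_l]).
    assert (Hra : (0 < Re a)%R) by (eapply Rlt_le_trans; [apply Hmin|apply Rmin_r]).
    pose proof (CGamma_neq_0 sigma Hs) as HGne.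
    set (c' := fun n => CGamma sigma * c n).
    assert (Hc' : forall n, Cmod (c' n) = (Cmod (CGamma sigma) * Cmod (c n))%R).
    { intros n. apply Cmod_mult. }
    destruct (weighted_series p lambda theta upsilon hlambda hB c' B) as [HS' HI'].
    + intros r Hr. apply (ex_series_ext (fun n => (Cmod (CGamma sigma) * (Cmod (c n) * r ^ n))%R)).
      { intros n. rewrite Hc'. rring. }
      apply: ex_series_scal. now apply Hc.
    + exact HB'.
    + apply (ex_series_ext (fun n => (Cmod (CGamma sigma) * (Cmod (c n) * B n))%R)).
      { intros n. rewrite Hc'. rring. }
      now apply: ex_series_scal.
    + rewrite HL, HI'.
      * replace (CSeries (fun n => c' n * ext_beta (theta + RtoC (INR n)) (upsilon - theta) p lambda))
          with (CGamma sigma * CSeries l).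
        -- unfold Cdiv. rewrite Cinv_mult_total.
           transitivity (CGamma sigma * / CGamma sigma * (/ CBeta theta (upsilon - theta) * CSeries l));
             [rewrite Cinv_r by auto; ring|ring].
        -- symmetry. apply is_Cseries_unique.
           eapply is_Cseries_ext; [|apply (is_Cseries_scal (CGamma sigma) _ _ HS)].
           intros n. cbv beta. unfold l, c'. ring.
      * intros x Hx.
        assert (Hzx : (Cmod (z * RtoC (phi x)) < 1)%R).
        { destruct (phi_D01 x Hx) as [h1 h2]. rewrite Cmod_mult, Cmod_R, Rabs_pos_eq by lra.
          apply Rle_lt_trans with (1 * phi x)%R; [|lra]. apply Rmult_le_compat_r; lra. }
        rewrite (goyal_laddha_integral gamma (z * RtoC (phi x)) sigma a Hs Hra Hzx
          (weight0oo p lambda theta upsilon x)).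
        -- f_equal. rewrite HG by auto. symmetry. apply is_Cseries_unique.
           eapply is_Cseries_ext; [|apply (is_Cseries_scal (CGamma sigma) (fun n => c n * RtoC (phi x ^ n)))].
           ++ intros n. cbv beta. unfold c'. ring.
           ++ apply (Cseries_abs _ (fun n => (Cmod (c n) * phi x ^ n)%R)).
              ** intros n. destruct (phi_D01 x Hx) as [h1 h2].
                 rewrite Cmod_mult, Cmod_R, Rabs_pos_eq; [apply Rle_refl|]. pos.
              ** apply Hc. destruct (phi_D01 x Hx); lra.
        -- intros t Ht. unfold double_integrand, weight0oo, gamma_kernel.
           rewrite (Cpower_pos t) by auto.
           replace (z * RtoC x * RtoC (exp (- t)) / RtoC (1 + x)) with
             (z * RtoC (phi x) * RtoC (exp (- t))).
           ++ unfold Cdiv. ring.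
           ++ rewrite <- Hw by auto. unfold Cdiv. ring.
Qed.
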